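(* Let $T_4$ be the unique (up to isometry) triangle in the hyperbolic plane $\mathbb{H}^2$ with all three angles equal to $\pi/4$, and let $\Gamma_{T_4}$ be the group of isometries of $\mathbb{H}^2$ generated by the reflections in the three sides of $T_4$; equivalently, $\Gamma_{T_4}$ is the group with presentation $\langle s_1,s_2,s_3 \mid s_i^2,\ (s_is_{i+1})^4 \ (i=1,2,3)\rangle$, indices being taken cyclically. Then there exists an ergodic diffuse invariant random subgroup of $\Gamma_{T_4}$.
   Context: For a countable discrete group $\Gamma$, let $\mathrm{Sub}_\Gamma$ be the space of subgroups of $\Gamma$ with the Chabauty topology (the topology induced from the product topology on $\{0,1\}^\Gamma$); $\Gamma$ acts on it by conjugation. An invariant random subgroup (IRS) of $\Gamma$ is a Borel probability measure on $\mathrm{Sub}_\Gamma$ which is invariant under conjugation by elements of $\Gamma$. It is ergodic if every conjugation-invariant Borel subset of $\mathrm{Sub}_\Gamma$ has measure $0$ or $1$. An IRS $\mu$ is diffuse if for every subgroup $H$ in the support of $\mu$, the set of subgroups of $\Gamma$ that are isomorphic (as abstract groups) to $H$ has $\mu$-measure zero. *)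

(* Defs.v *)
From HB Require Import structures.
From mathcomp Require Import all_boot all_order all_algebra.
From mathcomp Require Import all_classical all_reals all_analysis.
From mathcomp Require Import ring lra.

Set Implicit Arguments.
Unset Strict Implicit.
Unset Printing Implicit Defensive.
Import Order.TTheory GRing.Theory Num.Theory.
Local Open Scope classical_set_scope.
Local Open Scope ring_scope.

Section InvariantRandomSubgroups.
Variable G : groupType.

(* [set_type] carries the topology induced from its ambient space, here the
   product {0,1}^G, so [Sub] is the Chabauty space. *)
Definition subgroups : set {ptws G -> bool} :=
  [set H : G -> bool | group_closed (H : {pred G})].

Definition Sub : Type := set_type subgroups.

HB.instance Definition _ := Topological.on Sub.

Definition sub_pred (H : Sub) : {pred G} := set_val H.

Definition mk_sub (H : {pred G}) (HG : group_closed H) : Sub :=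
  exist _ (H : {ptws G -> bool}) (mem_set (HG : subgroups H)).

Lemma whole_closed : group_closed (predT : {pred G}).
Proof. by split. Qed.

HB.instance Definition _ := isPointed.Build Sub (mk_sub whole_closed).

Lemma conj_closed (g : G) (H : Sub) :
  group_closed [pred x : G | (x ^ g)%g \in sub_pred H].
Proof.
have [H1 HD] : group_closed (sub_pred H) by exact: set_valP.
split=> [|x y]; first by rewrite inE conj1g.
by rewrite !inE => xH yH; rewrite conjMg conjVg; exact: HD.
Qed.

(* [x ^ g] is [g^-1 * x * g], so [conj_sub g H] is g H g^-1. *)
Definition conj_sub (g : G) (H : Sub) : Sub := mk_sub (conj_closed g H).

Definition BorelSub := g_sigma_algebraType (@open Sub).

Definition isomorphic (H K : Sub) : Prop :=
  exists f : G -> G, set_bij [set` sub_pred H] [set` sub_pred K] f /\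
    {in sub_pred H &, {morph f : x y / (x * y)%g}}.

Variables (R : realType) (mu : probability BorelSub R).

Definition is_irs : Prop :=
  forall (g : G) (A : set BorelSub), measurable A ->
    mu (conj_sub g @^-1` A) = mu A.

Definition ergodic : Prop :=
  forall A : set BorelSub, measurable A ->
    (forall g : G, conj_sub g @^-1` A = A) -> mu A = 0%E \/ mu A = 1%E.

Definition measure_support : set Sub :=
  [set H | forall U : set Sub, open U -> U H -> (0 < mu U)%E].

(* An isomorphism class is not known a priori to be Borel, so measure zero means
   being contained in a Borel null set. *)
Definition diffuse : Prop :=
  forall H : Sub, measure_support H -> mu.-negligible [set K | isomorphic H K].

End InvariantRandomSubgroups.

Section GeneratedSubgroup.
Variables (G : groupType) (S : set G).

Definition generated : set G :=
  smallest (fun H : set G => group_closed [pred x | x \in H]) S.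

Lemma generated_closed : group_closed [pred x | x \in generated].
Proof.
have E (H : set G) x : (x \in [pred x | x \in H]) = (x \in H) by [].
split=> [|x y]; rewrite !E.
  by apply/mem_set => H [[H1 _] _]; apply/set_mem.
move=> /set_mem gx /set_mem gy; apply/mem_set => H HS.
have [[_ HD] _] := HS; apply/set_mem; rewrite -E.
by apply: HD; rewrite E; apply/mem_set; [exact: gx | exact: gy].
Qed.

Definition generated_group : Type := set_type generated.

HB.instance Definition _ := SubChoice.on generated_group.
HB.instance Definition _ :=
  SubChoice_isSubGroup.Build G (fun x => x \in generated) generated_group
    generated_closed.

End GeneratedSubgroup.

Section HyperbolicPlane.
Variable R : realType.

(* The Lorentz form of signature (2, 1); coordinate 0 is the negative one. *)
Definition lorentz (x y : 'rV[R]_3) : R :=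
  - (x 0 0 * y 0 0) + \sum_(i < 2) x 0 (lift ord0 i) * y 0 (lift ord0 i).

Definition hyperboloid : set 'rV[R]_3 :=
  [set x | lorentz x x = -1 /\ 0 < x 0 0].

Definition H2 : Type := set_type hyperboloid.

Definition arcosh (t : R) : R := ln (t + Num.sqrt (t ^+ 2 - 1)).

Definition hdist (p q : H2) : R := arcosh (- lorentz (set_val p) (set_val q)).

Definition isometries : set (H2 -> H2) :=
  [set f : H2 -> H2 | bijective f /\ forall p q, hdist (f p) (f q) = hdist p q].

Definition isometry : Type := set_type isometries.

HB.instance Definition _ := Choice.on isometry.

Definition isom_fun (f : isometry) : H2 -> H2 := set_val f.

Definition mk_isom (f : H2 -> H2) (hf : isometries f) : isometry :=
  exist _ f (mem_set hf).

Lemma isometry_id : isometries id.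
Proof. by split=> //; exists id. Qed.

Lemma isometry_comp (f g : isometry) : isometries (isom_fun f \o isom_fun g).
Proof.
have [fb fd] : isometries (isom_fun f) by exact: set_valP.
have [gb gd] : isometries (isom_fun g) by exact: set_valP.
split; first exact: bij_comp.
by move=> p q /=; rewrite fd gd.
Qed.

Lemma isometry_inv (f : isometry) :
  exists g : isometry, cancel (isom_fun f) (isom_fun g) /\
    cancel (isom_fun g) (isom_fun f).
Proof.
have [[g fK gK] fd] : isometries (isom_fun f) by exact: set_valP.
have gP : isometries g; last by exists (mk_isom gP).
split; first by exists (isom_fun f).
by move=> p q; rewrite -fd !gK.
Qed.

Definition isom_one : isometry := mk_isom isometry_id.
Definition isom_mul (f g : isometry) : isometry := mk_isom (isometry_comp f g).
Definition isom_inv (f : isometry) : isometry := projT1 (cid (isometry_inv f)).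

Lemma isom_ext (f g : isometry) : isom_fun f =1 isom_fun g -> f = g.
Proof. by move=> /funext fg; exact: val_inj. Qed.

Lemma isom_mulA : associative isom_mul.
Proof. by move=> f g h; exact: isom_ext. Qed.
Lemma isom_mul1 : left_id isom_one isom_mul.
Proof. by move=> f; exact: isom_ext. Qed.
Lemma isom_1mul : right_id isom_one isom_mul.
Proof. by move=> f; exact: isom_ext. Qed.
Lemma isom_mulV : left_inverse isom_one isom_inv isom_mul.
Proof.
by move=> f; apply: isom_ext; exact: (projT2 (cid (isometry_inv f))).1.
Qed.
Lemma isom_Vmul : right_inverse isom_one isom_inv isom_mul.
Proof.
by move=> f; apply: isom_ext; exact: (projT2 (cid (isometry_inv f))).2.
Qed.

HB.instance Definition _ := isGroup.Build isometry
  isom_mulA isom_mul1 isom_1mul isom_mulV isom_Vmul.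

(* Geodesic lines are the sets of points of H2 orthogonal to a unit spacelike
   vector n. *)
Definition on_line (n : 'rV[R]_3) (p : H2) : Prop :=
  lorentz n n = 1 /\ lorentz n (set_val p) = 0.

Definition is_reflection (n : 'rV[R]_3) (s : isometry) : Prop :=
  forall p : H2, set_val (isom_fun s p) =
    set_val p - (2 * lorentz n (set_val p)) *: n.

(* The tangent vector at p (orthogonal to p) of the geodesic from p to q; the
   Riemannian metric is the restriction of the Lorentz form. *)
Definition direction (p q : H2) : 'rV[R]_3 :=
  set_val q + lorentz (set_val p) (set_val q) *: set_val p.

(* The angle at p between the geodesics from p to q and from p to r. *)
Definition angle (p q r : H2) : R :=
  let u := direction p q in let w := direction p r in
  acos (lorentz u w / (Num.sqrt (lorentz u u) * Num.sqrt (lorentz w w))).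

(* A triangle is given by its vertices; indices are taken modulo 3. *)
Definition is_triangle (T : 'I_3 -> H2) : Prop :=
  ~ exists n, forall i, on_line n (T i).

Definition is_T4 (T : 'I_3 -> H2) : Prop :=
  is_triangle T /\ forall i, angle (T i) (T (i + 1)) (T (i + 2)) = pi / 4.

(* The i-th side is the one opposite to the i-th vertex. *)
Definition side_reflections (T : 'I_3 -> H2) : set isometry :=
  [set s | exists i n, (forall j, j != i -> on_line n (T j)) /\
    is_reflection n s].

Definition reflection_group (T : 'I_3 -> H2) : groupType :=
  generated_group (side_reflections T).

Lemma lorentzE (x y : 'rV[R]_3) :
  lorentz x y = - (x 0 0 * y 0 0) + x 0 1 * y 0 1 + x 0 2 * y 0 2.
Proof.
rewrite /lorentz big_ord_recl big_ord1 addrA.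
by congr (_ + x 0 _ * y 0 _ + x 0 _ * y 0 _); apply: val_inj.
Qed.

Lemma angle_equilateral (p q r : H2) (C : R) : 0 < C ->
  lorentz (set_val p) (set_val q) = - (C + 1) ->
  lorentz (set_val p) (set_val r) = - (C + 1) ->
  lorentz (set_val q) (set_val r) = - (C + 1) ->
  angle p q r = acos ((C + 1) / (C + 2)).
Proof.
move=> C0 pq pr qr.
have H (x : H2) : lorentz (set_val x) (set_val x) = -1.
  by have [] : hyperboloid (set_val x) by exact: set_valP.
have B (u v : H2) : lorentz (direction p u) (direction p v) =
    lorentz (set_val u) (set_val v) +
    lorentz (set_val p) (set_val u) * lorentz (set_val p) (set_val v).
  transitivity (lorentz (set_val u) (set_val v) +
    lorentz (set_val p) (set_val u) * lorentz (set_val p) (set_val v) *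
    (2 + lorentz (set_val p) (set_val p))).
    rewrite /direction; move: (set_val p) (set_val u) (set_val v) => a b c.
    rewrite !lorentzE !mxE; ring.
  by rewrite H; ring.
rewrite /angle /= !B pq pr qr !H -[Num.sqrt _ * _]expr2 sqr_sqrtr; last by nra.
have C1 : C != 0 by exact: lt0r_neq0.
have C2 : C + 2 != 0 by apply: lt0r_neq0; lra.
by congr acos; field; apply/andP; split; apply: lt0r_neq0; nra.
Qed.

Definition mk_point (x : 'rV[R]_3) (h : hyperboloid x) : H2 :=
  exist _ x (mem_set h).

Definition vec (x y z : R) : 'rV[R]_3 :=
  \row_j (if j == 0 then x else if j == 1 then y else z).

Lemma vecE x y z x' y' z' :
  lorentz (vec x y z) (vec x' y' z') = - (x * x') + y * y' + z * z'.
Proof. by rewrite lorentzE !mxE. Qed.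

Lemma ord3 (P : 'I_3 -> Prop) : P 0 -> P 1 -> P 2 -> forall i, P i.
Proof.
move=> P0 P1 P2; case=> [[|[|[|//]]]] h.
- by have -> : Ordinal h = 0 by exact: val_inj.
- by have -> : Ordinal h = 1 by exact: val_inj.
- by have -> : Ordinal h = 2 by exact: val_inj.
Qed.

Lemma T4_exists : exists T : 'I_3 -> H2, is_T4 T.
Proof.
pose a : R := Num.sqrt 2; pose s := Num.sqrt (2 * a / 3).
pose t := s * Num.sqrt 3 / 2; pose c := Num.sqrt (1 + 2 * a / 3).
have a0 : 0 < a by rewrite sqrtr_gt0; lra.
have a2 : a ^+ 2 = 2 by rewrite sqr_sqrtr; lra.
have s0 : 0 < s by rewrite sqrtr_gt0; lra.
have s2 : s ^+ 2 = 2 * a / 3 by rewrite sqr_sqrtr; lra.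
have t0 : 0 < t by rewrite !mulr_gt0 ?sqrtr_gt0 ?invr_gt0; lra.
have t2 : t ^+ 2 = a / 2.
  by rewrite /t expr_div_n exprMn s2 sqr_sqrtr; [field|lra].
have c0 : 0 < c by rewrite sqrtr_gt0; lra.
have c2 : c ^+ 2 = 1 + 2 * a / 3 by rewrite sqr_sqrtr; lra.
have h0 : hyperboloid (vec c s 0).
  by split; [rewrite vecE; lra | rewrite mxE].
have h1 : hyperboloid (vec c (- s / 2) t).
  by split; [rewrite vecE; lra | rewrite mxE].
have h2 : hyperboloid (vec c (- s / 2) (- t)).
  by split; [rewrite vecE; lra | rewrite mxE].
exists (fun i => if i == 0 then mk_point h0
  else if i == 1 then mk_point h1 else mk_point h2).
split.
  case=> n hn; have [nn +] := hn 0; have [_ +] := hn 1; have [_ +] := hn 2.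
  rewrite /= !set_valE /= !lorentzE !mxE /= => e2 e1 e0.
  have n0 : n 0 0 = 0 by apply: (@mulfI _ c); nra.
  have n1 : n 0 1 = 0 by apply: (@mulfI _ s); nra.
  have n2 : n 0 2 = 0 by apply: (@mulfI _ t); nra.
  by move: nn; rewrite lorentzE n0 n1 n2; lra.
have key : acos ((a + 1) / (a + 2)) = pi / 4 :> R.
  have -> : (a + 1) / (a + 2) = cos (pi / 4) :> R.
    have cp : 0 < cos (pi / 4 : R).
      by apply: cos_gt0_pihalf; have := @pi_gt0 R; lra.
    have c4 : cos (pi / 4 : R) ^+ 2 = 1 / 2.
      have := cos_mulr2n (pi / 4 : R).
      rewrite (_ : pi / 4 *+ 2 = pi / 2) ?cos_pihalf; last by field.
      by lra.
    have ap : 0 < (a + 1) / (a + 2) by apply: divr_gt0; lra.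
    apply/eqP; rewrite -(@eqrXn2 _ 2) ?ltW //.
    rewrite c4; apply/eqP; rewrite expr_div_n.
    have -> : (a + 1) ^+ 2 = 3 + 2 * a by rewrite sqrrD a2; ring.
    have -> : (a + 2) ^+ 2 = 2 * (3 + 2 * a) by rewrite sqrrD a2; ring.
    by field; apply/lt0r_neq0; lra.
  rewrite cosK // in_itv /=; have := @pi_gt0 R; lra.
have E p q r : lorentz (set_val p) (set_val q) = - (a + 1) ->
  lorentz (set_val p) (set_val r) = - (a + 1) ->
  lorentz (set_val q) (set_val r) = - (a + 1) -> angle p q r = pi/4.
  by rewrite -key; exact: angle_equilateral.
apply: ord3; apply: E; rewrite /= !set_valE /= vecE; lra.
Qed.

End HyperbolicPlane.

(* Main.v *)
Require Import Defs.
From HB Require Import structures.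
From mathcomp Require Import all_boot all_order all_algebra.
From mathcomp Require Import all_classical all_reals all_analysis.
From mathcomp Require Import ring lra zify.

(** Write s_0, s_1, s_2 for the reflections in the sides of the triangle. The
    random subgroup is the stabiliser of a random point of a random set on which
    the three involutions act compatibly with the relations
    s_i^2 = (s_i s_j)^4 = 1. That set consists of triangles, glued along their
    sides as prescribed by tables: the triangles are grouped into blocks of
    twenty, the blocks are placed along a line indexed by the integers, and a
    fair coin tossed independently for every block selects one of two gluing
    patterns. The base point is uniform among the twenty triangles of block 0.
    The generator s_i moves a triangle to its neighbour across its side i, or
    fixes it when that side lies on the boundary. The boundary contains an
    infinite chain of sides, five per block; consecutive sides e and e + 1 meet
    at an angle pi/4, except at one corner per block, whose angle is pi/2 and
    whose position in the block is dictated by the coin ([right_angled]).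

    Invariance ([irs_invariant]). Each generator permutes the triangles of a
    block, up to exchanging the last triangle of a block with the first one of
    the next block, and the law of the coins is invariant under translation.

    Ergodicity ([irs_ergodic]). The blocks are connected, so the event that the
    stabiliser belongs to an invariant set of subgroups does not depend on the
    base triangle, and it is a translation-invariant event for the coins. Such
    an event has probability 0 or 1 because the Bernoulli shift is mixing
    ([bern_ergodic]).

    Diffuseness ([irs_diffuse]). The main point is that the isomorphism type of
    the stabiliser determines the coins up to countably many possibilities
    ([rigidity]): from the stabiliser, as an abstract group, one reads off the
    sequence of angles along the chain, up to a translation and a flip. Reading
    it off requires to recognise the reflections in the sides of the chain:
    - two involutions whose product has order 4 are, simultaneously, conjugate
      to two of the generators ([acute_pair]), so that they are the reflections
      in the two sides at a corner of angle pi/4;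
    - two commuting reflections in distinct sides of the chain come from a corner
      of angle pi/2 ([commuting_pair_sides]);
    - reflections in the same side of the chain are conjugate in the stabiliser
      ([on_side_conj]), and the parity of the number of crossings of a side
      separates different sides ([on_side_crossing_parity]).
    The first item is an instance of the theorem that a finite subgroup of a
    Coxeter group is conjugate into a finite parabolic subgroup
    ([finite_dihedral]). It is proved with the action on weights: the sum of the
    translates of an interior point of the chamber is fixed and non-zero, and
    stabilisers of points of the chamber are generated by simple reflections.
    A given sequence of coins has probability zero, and the set of all the
    stabilisers is compact, hence Borel, and its complement is null; so each
    isomorphism class is contained in the union of that complement with a
    countable null set.

    The reflection group of the triangle enters only through the fact that its
    generators satisfy the relations above and no others ([gen_generators]): the
    Gram matrix of the unit normals of the sides has entries 1 and
    - (sqrt 2) / 2, so their span carries the geometric representation, which is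
    faithful ([geometric_faithful]).

    A finite sequence of mechanical verifications, carried out by evaluation,
    checks the gluing tables. Each of them concerns a triangle and paths that
    stay in its block and the two neighbouring ones. *)

Set Implicit Arguments.
Unset Strict Implicit.
Unset Printing Implicit Defensive.
Import Order.TTheory GRing.Theory Num.Theory.
Import numFieldNormedType.Exports.
Local Open Scope ring_scope.

(** * Words in three involutions whose products have order four *)

Notation word := (seq 'I_3).

Definition act (Y : Type) (a : 'I_3 -> Y -> Y) (w : word) (y : Y) : Y :=
  foldr a y w.

Definition coxeter_action (Y : Type) (a : 'I_3 -> Y -> Y) : Prop :=
  (forall i, involutive (a i)) /\
  (forall i j y, iter 4 (fun z => a i (a j z)) y = y).

(** Two words represent the same element of the Coxeter group when they act in
    the same way in every set where the relations hold; the group itself need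
    not be constructed. *)
Definition weq (w w' : word) : Prop :=
  forall (Y : Type) (a : 'I_3 -> Y -> Y), coxeter_action a ->
    act a w =1 act a w'.

Lemma act_cat Y (a : 'I_3 -> Y -> Y) w w' y :
  act a (w ++ w') y = act a w (act a w' y).
Proof. by rewrite /act foldr_cat. Qed.

Lemma act_rcons Y (a : 'I_3 -> Y -> Y) w i y :
  act a (rcons w i) y = act a w (a i y).
Proof. by rewrite -cats1 act_cat. Qed.

Lemma act_revK Y (a : 'I_3 -> Y -> Y) w : coxeter_action a ->
  cancel (act a w) (act a (rev w)).
Proof.
move=> [aK _]; elim: w => [//|i w IH] y.
by rewrite rev_cons act_rcons /= aK IH.
Qed.

Lemma weq_sym w w' : weq w w' -> weq w' w.
Proof. by move=> h Y a ca y; rewrite (h Y a ca). Qed.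

Lemma weq_trans w2 w1 w3 : weq w1 w2 -> weq w2 w3 -> weq w1 w3.
Proof. by move=> h k Y a ca y; rewrite (h Y a ca) (k Y a ca). Qed.

Lemma weq_cat w1 w2 w1' w2' : weq w1 w1' -> weq w2 w2' ->
  weq (w1 ++ w2) (w1' ++ w2').
Proof. by move=> h k Y a ca y; rewrite !act_cat (k Y a ca) (h Y a ca). Qed.

Lemma weq_ss i w : weq (i :: i :: w) w.
Proof. by move=> Y a [aK _] y /=; rewrite aK. Qed.

Lemma weq_revl w w' : weq (rev w ++ w ++ w') w'.
Proof. by move=> Y a ca y; rewrite !act_cat act_revK. Qed.

Lemma weq_revr w w' : weq (w ++ rev w ++ w') w'.
Proof. by have := @weq_revl (rev w) w'; rewrite revK. Qed.

Lemma weq_braid i j : weq [:: i; j; i; j] [:: j; i; j; i].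
Proof.
move=> Y a [aK a4] y /=; have := a4 i j (a j (a i (a j (a i y)))).
by rewrite /= !aK.
Qed.

(** The letters alternate and the last one, applied first, is [e]. Length 4 is
    enough because of the braid relation. *)
Definition alternating (e o : 'I_3) (m : nat) : word :=
  match m with
  | 0 => [::] | 1 => [:: e] | 2 => [:: o; e] | 3 => [:: e; o; e]
  | _ => [:: o; e; o; e]
  end%N.

Lemma alternating_cons (e o x : 'I_3) m : x \in [:: e; o] -> (m <= 4)%N ->
  exists m', (m' <= minn 4 m.+1)%N /\
    (weq (x :: alternating e o m) (alternating e o m') \/
     weq (x :: alternating e o m) (alternating o e m')).
Proof.
have K w : weq w w by [].
have B : weq [:: e; o; e; o; e] [:: o; e; o].
  apply: (@weq_trans [:: e; e; o; e; o]); last exact: weq_ss.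
  by apply: (@weq_cat [:: e] _ [:: e]) => //; exact: weq_braid.
rewrite !inE => /orP[]/eqP-> ; case: m => [|[|[|[|[|//]]]]] _.
- by exists 1%N; split=> //; left.
- by exists 0%N; split=> //; left; exact: weq_ss.
- by exists 3%N; split=> //; left.
- by exists 2%N; split=> //; left; exact: weq_ss.
- by exists 3%N; split=> //; right.
- by exists 1%N; split=> //; right.
- by exists 2%N; split=> //; left.
- by exists 1%N; split=> //; left; exact: weq_ss.
- by exists 4%N; split=> //; left.
- by exists 3%N; split=> //; left; exact: weq_ss.
Qed.

(** Cancelling and braiding bring any word in two letters to an alternating one;
    the bound by the length of the word is what makes inductions on length work. *)
Lemma dihedral_normal_form (s t : 'I_3) (u : word) :
  all (mem [:: s; t]) u -> exists m, (m <= minn 4 (size u))%N /\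
    (weq u (alternating s t m) \/ weq u (alternating t s m)).
Proof.
elim: u => [_|x u IH /= /andP[xst /IH[m [mu H]]]]; first by exists 0%N; split=> //; left.
have xts : x \in [:: t; s] by move: xst; rewrite !inE orbC.
move: mu; rewrite leq_min => /andP[m4 mu].
by case: H => H; [have [m' [mm' H']] := alternating_cons xst m4
                 |have [m' [mm' H']] := alternating_cons xts m4];
  exists m'; (split; first by move: mm'; lia);
  case: H' => H'; [left|right|right|left];
  apply: weq_trans H'; apply: (@weq_cat [:: x] _ [:: x]).
Qed.

(** * The geometric representation *)

Section Roots.
Variables (R : realFieldType) (r : R).
Hypotheses (r_gt0 : 0 < r) (r2 : r * r = 2).
Implicit Types (v p : 'rV[R]_3) (i j : 'I_3) (w : word).

(** The Cartan matrix for the angles pi/4, with r standing for the square root of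
    2, and the reflections in the simple roots. *)
Definition cox i j : R := if i == j then 2 else - r.
Definition root i : 'rV[R]_3 := delta_mx 0 i.
Definition coroot i v : R := \sum_j cox i j * v 0 j.
Definition rrefl i v : 'rV[R]_3 := v - coroot i v *: root i.

Lemma corootD i u v : coroot i (u + v) = coroot i u + coroot i v.
Proof. by rewrite -big_split; apply: eq_bigr => j _; rewrite mxE mulrDr. Qed.

Lemma corootZ i a v : coroot i (a *: v) = a * coroot i v.
Proof. by rewrite mulr_sumr; apply: eq_bigr => j _; rewrite mxE mulrCA. Qed.

Lemma corootN i v : coroot i (- v) = - coroot i v.
Proof. by rewrite -scaleN1r corootZ mulN1r. Qed.

Lemma coroot_root i j : coroot i (root j) = cox i j.
Proof.
rewrite /coroot (bigD1 j) //= mxE !eqxx mulr1 big1 ?addr0 // => k kj.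
by rewrite mxE eqxx (negPf kj) mulr0.
Qed.

Lemma coxii i : cox i i = 2. Proof. by rewrite /cox eqxx. Qed.
Lemma coxij i j : i != j -> cox i j = - r. Proof. by rewrite /cox => /negPf->. Qed.

Lemma coroot_rrefl i j v : coroot j (rrefl i v) = coroot j v - coroot i v * cox j i.
Proof. by rewrite corootD corootN corootZ coroot_root. Qed.

Lemma rreflK i : involutive (rrefl i).
Proof.
move=> v; rewrite {1}/rrefl coroot_rrefl coxii /rrefl.
by apply/rowP => k; rewrite !mxE; ring.
Qed.

Lemma rrefl_lin i a u v : rrefl i (a *: u + v) = a *: rrefl i u + rrefl i v.
Proof.
rewrite /rrefl corootD corootZ scalerDl scalerBr scalerA opprD.
by rewrite addrACA.
Qed.

Lemma rrefl_rot2 i j v : i != j ->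
  rrefl i (rrefl j (rrefl i (rrefl j v))) =
  v - (2 * coroot i v + r * coroot j v) *: root i
    - (2 * coroot j v + r * coroot i v) *: root j.
Proof.
move=> ij; have ji : j != i by rewrite eq_sym.
set x := coroot i v; set y := coroot j v.
have E1 : coroot i (rrefl j v) = x + r * y.
  by rewrite coroot_rrefl coxij // -/x -/y; ring.
have E1' : coroot j (rrefl j v) = - y.
  by rewrite coroot_rrefl coxii -/x -/y; ring.
have E2 : coroot j (rrefl i (rrefl j v)) = y + r * x.
  rewrite coroot_rrefl coxij // E1 E1'.
  transitivity (- y + r * x + r * r * y); first by ring.
  by rewrite r2; ring.
have E2' : coroot i (rrefl i (rrefl j v)) = - (x + r * y).
  by rewrite coroot_rrefl coxii E1; ring.
have E3 : coroot i (rrefl j (rrefl i (rrefl j v))) = x.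
  rewrite coroot_rrefl coxij // E2 E2'.
  transitivity (- x + r * r * x); first by ring.
  by rewrite r2; ring.
rewrite {1}/rrefl E3 {1}/rrefl E2 {1}/rrefl E1 {1}/rrefl -/y.
apply/rowP => k; rewrite !mxE; ring.
Qed.

Lemma rrefl_action : coxeter_action rrefl.
Proof.
split=> [i|i j v]; first exact: rreflK.
rewrite /=; have [<-|ij] := eqVneq i j; first by rewrite !rreflK.
rewrite (rrefl_rot2 _ ij) (rrefl_rot2 v ij).
rewrite !(corootD, corootN, corootZ, coroot_root) !coxii (coxij ij) coxij 1?eq_sym //.
set x := coroot i v; set y := coroot j v.
have E z t : z - (2 * z + r * t) * 2 - (2 * t + r * z) * - r = - z.
  transitivity (- 3 * z + r * r * z); first by ring.
  by rewrite r2; ring.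
have E' z t : z - (2 * t + r * z) * - r - (2 * z + r * t) * 2 = - z.
  by rewrite -[RHS](E z t); ring.
rewrite E E'; apply/rowP => k; rewrite !mxE; ring.
Qed.

Notation ract := (act rrefl).

Lemma ract_lin w a u v : ract w (a *: u + v) = a *: ract w u + ract w v.
Proof. by elim: w => //= i w ->; rewrite rrefl_lin. Qed.

Lemma ract0 w : ract w 0 = 0.
Proof. by have := ract_lin w (-1) 0 0; rewrite scaler0 addr0 scaleN1r addNr. Qed.

Lemma ractN w v : ract w (- v) = - ract w v.
Proof. by have := ract_lin w (-1) v 0; rewrite !addr0 !scaleN1r ract0 addr0. Qed.

Definition nonneg v := forall j, 0 <= v 0 j.

Lemma nonneg_comb a b u v : 0 <= a -> 0 <= b -> nonneg u -> nonneg v ->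
  nonneg (a *: u + b *: v).
Proof. by move=> a0 b0 u0 v0 j; rewrite !mxE addr_ge0 ?mulr_ge0. Qed.

Lemma nonneg_root i : nonneg (root i).
Proof. by move=> j; rewrite mxE eqxx /=; case: (j == i); rewrite ?ler01. Qed.

Lemma rrefl_root i : rrefl i (root i) = - root i.
Proof.
rewrite /rrefl coroot_root coxii (_ : 2 = 1 + 1) // scalerDl scale1r opprD.
by rewrite addrA subrr add0r.
Qed.

Lemma rrefl_root_neq i j : i != j -> rrefl i (root j) = r *: root i + root j.
Proof. by move=> ij; rewrite /rrefl coroot_root coxij // scaleNr opprK addrC. Qed.

Definition positive_or_ends_in w i :=
  nonneg (ract w (root i)) \/
  exists w', (size w' < size w)%N /\ weq w (rcons w' i).

(** The case of [positive_or_shorter] in which a word in two letters has been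
    split off on the right: the rest sends both simple roots to non-negative
    vectors, and the dihedral group of order 8 maps the root of s to a
    non-negative combination of the two simple roots, unless the word can be
    rewritten to end in s. *)
Lemma dihedral_sign (s t : 'I_3) (w v u : word) : s != t ->
  all (mem [:: s; t]) u -> weq w (v ++ u) -> (size v + size u <= size w)%N ->
  nonneg (ract v (root s)) -> nonneg (ract v (root t)) -> positive_or_ends_in w s.
Proof.
move=> st ust wvu szw vs vt.
have ts : t != s by rewrite eq_sym.
have [m [mu H]] := dihedral_normal_form ust.
(* a normal form ending in s exhibits a shorter word *)
have S (u' : word) : (size u' < size u)%N -> weq u (rcons u' s) -> positive_or_ends_in w s.
  move=> lt e; right; exists (v ++ u'); split; first by rewrite size_cat; lia.
  apply: (weq_trans wvu); rewrite rcons_cat.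
  by apply: weq_cat.
have P (u' : word) a b : weq u u' -> ract u' (root s) = a *: root t + b *: root s ->
    0 <= a -> 0 <= b -> positive_or_ends_in w s.
  move=> e E a0 b0; left; rewrite (wvu _ _ rrefl_action) act_cat.
  rewrite (e _ _ rrefl_action) E ract_lin -[b *: _]addr0 ract_lin ract0 addr0.
  exact: nonneg_comb.
have t1 : rrefl t (root s) = r *: root t + 1 *: root s.
  by rewrite rrefl_root_neq // scale1r.
have t2 : rrefl s (r *: root t + 1 *: root s) = r *: root t + 1 *: root s.
  rewrite rrefl_lin rrefl_root_neq // !scale1r rrefl_root scalerDr scalerA r2.
  by rewrite (_ : 2 = 1 + 1) // scalerDl scale1r -!addrA [root s + (_ - _)]addrCA subrr addr0 addrC.
have t3 : rrefl t (r *: root t + 1 *: root s) = 0 *: root t + 1 *: root s.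
  by rewrite -t1 rreflK scale1r scale0r add0r.
have m4 : (m < 5)%N by move: mu; lia.
move: mu m4; case: m H => [|[|[|[|[|//]]]]] /= H mu _; case: H => e.
- by apply: (P _ 0 1 e) => //=; rewrite ?ler01 // scale0r scale1r add0r.
- by apply: (P _ 0 1 e) => //=; rewrite ?ler01 // scale0r scale1r add0r.
- by apply: (S [::]) => //=; lia.
- by apply: (P _ r 1 e) => //=; rewrite ?ler01 // ltW.
- by apply: (S [:: t]) => //=; lia.
- by apply: (P _ r 1 e) => //=; rewrite ?ler01 ?(ltW r_gt0) // t1 t2.
- by apply: (S [:: s; t]) => //=; lia.
- by apply: (P _ 0 1 e) => //=; rewrite ?ler01 // t1 t2 t3.
- by apply: (S [:: t; s; t]) => //=; lia.
- apply: (S [:: t; s; t]) => /=; first lia.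
  by apply: (weq_trans e); exact: weq_braid.
Qed.

(** The basic fact on Coxeter groups: the image of a simple root is positive, or
    the word can be shortened by moving that reflection to its end. The
    induction peels off the longest right factor using only i and the last
    letter of the word, then applies [dihedral_sign]. *)
Lemma positive_or_shorter w i : positive_or_ends_in w i.
Proof.
have [n] := ubnP (size w); elim: n w i => // n IH w i.
rewrite ltnS => szw.
have [->|[w1 [t ew]]] : w = [::] \/ exists w1 t, w = rcons w1 t.
- by case/lastP: w {szw} => [|w1 t]; [left|right; exists w1, t].
- by left => /=; exact: nonneg_root.
have [<-{i}|it] := eqVneq t i.
  by right; exists w1; rewrite ew size_rcons.
(* Here u uses the letters i and t only; if v can end in one of them, that letter is
   transferred to u and v becomes shorter. *)
have inner k : forall v u : word, (size v <= k)%N -> (size v < size w)%N ->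
    (size v + size u <= size w)%N -> all (mem [:: i; t]) u ->
    weq w (v ++ u) -> positive_or_ends_in w i.
  elim: k => [|k IHk] v u vk vw szvu ust e;
    (have IHv j : positive_or_ends_in v j by apply: IH; lia);
    have [vi|[v' [lv' ev']]] := IHv i; try (by move: lv'; lia);
    have [vt|[v'' [lv'' ev'']]] := IHv t; try (by move: lv''; lia).
  - by apply: (dihedral_sign _ ust e) => //; rewrite eq_sym.
  - by apply: (dihedral_sign _ ust e) => //; rewrite eq_sym.
  - apply: (IHk v'' (t :: u)) => /=; try lia.
      by rewrite !inE eqxx orbT.
    by apply: (weq_trans e); rewrite -cat_rcons; exact: weq_cat.
  - apply: (IHk v' (i :: u)) => /=; try lia.
      by rewrite !inE eqxx.
    by apply: (weq_trans e); rewrite -cat_rcons; exact: weq_cat.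
  - apply: (IHk v' (i :: u)) => /=; try lia.
      by rewrite !inE eqxx.
    by apply: (weq_trans e); rewrite -cat_rcons; exact: weq_cat.
apply: (inner (size w1) w1 [:: t]); rewrite ?ew ?size_rcons /= ?addn1 //.
  by rewrite !inE eqxx orbT.
by rewrite cats1.
Qed.

Lemma ract_root_neq0 w i : ract w (root i) != 0.
Proof.
apply/eqP => h; have := act_revK w rrefl_action (root i).
rewrite h ract0 => /rowP /(_ i); rewrite !mxE !eqxx /= => /eqP.
by rewrite eq_sym oner_eq0.
Qed.

Lemma nonneg_pm v : nonneg v -> nonneg (- v) -> v = 0.
Proof.
move=> p n; apply/rowP => j; have := p j; have := n j; rewrite !mxE oppr_ge0.
by move=> a b; apply/eqP; rewrite eq_le a b.
Qed.

Lemma root_sign w i : nonneg (ract w (root i)) \/ nonneg (- ract w (root i)).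
Proof.
have [n] := ubnP (size w); elim: n w => // n IH w; rewrite ltnS => szw.
have [|[w' [lt e]]] := positive_or_shorter w i; first by left.
rewrite (e _ _ rrefl_action) act_rcons rrefl_root ractN opprK.
by case: (IH w'); [lia|right|left].
Qed.

(** A word that fixes all simple roots sends the last of them to a negative root
    once its last letter is removed, so it can be shortened indefinitely. *)
Lemma geometric_faithful w : (forall i, ract w (root i) = root i) -> weq w [::].
Proof.
have [n] := ubnP (size w); elim: n w => // n IH w; rewrite ltnS => szw fix_w.
case/lastP: w szw fix_w => [//|w1 s]; rewrite size_rcons => szw fix_w.
have E : ract w1 (root s) = - root s.
  by have := fix_w s; rewrite act_rcons rrefl_root ractN => /eqP; rewrite eqr_oppLR => /eqP.
have [p|[w' [lt e]]] := positive_or_shorter w1 s.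
  have /(nonneg_pm p)/eqP : nonneg (- ract w1 (root s)).
    by rewrite E opprK; exact: nonneg_root.
  by rewrite (negPf (ract_root_neq0 _ _)).
have e' : weq (rcons w1 s) w'.
  move=> Y a ca y; rewrite act_rcons (e _ _ ca) act_rcons.
  by have [aK _] := ca; rewrite aK.
apply: (weq_trans e'); apply: IH; first lia.
by move=> i; rewrite -(e' _ _ rrefl_action).
Qed.

(** * The dual representation and finite dihedral subgroups *)

Implicit Types (a b q : 'rV[R]_3) (k : 'I_3).
(** Weights are described by their values on the simple roots, so the chamber is
    the set of vectors with non-negative coordinates. *)
Definition pairing p a : R := \sum_j p 0 j * a 0 j.
Definition wrefl i p : 'rV[R]_3 := \row_j (p 0 j - cox i j * p 0 i).
Notation wact := (act wrefl).

Lemma pairing_root p i : pairing p (root i) = p 0 i.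
Proof.
rewrite /pairing (bigD1 i) //= mxE !eqxx mulr1 big1 ?addr0 // => k ki.
by rewrite mxE eqxx (negPf ki) mulr0.
Qed.

Lemma pairing_wrefl i p a : pairing (wrefl i p) a = pairing p (rrefl i a).
Proof.
transitivity (pairing p a - p 0 i * coroot i a).
  rewrite /pairing /coroot mulr_sumr -sumrN -big_split; apply: eq_bigr => j _.
  by rewrite mxE /=; ring.
rewrite -[p 0 i]pairing_root /pairing mulr_suml -sumrN -big_split.
by apply: eq_bigr => j _; rewrite !mxE /=; ring.
Qed.

Lemma pairing_wact w p a : pairing (wact w p) a = pairing p (ract (rev w) a).
Proof.
elim: w a => //= i w IH a.
by rewrite pairing_wrefl IH rev_cons act_rcons.
Qed.

Lemma pairing_ext p q : (forall a, pairing p a = pairing q a) -> p = q.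
Proof. by move=> h; apply/rowP => j; rewrite -!pairing_root. Qed.

Lemma wrefl_action : coxeter_action wrefl.
Proof.
have [rK r4] := rrefl_action.
split=> [i p|i j p]; apply: pairing_ext => a; rewrite /= !pairing_wrefl ?rK //.
by have /= -> := r4 j i a.
Qed.

Lemma wreflD i p q : wrefl i (p + q) = wrefl i p + wrefl i q.
Proof. by apply/rowP => j; rewrite !mxE; ring. Qed.

Lemma wactD w p q : wact w (p + q) = wact w p + wact w q.
Proof. by elim: w => //= i w ->; rewrite wreflD. Qed.

Lemma pairingDl p q a : pairing (p + q) a = pairing p a + pairing q a.
Proof. by rewrite -big_split; apply: eq_bigr => j _; rewrite mxE mulrDl. Qed.

Lemma pairingN p a : pairing p (- a) = - pairing p a.
Proof. by rewrite -sumrN; apply: eq_bigr => j _; rewrite mxE mulrN. Qed.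

Lemma pairing_ge0 p a : nonneg p -> nonneg a -> 0 <= pairing p a.
Proof. by move=> p0 a0; apply: sumr_ge0 => j _; rewrite mulr_ge0. Qed.

(** The invariant form of signature (2, 1): it serves to show that the only
    positive root proportional to a simple root is that root itself. *)
Definition qform a : R := \sum_i a 0 i * coroot i a.

Lemma qform_rrefl i a : qform (rrefl i a) = qform a.
Proof.
set c := coroot i a.
have coxC j k : cox j k = cox k j by rewrite /cox eq_sym.
transitivity (\sum_j (a 0 j * coroot j a + (- c) * (cox i j * a 0 j)
    + pairing (root j) (root i) * (2 * (c * c) - c * coroot j a))).
  have E j : (rrefl i a) 0 j = a 0 j - c * pairing (root j) (root i).
    rewrite /rrefl mxE pairing_root !mxE; congr (_ - _ * _).
    by rewrite eqxx /= [in RHS]eq_sym.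
  apply: eq_bigr => j _; rewrite E coroot_rrefl -/c coxC pairing_root !mxE eqxx /=.
  have [<-|ji] := eqVneq i j; rewrite ?coxii /=; last by rewrite !mulr0 !mul0r !subr0 !addr0; ring.
  by rewrite -/c; ring.
rewrite !big_split /= -mulr_sumr -/(coroot i a) -/c.
rewrite [X in _ + X](_ : _ = 2 * (c * c) - c * c); first by rewrite /qform; ring.
rewrite (bigD1 i) //= pairing_root mxE !eqxx mul1r big1 ?addr0 // => j ji.
by rewrite pairing_root mxE eqxx /= [i == j]eq_sym (negPf ji) mul0r.
Qed.

Lemma qform_ract w a : qform (ract w a) = qform a.
Proof. by elim: w => //= i w <-; rewrite qform_rrefl. Qed.

Lemma qform_scale_root c i : qform (c *: root i) = 2 * (c * c).
Proof.
rewrite /qform (bigD1 i) //= corootZ coroot_root coxii !mxE !eqxx /= big1 ?addr0 => [|j ji].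
  by ring.
by rewrite !mxE eqxx (negPf ji) mulr0 mul0r.
Qed.

Definition is_root a := exists w i, a = ract w (root i).

Lemma is_root_rrefl i a : is_root a -> is_root (rrefl i a).
Proof. by move=> [w [j ->]]; exists (i :: w), j. Qed.

Lemma is_root_simple i : is_root (root i).
Proof. by exists [::], i. Qed.

Lemma is_root_sign a : is_root a -> nonneg a \/ nonneg (- a).
Proof. by move=> [w [i ->]]; exact: root_sign. Qed.

(** A simple reflection changes a single coordinate, so a positive root that it
    makes negative is proportional to the simple root, and equal to it because
    the two have the same norm. *)
Lemma rrefl_negative i a : is_root a -> nonneg a -> nonneg (- rrefl i a) -> a = root i.
Proof.
move=> ra a0 n0.
have aj j : j != i -> a 0 j = 0.
  move=> ji; have := n0 j; have := a0 j; rewrite !mxE eqxx (negPf ji) mulr0 subr0.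
  by rewrite oppr_ge0 => x y; apply/eqP; rewrite eq_le x y.
have E : a = a 0 i *: root i.
  apply/rowP => j; rewrite !mxE eqxx /=.
  by have [->|ji] := eqVneq j i; rewrite ?mulr1 // mulr0 aj.
have : qform a = 2.
  have [w [j ->]] := ra; rewrite qform_ract.
  by have := qform_scale_root 1 j; rewrite scale1r !mulr1.
rewrite E qform_scale_root => q2.
have /eqP : (a 0 i - 1) * (a 0 i + 1) = 0 by have : a 0 i * a 0 i = 1; [lra|nra].
rewrite mulf_eq0 => /orP[/eqP h|/eqP h].
  by rewrite (_ : a 0 i = 1) ?scale1r //; lra.
by exfalso; have := a0 i; lra.
Qed.

(** This list contains all positive roots made negative by the inverse of w,
    possibly among other vectors; only its finiteness matters. *)
Fixpoint inversions w : seq 'rV[R]_3 :=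
  if w is i :: w' then root i :: map (rrefl i) (inversions w') else [::].

Lemma inversionsP w a : is_root a -> nonneg a -> nonneg (- ract (rev w) a) ->
  a \in inversions w.
Proof.
elim: w a => [|i w IH] a ra a0 /=.
  move=> n0; have a_0 := nonneg_pm a0 n0.
  by have [u [j e]] := ra; have := ract_root_neq0 u j; rewrite -e a_0 eqxx.
rewrite rev_cons act_rcons inE => h.
have [sp|sn] := is_root_sign (is_root_rrefl i ra).
  apply/orP; right; have [rK _] := rrefl_action.
  by rewrite -[a](rK i) map_f //; apply: IH => //; exact: is_root_rrefl.
by apply/orP; left; apply/eqP; exact: rrefl_negative.
Qed.

(** A point in the interior of the chamber. *)
Definition rho : 'rV[R]_3 := const_mx 1.

Lemma nonneg_rho : nonneg rho. Proof. by move=> j; rewrite mxE ler01. Qed.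

Lemma negative_inversion w a : is_root a -> nonneg a ->
  pairing (wact w rho) a < 0 -> a \in inversions w.
Proof.
move=> ra a0 h; apply: inversionsP => //.
have [|//] : nonneg (ract (rev w) a) \/ nonneg (- ract (rev w) a).
  by apply: is_root_sign; have [u [j ->]] := ra; exists (rev w ++ u), j; rewrite act_cat.
by move=> /(pairing_ge0 nonneg_rho); rewrite -pairing_wact leNgt h.
Qed.

(** Finitely many positive roots are negative on p; a reflection in a simple root
    among them removes that root from the list and permutes the other positive
    roots, so after finitely many steps none is left. *)
Lemma move_to_chamber p (L : seq 'rV[R]_3) :
  (forall a, is_root a -> nonneg a -> pairing p a < 0 -> a \in L) ->
  exists g, nonneg (wact g p).
Proof.
have [n] := ubnP (size L); elim: n L p => // n IH L p; rewrite ltnS => szL HL.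
have [/forallP h|] := boolP [forall j, 0 <= p 0 j]; first by exists [::].
rewrite negb_forall => /existsP[s]; rewrite -ltNge => ps.
have [rK _] := rrefl_action.
pose L' := map (rrefl s) [seq a <- L | predC1 (root s) a].
have [||g Hg] := IH L' (wrefl s p).
- have c0 : (0 < count (pred1 (root s)) L)%N.
    rewrite -has_count has_pred1; apply: HL; rewrite ?pairing_root //.
      exact: is_root_simple.
    exact: nonneg_root.
  have := count_predC (pred1 (root s)) L.
  rewrite size_map size_filter (@eq_count _ (predC _) (predC1 (root s))) // => eL.
  by apply: leq_trans szL; rewrite -eL -[X in (X < _)%N]add0n ltn_add2r.
- move=> a ra a0; rewrite pairing_wrefl => h.
  rewrite -[a](rK s) map_f // mem_filter /=.
  have sa : nonneg (rrefl s a).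
    have [//|n0] := is_root_sign (is_root_rrefl s ra).
    move: h; rewrite (rrefl_negative ra a0 n0) rrefl_root pairingN pairing_root.
    by rewrite oppr_lt0 ltNge (ltW ps).
  rewrite HL ?andbT //; last exact: is_root_rrefl.
  apply/eqP => e; have := a0 s; rewrite -[a](rK s) e rrefl_root !mxE !eqxx /=.
  by rewrite oppr_ge0 ler10.
by exists (rcons g s); rewrite act_rcons.
Qed.

(** Let w s fix q. If w sends the root of s to a positive vector, the value of q
    on that root is both non-negative and non-positive, hence zero; then s fixes q
    and can be removed. Otherwise w ends in s, up to equality in the group, and
    w s is equal to a shorter word. *)
Lemma chamber_stabilizer q w : nonneg q -> wact w q = q ->
  exists w', weq w w' /\ all (fun s => q 0 s == 0) w'.
Proof.
move=> q0; have [n] := ubnP (size w); elim: n w => // n IH w; rewrite ltnS => szw.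
case/lastP: w szw => [|w s]; first by exists [::].
rewrite size_rcons => szw fix_q.
have [pos|[w2 [lt e]]] := positive_or_shorter w s.
  have qs : q 0 s = 0.
    have wK := act_revK (rcons w s) wrefl_action q.
    have E : q 0 s = - pairing q (ract w (root s)).
      rewrite -{1}wK fix_q -pairing_root pairing_wact revK act_rcons rrefl_root.
      by rewrite ractN pairingN.
    apply/eqP; rewrite eq_le q0 andbT E oppr_le0; exact: pairing_ge0.
  have sq : wrefl s q = q by apply/rowP => j; rewrite mxE qs mulr0 subr0.
  have [||w' [e' aw']] := IH w; first by lia.
    by move: fix_q; rewrite act_rcons sq.
  exists (rcons w' s); split; last by rewrite all_rcons qs eqxx.
  by rewrite -!cats1; apply: weq_cat.
have e' : weq (rcons w s) w2.
  move=> Y a ca y; rewrite act_rcons (e _ _ ca) act_rcons.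
  by have [aK _] := ca; rewrite aK.
have [||w' [e'' aw']] := IH w2; first by lia.
  by rewrite -(e' _ _ wrefl_action).
by exists w'; split=> //; exact: (weq_trans e').
Qed.

(** The dual of the invariant form is proportional to
    (2 - r) |p|^2 - (sum of the coordinates of p)^2; this is the half of its
    negative cone that contains [rho]. It is convex and invariant, which keeps
    the sum of translates of [rho] from vanishing. *)
Definition forward p : Prop :=
  0 < \sum_j p 0 j /\ (2 - r) * (\sum_j p 0 j * p 0 j) < (\sum_j p 0 j) * \sum_j p 0 j.

Lemma r_gt1 : 1 < r.
Proof.
rewrite ltNge; apply/negP => h.
by have := ler_pM (ltW r_gt0) (ltW r_gt0) h h; rewrite r2; lra.
Qed.

Lemma r_lt32 : r < 3 / 2.
Proof.
rewrite ltNge; apply/negP => h; have h0 : (0 : R) <= 3 / 2 by lra.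
by have := ler_pM h0 h0 h h; rewrite r2; lra.
Qed.

Lemma forward_step (x y z : R) : 0 < x + y + z ->
  (2 - r) * (x * x + y * y + z * z) < (x + y + z) * (x + y + z) ->
  0 < - x + (y + r * x) + (z + r * x) /\
  (2 - r) * ((- x) * (- x) + (y + r * x) * (y + r * x) + (z + r * x) * (z + r * x))
   < (- x + (y + r * x) + (z + r * x)) * (- x + (y + r * x) + (z + r * x)).
Proof.
move=> S0 Q; split; last first.
  have -> : (2 - r) * ((- x) * (- x) + (y + r * x) * (y + r * x) + (z + r * x) * (z + r * x)) =
     (2 - r) * (x * x + y * y + z * z) + (2 - r) * (2 * x * x * (r * r) + 2 * r * x * (y + z)).
     by ring.
  have -> : (- x + (y + r * x) + (z + r * x)) * (- x + (y + r * x) + (z + r * x)) =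
     (x + y + z) * (x + y + z) + 4 * x * (r - 1) * (x + y + z) + 4 * x * x * (r * r - 2 * r + 1).
    by ring.
  rewrite r2.
  suff : (2 - r) * (2 * x * x * 2 + 2 * r * x * (y + z)) =
       4 * x * (r - 1) * (x + y + z) + 4 * x * x * (2 - 2 * r + 1) by lra.
  have -> : (2 - r) * (2 * x * x * 2 + 2 * r * x * (y + z)) =
     8 * x * x - 4 * r * x * x + 4 * r * x * (y + z) - 2 * (r * r) * x * (y + z) by ring.
  by rewrite r2; ring.
have r1 := r_gt1; have r32 := r_lt32.
set S := x + y + z in S0 Q *.
have -> : - x + (y + r * x) + (z + r * x) = S + 2 * (r - 1) * x by rewrite /S; ring.
case: (leP 0 x) => x0; first by nra.
have yz : (y + z) * (y + z) <= 2 * (y * y + z * z) by have := sqr_ge0 (y - z); rewrite expr2; nra.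
have E : y + z = S - x by rewrite /S; ring.
rewrite E in yz.
have Q' : (2 - r) * (3 * (x * x) - 2 * (S * x) + S * S) < 2 * (S * S) by nra.
rewrite ltNge; apply/negP => neg.
have h1 : S <= - x by nra.
nra.
Qed.

Lemma forward_wrefl i p : forward p -> forward (wrefl i p).
Proof.
have big3 (F : 'I_3 -> R) : \sum_j F j = F 0 + F 1 + F 2.
  by rewrite !big_ord_recl big_ord0 addr0 addrA; congr (_ + F _ + F _); exact: val_inj.
have [c01 [c02 c12]] : cox 0 1 = - r /\ cox 0 2 = - r /\ cox 1 2 = - r by [].
have [c10 [c20 c21]] : cox 1 0 = - r /\ cox 2 0 = - r /\ cox 2 1 = - r by [].
have [->|[->|->]] : i = 0 \/ i = 1 \/ i = 2.
  by case: i => [[|[|[|//]]] h]; [left|right; left|right; right]; exact: val_inj.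
all: rewrite /forward !big3 !mxE !coxii ?(c01, c02, c12, c10, c20, c21).
all: move=> [S Q].
- have [] := forward_step S Q.
  by move=> ? ?; split; lra.
- have [||? ?] := @forward_step (p 0 1) (p 0 0) (p 0 2); [lra|lra|].
  by split; lra.
- have [||? ?] := @forward_step (p 0 2) (p 0 0) (p 0 1); [lra|lra|].
  by split; lra.
Qed.

Lemma forward_rho : forward rho.
Proof.
have r32 := r_lt32.
have E : \sum_j rho 0 j = 3.
  by rewrite (eq_bigr (fun=> 1)) ?sumr_const ?card_ord // => j _; rewrite mxE.
have E' : \sum_j rho 0 j * rho 0 j = 3.
  by rewrite -E; apply: eq_bigr => j _; rewrite mxE mulr1.
by have := r_gt0; rewrite /forward E E'; split; lra.
Qed.

Lemma forward_wact w p : forward p -> forward (wact w p).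
Proof. by move=> fp; elim: w => //= i w; exact: forward_wrefl. Qed.

(** The subgroup generated by u and v has at most 8 elements, listed in [D]. The
    sum of the translates of [rho] by them is fixed by u and v, and it can be
    moved into the chamber. It is not zero there, so at least one coordinate, of
    index k, is positive, and the stabiliser avoids the letter k. *)
Lemma finite_dihedral (u v : word) :
  weq (u ++ u) [::] -> weq (v ++ v) [::] ->
  weq (u ++ v ++ u ++ v ++ u ++ v ++ u ++ v) [::] ->
  exists (g : word) k (u' v' : word), [/\ all (predC1 k) u', all (predC1 k) v',
    weq (g ++ u ++ rev g) u' & weq (g ++ v ++ rev g) v'].
Proof.
move=> uu vv uv4.
have U p : wact u (wact u p) = p by have := uu _ _ wrefl_action p; rewrite act_cat.
have V p : wact v (wact v p) = p by have := vv _ _ wrefl_action p; rewrite act_cat.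
have UV p : wact v (wact u (wact v (wact u p))) = wact u (wact v (wact u (wact v p))).
  have := uv4 _ _ wrefl_action (wact v (wact u (wact v (wact u p)))).
  by rewrite !act_cat /= !(U, V).
pose D := [:: [::]; u; v; u ++ v; v ++ u; u ++ v ++ u; v ++ u ++ v; u ++ v ++ u ++ v].
pose p := \sum_(d <- D) wact d rho.
have up : wact u p = p.
  rewrite /p !big_cons big_nil !wactD !act_cat /= !U addr0.
  have -> : wact u 0 = 0 by apply: (addrI (wact u 0)); rewrite -wactD !addr0.
  rewrite addr0; apply/rowP => j; rewrite !mxE; ring.
have vp : wact v p = p.
  rewrite /p !big_cons big_nil !wactD !act_cat /= UV !V addr0.
  have -> : wact v 0 = 0 by apply: (addrI (wact v 0)); rewrite -wactD !addr0.
  rewrite addr0; have := UV (wact v rho); rewrite V => ->.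
  apply/rowP => j; rewrite !mxE; ring.
have [|g gp] := @move_to_chamber p (flatten (map inversions D)).
  move=> a ra a0 h.
  have [d dD hd] : exists2 d, d \in D & pairing (wact d rho) a < 0.
    apply/hasP; apply: contraTT h => /hasPn nD; rewrite -leNgt /p.
    elim: D nD {p up vp} => [|d D' IH] nD.
      by rewrite big_nil; apply: sumr_ge0 => j _; rewrite mxE mul0r.
    rewrite big_cons pairingDl addr_ge0 //.
      by rewrite leNgt nD ?inE ?eqxx.
    by apply: IH => d' d'D; rewrite nD ?inE ?d'D ?orbT.
  apply/flatten_mapP; exists d => //; exact: negative_inversion.
set q := wact g p in gp.
have conj_fix x : wact x p = p -> wact (g ++ x ++ rev g) q = q.
  move=> xp; rewrite !act_cat /q; have := act_revK g wrefl_action p => ->.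
  by rewrite xp.
(* Each translate has a positive sum of coordinates by [forward_wact]. *)
have [k qk] : exists k, q 0 k != 0.
  have : 0 < \sum_j q 0 j.
    rewrite /q /p; elim: (D) (isT : D != [::]) => // d D' IH _.
    rewrite big_cons wactD -act_cat.
    set W := wact g _; rewrite (eq_bigr (fun j => (wact (g ++ d) rho) 0 j + W 0 j)); last first.
      by move=> j _; rewrite mxE.
    rewrite big_split /= /W {W}; have [fd _] := forward_wact (g ++ d) forward_rho.
    apply: ltr_wpDr fd; case: D' IH => [|d' D'] IH; last exact: ltW (IH isT).
    rewrite big_nil (_ : wact g 0 = 0); first by rewrite big1 // => j _; rewrite mxE.
    by apply: (addrI (wact g 0)); rewrite -wactD !addr0.
  case: (boolP [exists k, q 0 k != 0]) => [/existsP //|].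
  rewrite negb_exists => /forallP h; rewrite big1 ?ltxx // => j _.
  by apply/eqP; have := h j; rewrite negbK.
have [u' [eu au]] := chamber_stabilizer gp (conj_fix u up).
have [v' [ev av]] := chamber_stabilizer gp (conj_fix v vp).
exists g, k, u', v'; split=> //.
  by apply: sub_all au => s /= /eqP qs; apply: contraNneq qk => <-; rewrite qs.
by apply: sub_all av => s /= /eqP qs; apply: contraNneq qk => <-; rewrite qs.
Qed.

End Roots.

(** * A line of blocks of triangles *)

(** Row i of the table of type b lists the neighbours across side i of the twenty
    triangles of a block; fixed entries are sides on the boundary. The entries 19
    and 0 of row 0 are in the previous and in the next block, as [jump] says. *)
Definition tile_table (b : bool) (i : nat) : seq nat :=
  match i, b with
  | 0, _ => [:: 19; 2; 1; 4; 3; 6; 5; 8; 7; 10; 9; 12; 11; 14; 13; 16; 15; 18; 17; 0]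
  | 1, false => [:: 0; 1; 3; 2; 4; 7; 6; 5; 8; 11; 12; 9; 10; 13; 15; 14; 16; 19; 18; 17]
  | 1, true => [:: 0; 3; 4; 1; 2; 5; 7; 6; 8; 11; 10; 9; 12; 13; 15; 14; 16; 19; 18; 17]
  | _, false => [:: 1; 0; 2; 5; 4; 3; 6; 7; 9; 8; 10; 13; 12; 11; 14; 17; 16; 15; 18; 19]
  | _, true => [:: 1; 0; 2; 5; 4; 3; 6; 9; 8; 7; 10; 11; 13; 12; 14; 17; 16; 15; 18; 19]
  end%N.

(** The pairs (k, j) for which side i of triangle k lies on the side number
    5 n + j of the boundary chain, n being the index of the block. The offset 5 is
    the first side of the next block, part of which runs along this one. Boundary
    edges that belong to no side of the chain do not appear. *)
Definition side_table (b : bool) (i : nat) : seq (nat * nat) :=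
  match i, b with
  | 1, false => [:: (0, 0); (1, 1); (4, 1); (6, 3); (8, 3); (13, 3); (16, 3); (18, 5)]
  | 2, false => [:: (4, 2); (6, 2); (16, 4); (18, 4)]
  | 1, true => [:: (0, 0); (5, 0); (8, 0); (10, 2); (12, 2); (13, 3); (16, 3); (18, 5)]
  | 2, true => [:: (8, 1); (10, 1); (16, 4); (18, 4)]
  | _, _ => [::]
  end%N.

(** The default value k makes all moves fix the places with k at least 20, so the
    relations hold there as well and places need not carry a bound. *)
Definition tile (b : bool) (i k : nat) : nat := nth k (tile_table b i) k.

Definition jump (i k : nat) : int :=
  if (i == 0)%N then (if (k == 0)%N then -1 else if (k == 19)%N then 1 else 0) else 0.

Definition side_offset (b : bool) (i k : nat) : option nat :=
  omap snd (ohead [seq x <- side_table b i | x.1 == k]).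

Notation place := (int * nat)%type.

Section Line.
Variable omega : int -> bool.

Definition move (i : 'I_3) (s : place) : place :=
  (s.1 + jump i s.2, tile (omega s.1) i s.2).

Definition side (i : 'I_3) (s : place) : option int :=
  omap (fun j : nat => 5 * s.1 + j%:Z) (side_offset (omega s.1) i s.2).

Definition right_angled (e : int) : bool :=
  let j := (e %% 5)%Z in if omega (e %/ 5)%Z then j == 2 else j == 0.

Definition crosses (e : int) (i : 'I_3) (s : place) : bool :=
  (move i s == s) && (side i s == Some e).

(** The triangles are doubled and the reflections in side e exchange the two
    copies; that the relations still hold means that the parity of the number of
    reflections in side e along a word depends only on its element. *)
Definition crossing_move (e : int) (i : 'I_3) (sx : place * bool) : place * bool :=
  (move i sx.1, sx.2 (+) crosses e i sx.1).

End Line.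

(** The relations and the corners are checked inside a window of three blocks of
    types [a], [b], [c], with relative indices -1, 0 and 1. A walk has no
    value as soon as it makes a step from outside the window; it records the sides
    in which it reflects. *)
Section Window.
Variables a b c : bool.

Definition window (d : int) : bool := if d == 0 then b else if d == 1 then c else a.
Definition visible (d : int) := (d == 0) || (d == 1) || (d == -1).

Definition window_step (i : nat) (x : place * seq int) : option (place * seq int) :=
  let: ((d, k), L) := x in
  if visible d then
    let s' := (d + jump i k, tile (window d) i k) in
    Some (s', if s' == (d, k) then
                if side_offset (window d) i k is Some j then (5 * d + j%:Z) :: L else L
              else L)
  else None.

Definition window_walk (w : seq nat) (k : nat) : option (place * seq int) :=
  foldr (fun i o => obind (window_step i) o) (Some ((0, k), [::])) w.

End Window.

Lemma window_walkP omega n a b c (w : word) k d k' L e x :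
  omega (n - 1) = a -> omega n = b -> omega (n + 1) = c ->
  window_walk a b c (map val w) k = Some ((d, k'), L) ->
  act (crossing_move omega e) w ((n, k), x) =
    ((n + d, k'), x (+) odd (count_mem (e - 5 * n) L)).
Proof.
move=> ea eb ec; elim: w d k' L => [|i w IH] d k' L /=.
  by case=> <- <- <-; rewrite addr0 addbF.
case E : window_walk => [[[d1 k1] L1]|] //=; rewrite (IH _ _ _ E).
case: ifP => // vis [<- <- <-].
have ow : omega (n + d1) = window a b c d1.
  rewrite /window; move: vis; rewrite /visible.
  case: (d1 =P 0) => [->|_]; first by rewrite addr0.
  case: (d1 =P 1) => [->|_] //=.
  by move=> /eqP ->.
rewrite /crossing_move /= /move /= ow addrA; congr (_, _).
rewrite -addbA; congr (_ (+) _); rewrite /crosses /move /side /= ow.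
rewrite -addrA xpair_eqE (inj_eq (addrI n)).
rewrite -xpair_eqE; case: eqP => _ /=; last by rewrite addbF.
case: side_offset => [j|] /=; last by rewrite addbF.
rewrite oddD addbC; congr (_ (+) _).
rewrite oddb (_ : (Some _ == Some e) = (5 * (n + d1) + j%:Z == e)) //.
by rewrite [RHS]eq_sym subr_eq eq_sym; congr (_ == _); ring.
Qed.

Lemma act_crossing omega e w s x :
  (act (crossing_move omega e) w (s, x)).1 = act (move omega) w s.
Proof. by elim: w => //= i w ->. Qed.

Lemma window_walk_move omega n (w : word) k d k' L :
  window_walk (omega (n - 1)) (omega n) (omega (n + 1)) (map val w) k = Some ((d, k'), L) ->
  act (move omega) w (n, k) = (n + d, k').
Proof.
move=> E; rewrite -(@act_crossing omega 0 w _ false).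
by rewrite (window_walkP 0 false erefl erefl erefl E).
Qed.

Definition bools := [:: false; true].
Definition tiles := iota 0 20.
Definition letters := iota 0 3.

Definition even_list (L : seq int) := all (fun l => ~~ odd (count_mem l L)) L.

Lemma even_listP L l : even_list L -> odd (count_mem l L) = false.
Proof.
move=> /allP h; have [lL|lL] := boolP (l \in L); first by apply/negbTE/h.
by rewrite (count_memPn lL).
Qed.

Definition closed_loop a b c w k :=
  if window_walk a b c w k is Some ((d, k'), L) then
    [&& d == 0, k' == k & even_list L] else false.

Definition forall_windows (P : bool -> bool -> bool -> bool) :=
  all (fun a => all (fun b => all (P a b) bools) bools) bools.

Lemma forall_windowsP P : forall_windows P -> forall a b c, P a b c.
Proof.
have B x : x \in bools by case: x.
by move=> /allP h a b c; have /allP h' := h a (B a); have /allP := h' b (B b); apply.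
Qed.

(** Both families of relations hold from each triangle, and they cross each side
    an even number of times. *)
Lemma relations_check :
  forall_windows (fun a b c => all (fun k => all (fun i => all (fun j =>
    closed_loop a b c [:: i; i] k &&
    closed_loop a b c [:: i; j; i; j; i; j; i; j] k) letters) letters) tiles).
Proof. by vm_compute. Qed.

Lemma mem_letters (i : 'I_3) : val i \in letters.
Proof. by rewrite mem_iota ltn_ord. Qed.

Lemma tile_big b i k : (20 <= k)%N -> tile b i k = k.
Proof. by move=> h; rewrite /tile nth_default //; case: i => [|[|i]]; case: b. Qed.

Lemma jump_big i k : (20 <= k)%N -> jump i k = 0.
Proof.
move=> h; rewrite /jump; case: eqP => // _.
by rewrite !gtn_eqF // (leq_trans _ h).
Qed.

Lemma side_big b i k : (20 <= k)%N -> side_offset b i k = None.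
Proof.
move=> h; rewrite /side_offset (_ : [seq x <- _ | _] = [::]) //.
apply/eqP; rewrite -[_ == _]negbK -has_filter; apply/hasPn => x xs.
have /allP/(_ x xs) : all (fun x => x.1 < 20)%N (side_table b i).
  by case: i xs => [|[|[|i]]]; case: b.
by move=> x20; rewrite neq_ltn (leq_trans x20 h).
Qed.

Lemma crossing_move_big omega e i n k x : (20 <= k)%N ->
  crossing_move omega e i ((n, k), x) = ((n, k), x).
Proof.
move=> h; rewrite /crossing_move /crosses /move /side /= tile_big // jump_big // addr0.
by rewrite side_big //= andbF addbF.
Qed.

Lemma crossing_loop omega e n k x (w : word) : (k < 20)%N ->
  closed_loop (omega (n - 1)) (omega n) (omega (n + 1)) (map val w) k ->
  act (crossing_move omega e) w ((n, k), x) = ((n, k), x).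
Proof.
move=> k20; rewrite /closed_loop; case E : window_walk => [[[d k'] L]|//].
case/and3P => /eqP d0 /eqP kk ev; rewrite (window_walkP e x erefl erefl erefl E) d0 kk addr0.
by rewrite even_listP // addbF.
Qed.

Lemma crossing_action omega e : coxeter_action (crossing_move omega e).
Proof.
have C n k (i j : 'I_3) : (k < 20)%N ->
   closed_loop (omega (n - 1)) (omega n) (omega (n + 1)) [:: val i; val i] k &&
   closed_loop (omega (n - 1)) (omega n) (omega (n + 1))
     [:: val i; val j; val i; val j; val i; val j; val i; val j] k.
  move=> k20; have /allP := forall_windowsP relations_check (omega (n - 1)) (omega n) (omega (n + 1)).
  move=> /(_ k); rewrite mem_iota => /(_ k20) /allP /(_ _ (mem_letters i)).
  by move=> /allP /(_ _ (mem_letters j)).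
split=> [i [[n k] x]|i j [[n k] x]]; (have [k20|k20] := ltnP k 20;
  last by rewrite /= !crossing_move_big).
- have /andP[c1 _] := C n k i i k20.
  exact: (@crossing_loop omega e n k x [:: i; i] k20 c1).
- have /andP[_ c2] := C n k i j k20.
  exact: (@crossing_loop omega e n k x [:: i; j; i; j; i; j; i; j] k20 c2).
Qed.

Lemma move_action omega : coxeter_action (move omega).
Proof.
have [cK c4] := crossing_action omega 0.
split=> [i s|i j s]; first by have := cK i (s, false) => /(congr1 fst).
by have := c4 i j (s, false) => /(congr1 fst).
Qed.

Definition local_side (b : bool) (i k : nat) (d : int) : option int :=
  omap (fun j : nat => 5 * d + j%:Z) (side_offset b i k).

Definition local_right_angled (a b c : bool) (e : int) : bool :=
  let j := (e %% 5)%Z in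
  let n := (e %/ 5)%Z in if window a b c n then j == 2 else j == 0.

Definition is_mirror b (i k : nat) := (jump i k == 0) && (tile b i k == k).

Definition adjacent_local_sides a b c (want : bool) (l l' : option int) :=
  match l, l' with
  | Some e, Some e' =>
      ((e' == e + 1) && (local_right_angled a b c e == want) && visible (e %/ 5)%Z) ||
      ((e == e' + 1) && (local_right_angled a b c e' == want) && visible (e' %/ 5)%Z)
  | _, _ => false
  end.

(** A triangle with two sides on the boundary is at a corner of angle pi/4 of the
    chain. *)
Lemma acute_corner_check :
  forall_windows (fun a b c => all (fun k => all (fun i => all (fun j =>
    [&& i != j, is_mirror b i k & is_mirror b j k] ==>
    adjacent_local_sides a b c false (local_side b i k 0) (local_side b j k 0))
   letters) letters) tiles).
Proof. by vm_compute. Qed.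

(** When two adjacent triangles have the same side i on the boundary, their edges
    are on the same side of the chain, or on two sides that meet at a right angle,
    unless one of them is outside the chain. *)
Lemma right_corner_check :
  forall_windows (fun a b c => all (fun k => all (fun i => all (fun j =>
    if [&& is_mirror b i k & ~~ is_mirror b j k] then
      let d := jump j k in let k' := tile b j k in let b' := window a b c d in
      is_mirror b' i k' ==>
      [|| local_side b i k 0 == None, local_side b' i k' d == None,
          local_side b i k 0 == local_side b' i k' d |
      adjacent_local_sides a b c true (local_side b i k 0) (local_side b' i k' d)]
    else true)
   letters) letters) tiles).
Proof. by vm_compute. Qed.

(** * Corners, sides and connectivity of the line *)

Definition adjacent (omega : int -> bool) (want : bool) (e e' : int) : Prop :=
  (e' = e + 1 /\ right_angled omega e = want) \/
  (e = e' + 1 /\ right_angled omega e' = want).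

Lemma right_angled_local omega n e : visible (e %/ 5)%Z ->
  right_angled omega (5 * n + e) =
  local_right_angled (omega (n - 1)) (omega n) (omega (n + 1)) e.
Proof.
rewrite /right_angled /local_right_angled [5 * n]mulrC divzMDl // modzMDl => vis.
congr (if _ then _ else _); move: vis; rewrite /visible /window.
case: ((e %/ 5)%Z =P 0) => [->|_]; first by rewrite addr0.
case: ((e %/ 5)%Z =P 1) => [->|_] //=.
by move=> /eqP ->.
Qed.

Lemma move_window omega n k (i : 'I_3) :
  omega (n + jump i k) = window (omega (n - 1)) (omega n) (omega (n + 1)) (jump i k).
Proof.
rewrite /jump /window; case: ifP => _; last by rewrite addr0.
case: ifP => _ //; case: ifP => _ //; by rewrite addr0.
Qed.

Lemma side_local omega n d k (i : 'I_3) b : omega (n + d) = b ->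
  side omega i (n + d, k) = omap (fun l => 5 * n + l) (local_side b i k d).
Proof.
move=> ob; rewrite /side /local_side /= ob; case: side_offset => //= j.
by rewrite mulrDr addrA.
Qed.

Lemma is_mirror_local omega n d k (i : 'I_3) b : omega (n + d) = b ->
  (move omega i (n + d, k) == (n + d, k)) = is_mirror b i k.
Proof.
by move=> ob; rewrite /move /= ob xpair_eqE addrC -subr_eq0 addrK.
Qed.

Lemma adjacent_local omega n want l l' e e' :
  adjacent_local_sides (omega (n - 1)) (omega n) (omega (n + 1)) want l l' ->
  omap (fun x => 5 * n + x) l = Some e -> omap (fun x => 5 * n + x) l' = Some e' ->
  adjacent omega want e e'.
Proof.
case: l => // l; case: l' => // l' /= h [<-] [<-].
case/orP: h => /andP[/andP[/eqP-> /eqP r] v]; [left|right];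
  by rewrite addrA right_angled_local.
Qed.

Lemma window_check P (omega : int -> bool) (n : int) (k : nat) (i j : 'I_3) :
  forall_windows (fun a b c => all (fun k => all (fun i => all (fun j => P a b c k i j)
    letters) letters) tiles) -> (k < 20)%N ->
  P (omega (n - 1)) (omega n) (omega (n + 1)) k (val i) (val j).
Proof.
move=> h k20; have /allP := forall_windowsP h (omega (n - 1)) (omega n) (omega (n + 1)).
move=> /(_ k); rewrite mem_iota => /(_ k20) /allP /(_ _ (mem_letters i)).
by move=> /allP /(_ _ (mem_letters j)).
Qed.

Lemma acute_corner omega (i j : 'I_3) s : (s.2 < 20)%N -> i != j ->
  move omega i s = s -> move omega j s = s ->
  exists e e', [/\ side omega i s = Some e, side omega j s = Some e' &
    adjacent omega false e e'].
Proof.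
case: s => n k /= k20 ij /eqP; rewrite -[n]addr0 (is_mirror_local _ _ (erefl _)) => li.
move=> /eqP; rewrite (is_mirror_local _ _ (erefl _)) => lj.
have := window_check omega n i j acute_corner_check k20.
rewrite ij; rewrite !addr0 in li lj *; rewrite li lj /= => h.
have := @side_local omega n 0 k i; rewrite addr0 => /(_ _ erefl) ->.
have := @side_local omega n 0 k j; rewrite addr0 => /(_ _ erefl) ->.
move: h; case E: (local_side _ i k 0) => [e|//]; case E': (local_side _ j k 0) => [e'|//] h.
by exists (5 * n + e), (5 * n + e'); split=> //; apply: (adjacent_local h).
Qed.

Lemma right_corner omega (i j : 'I_3) s e e' : (s.2 < 20)%N ->
  move omega i s = s -> move omega j s != s ->
  move omega i (move omega j s) = move omega j s ->
  side omega i s = Some e -> side omega i (move omega j s) = Some e' -> e != e' ->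
  adjacent omega true e e'.
Proof.
case: s => n k /= k20 /eqP li lj.
have ob := move_window omega n k j; rewrite [move _ j _]/move /= => /eqP.
rewrite (is_mirror_local _ _ ob) => li' si.
rewrite (side_local _ _ ob) => si' ee.
have := window_check omega n i j right_corner_check k20.
have l0 x : (move omega x (n, k) == (n, k)) = is_mirror (omega n) x k.
  by rewrite -[n]addr0 (is_mirror_local _ _ (erefl _)) addr0.
rewrite -!l0 li lj /= li' /=.
move: si; have := @side_local omega n 0 k i; rewrite addr0 => /(_ _ erefl) -> si.
case/or4P.
- by move=> /eqP h; rewrite h in si.
- by move=> /eqP h; rewrite h in si'.
- move=> /eqP h; move: si si'; rewrite -h => -> [eq]; by rewrite eq eqxx in ee.
- by move=> h; exact: (adjacent_local h).
Qed.

Definition corner_existence_check :=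
  all (fun b => all (fun j : nat =>
   has (fun k => has (fun i => has (fun l =>
     if (if b then j == 2 else j == 0)%N then
       [&& is_mirror b i k, tile b l k != k, jump l k == 0, is_mirror b i (tile b l k),
           side_offset b i k == Some j & side_offset b i (tile b l k) == Some j.+1]
     else [&& i != l, is_mirror b i k, is_mirror b l k, side_offset b i k == Some j
           & side_offset b l k == Some j.+1])
   letters) letters) tiles) (iota 0 5)) bools.

Lemma corner_existence_checked : corner_existence_check. Proof. by vm_compute. Qed.

Lemma letterP (i : nat) : i \in letters -> exists i' : 'I_3, val i' = i.
Proof. by rewrite mem_iota => h; exists (Ordinal h). Qed.

(** At an angle pi/4 there is one triangle, with sides i and l on the boundary; at
    an angle pi/2 there are two of them, exchanged by l, whose sides i are on the
    boundary. *)
Definition corner omega (e : int) (s : place) (i l : 'I_3) : Prop :=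
  if right_angled omega e then
    [/\ move omega i s = s, move omega l s != s,
        move omega i (move omega l s) = move omega l s,
        side omega i s = Some e & side omega i (move omega l s) = Some (e + 1)]
  else [/\ i != l, move omega i s = s, move omega l s = s,
        side omega i s = Some e & side omega l s = Some (e + 1)].

Lemma corner_exists omega e : exists s i l, (s.2 < 20)%N /\ corner omega e s i l.
Proof.
pose n := (e %/ 5)%Z; pose j := `|(e %% 5)%Z|%N.
have j0 : 0 <= (e %% 5)%Z by rewrite modz_ge0.
have jE : (e %% 5)%Z = j%:Z by rewrite /j gez0_abs.
have j5 : (j < 5)%N by rewrite -ltz_nat -jE ltz_pmod.
have eE : e = 5 * n + j%:Z by rewrite {1}(divz_eq e 5) mulrC jE.
have B x : x \in bools by case: x.
have /allP/(_ (omega n) (B _))/allP := corner_existence_checked.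
move=> /(_ j); rewrite mem_iota => /(_ j5) /hasP[k]; rewrite mem_iota => k20.
move=> /hasP[_ /letterP[i <-]] /hasP[_ /letterP[l <-]].
have rE : right_angled omega e = (if omega n then j == 2 else j == 0)%N.
  by rewrite /right_angled -/n jE; case: (omega n).
have lE x k' : (move omega x (n, k') == (n, k')) = is_mirror (omega n) x k'.
  by rewrite -[n]addr0 (is_mirror_local _ _ (erefl _)) addr0.
rewrite -rE => H; exists (n, k), i, l; split=> //; move: H; rewrite /corner.
case: ifP => _ /=; last first.
  case/and5P=> il /[!(=^~ lE)] /eqP li /eqP ll /eqP si /eqP sl.
  by split=> //; rewrite /side /= ?si ?sl /= eE // -addrA intS [1 + _]addrC.
case/and3P=> /[!(=^~ lE)] /eqP li tl /and4P[/eqP jl /eqP li' /eqP si /eqP sl].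
have ml : move omega l (n, k) = (n, tile (omega n) l k) by rewrite /move /= jl addr0.
rewrite ml; split=> //.
- by rewrite xpair_eqE eqxx.
- by rewrite /side /= si /= eE.
- by rewrite /side /= sl /= eE -addrA intS [1 + _]addrC.
Qed.

(** As l i l commutes with i, such a word carries an edge of a mirror to another
    edge of the same mirror. *)
Definition bounce (i : 'I_3) (ls : seq 'I_3) : word := flatten [seq [:: l; i; l] | l <- ls].
Definition nbounce (i : nat) (ls : seq nat) : seq nat := flatten [seq [:: l; i; l] | l <- ls].

(** A chosen edge on each of the five sides of a block: the index of the side in
    its triangle, and the triangle. *)
Definition base_loop (b : bool) (j : nat) : nat * nat :=
  nth (1, 0) (if b then [:: (1, 0); (2, 8); (1, 10); (1, 13); (2, 16)]
              else [:: (1, 0); (1, 1); (2, 4); (1, 6); (2, 16)]) j %N.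

Fixpoint alternate (n : nat) (l l' : nat) : seq nat :=
  if n is m.+1 then l :: alternate m l' l else [::].

(** Each edge on a side of the chain is carried to the chosen edge of that side by
    a bounce, here with at most seven steps and two alternating letters. *)
Definition same_side_check :=
  forall_windows (fun a b c => all (fun k => all (fun i =>
    if is_mirror b i k then if side_offset b i k is Some j then
      let d : int := if j == 5 then 1%R else 0%R in
      let j' := if j == 5 then 0 else j in
      let: (i0, k0) := base_loop (window a b c d) j' in
      (j < 6)%N && (i0 == i) &&
      has (fun m => has (fun l => has (fun l' =>
        let ls := alternate m l l' in
        all (fun x => (x != i) && (x < 3)) ls &&
        if window_walk a b c (nbounce i ls) k is Some (s, _) then s == (d, k0) else false)
      letters) letters) (iota 0 8)
    else true else true) letters) tiles)%N.

Lemma same_side_checked : same_side_check. Proof. by vm_compute. Qed.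

Definition base_side omega (e : int) : nat * nat :=
  base_loop (omega (e %/ 5)%Z) `|(e %% 5)%Z|%N.

Lemma map_bounce i ls : map val (bounce i ls) = nbounce (val i) (map val ls).
Proof. by elim: ls => //= l ls ->. Qed.

Lemma side_base omega (i : 'I_3) s e : move omega i s = s -> side omega i s = Some e ->
  val i = (base_side omega e).1 /\
  exists ls, all (predC1 i) ls /\
    act (move omega) (bounce i ls) s = ((e %/ 5)%Z, (base_side omega e).2) :> place.
Proof.
case: s => n k; have [k20|k20] := ltnP k 20; last by rewrite /side side_big.
move=> /eqP li; rewrite /side /=; case sj: side_offset => [j|] //= [eE].
have /allP := forall_windowsP same_side_checked (omega (n - 1)) (omega n) (omega (n + 1)).
move=> /(_ k); rewrite mem_iota => /(_ k20) /allP /(_ _ (mem_letters i)).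
have -> : is_mirror (omega n) i k.
  by have := is_mirror_local k i (erefl (omega (n + 0))); rewrite addr0 li => <-.
rewrite sj; set d := if _ then _ else _; set j' := if _ then _ else _.
cbv zeta; set W := window _ _ _ _.
case E: (base_loop W j') => [i0 k0] /andP[/andP[j6 /eqP i0E] h].
have j5 : (j' < 5)%N.
  by rewrite /j'; case: eqP => // ?; lia.
have eE' : e = 5 * (n + d) + j'%:Z.
  by rewrite -eE /d /j'; case: eqP => [->|_]; lia.
have dE : (e %/ 5)%Z = n + d.
  by rewrite eE' mulrC divzMDl // divz_small ?addr0 // /=; lia.
have mE : (e %% 5)%Z = j'%:Z.
  by rewrite eE' mulrC modzMDl modz_small //=; lia.
have WE : W = omega (n + d).
  by rewrite /W /d; case: (j == 5)%N; rewrite /window /= ?addr0.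
rewrite /base_side dE mE absz_nat -WE E /=; split; first by rewrite i0E.
case/hasP: h => m _ /hasP[l _ /hasP[l' _ /andP[lsi]]].
case EL: window_walk => [[s' L]|//] /eqP s'E; rewrite s'E in EL.
set ls := alternate m l l' in lsi EL.
have lsE : map val (map (inord : nat -> 'I_3) ls) = ls.
  rewrite -map_comp -[RHS]map_id; apply/eq_in_map => x xls /=.
  by rewrite inordK //; have /allP/(_ x xls)/andP[] := lsi.
exists (map inord ls); split.
  rewrite all_map; apply: sub_all lsi => x /andP[xi x3] /=.
  by rewrite -val_eqE /= inordK.
by rewrite (@window_walk_move omega n (bounce i _) k d k0 L) // map_bounce lsE.
Qed.

(** One step of the search for the triangles of a block accessible without leaving
    it: the letter 0 is not applied at the two triangles where it exits. *)
Definition spread (b : bool) (S : seq nat) : seq nat :=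
  undup (S ++ [seq tile b i k | i <- letters, k <- [seq k <- S | (k != 0) && (k != 19)]]
         ++ [seq tile b i k | i <- [:: 1; 2], k <- S])%N.

Lemma spread_check :
  all (fun b => all (fun k => k \in iter 20 (spread b) [:: 0%N]) tiles) bools.
Proof. by vm_compute. Qed.

(** The word depends on the type of the block only, so it may be used for all
    sequences of coins with the same bit there; ergodicity needs this uniformity. *)
Lemma block_path (b : bool) (k : nat) : (k < 20)%N -> exists w : word,
  forall omega n, omega n = b -> act (move omega) w (n, 0%N) = (n, k).
Proof.
move=> k20; have B : b \in bools by case: b.
have /allP/(_ b B)/allP/(_ k) := spread_check; rewrite mem_iota => /(_ k20).
elim: 20%N {k20} k => [|m IH] k.
  by rewrite inE => /eqP->; exists [::].
have step (i : 'I_3) k' : jump i k' = 0 -> k' \in iter m (spread b) [:: 0%N] ->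
    exists w : word, forall omega n, omega n = b ->
      act (move omega) w (n, 0%N) = (n, tile b i k').
  move=> j0 /IH[w hw]; exists (i :: w) => omega n on.
  by rewrite /= hw // /move /= on j0 addr0.
rewrite iterS mem_undup mem_cat => /orP[/IH h|]; first exact: h.
rewrite mem_cat => /orP[/flatten_mapP|/flatten_mapP] [i].
  move=> /letterP[i' <-] /mapP[k']; rewrite mem_filter => /andP[/andP[k0 k19] k'S] ->.
  by apply: step => //; rewrite /jump (negPf k0) (negPf k19) if_same.
move=> i12; have [i' i'E] : exists i' : 'I_3, val i' = i.
  by apply: letterP; move: i12; rewrite !inE => /orP[]/eqP->.
move=> /mapP[k' k'S ->]; rewrite -i'E; apply: step => //; rewrite /jump i'E.
by move: i12; rewrite !inE => /orP[]/eqP->.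
Qed.

Lemma next_block omega n : move omega 0 (n, 19%N) = (n + 1, 0%N).
Proof. by rewrite /move /tile /=; case: (omega n). Qed.

Lemma path_from_origin omega n k : (k < 20)%N -> exists w, act (move omega) w (0, 0%N) = (n, k).
Proof.
move=> k20.
have rev_path s t : (exists w, act (move omega) w s = t) -> exists w, act (move omega) w t = s.
  by move=> [w <-]; exists (rev w); rewrite act_revK //; exact: move_action.
have trans s t u : (exists w, act (move omega) w s = t) ->
    (exists w, act (move omega) w t = u) -> exists w, act (move omega) w s = u.
  by move=> [w <-] [w' <-]; exists (w' ++ w); rewrite act_cat.
have inblock m j : (j < 20)%N -> exists w, act (move omega) w (m, 0%N) = (m, j).
  by move=> /(block_path (omega m))[w hw]; exists w; exact: hw.
have next m : exists w, act (move omega) w (m, 0%N) = (m + 1, 0%N).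
  apply: (trans _ (m, 19%N)); first exact: inblock.
  by exists [:: 0]; rewrite /= next_block.
apply: (trans _ (n, 0%N)); last exact: inblock.
case: n => n.
  elim: n => [|n IH]; first by exists [::].
  by apply: (trans _ _ _ IH); rewrite intS addrC; exact: next.
rewrite NegzE; elim: n => [|n IH]; refine (rev_path _ _ _).
  by have := next (- 1); rewrite addNr.
apply: (trans _ (- n.+1%:Z, 0%N)); last exact: (rev_path _ _ IH).
by have := next (- n.+2%:Z); rewrite (_ : - n.+2%:Z + 1 = - n.+1%:Z) //; lia.
Qed.

Lemma path_between omega s t : (s.2 < 20)%N -> (t.2 < 20)%N ->
  exists w, act (move omega) w s = t.
Proof.
case: s t => n k [m l] /= /(path_from_origin omega n)[w <-] /(path_from_origin omega m)[w' <-].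
by exists (w' ++ rev w); rewrite act_cat act_revK //; exact: move_action.
Qed.

Lemma tile_lt b i k : (k < 20)%N -> (tile b i k < 20)%N.
Proof.
move=> k20; have /allP/(_ k) : all (fun k => tile b i k < 20)%N tiles.
  by case: i => [|[|[|i]]]; case: b.
by rewrite mem_iota => /(_ k20).
Qed.

Lemma act_lt omega w s : (s.2 < 20)%N -> ((act (move omega) w s).2 < 20)%N.
Proof. by move=> s20; elim: w => //= i w IH; exact: tile_lt. Qed.

(** * Groups presented by three reflections *)

Definition evalw (G : groupType) (s : 'I_3 -> G) (w : word) : G :=
  foldr (fun i g => s i * g)%g 1%g w.

(** A presentation of the group: [gen_faithful] says that its relations are
    consequences of the given ones. *)
Record coxeter_generators (G : groupType) (s : 'I_3 -> G) : Prop := CoxeterGenerators {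
  gen_inv : forall i, (s i * s i)%g = 1%g;
  gen_order : forall i j, ((s i * s j) ^+ 4)%g = 1%g;
  gen_span : forall g, exists w, g = evalw s w;
  gen_faithful : forall w, evalw s w = 1%g -> weq w [::] }.

Section CoxeterGroup.
Variables (R : realFieldType) (r : R) (r_gt0 : 0 < r) (r2 : r * r = 2).
Variables (G : groupType) (s : 'I_3 -> G) (sP : coxeter_generators s).
Notation ev := (evalw s).
Local Open Scope group_scope.

Lemma ev_cat w w' : ev (w ++ w') = ev w * ev w'.
Proof. by elim: w => [|i w IH] /=; rewrite ?mul1g // IH mulgA. Qed.

Lemma ev1 i : ev [:: i] = s i. Proof. by rewrite /= mulg1. Qed.

Lemma mult_action : coxeter_action (fun i g => s i * g).
Proof.
split=> [i g|i j g]; first by rewrite mulgA (gen_inv sP) mul1g.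
rewrite -[RHS]mul1g -(gen_order sP i j).
by rewrite -iter_mulg; apply: eq_iter => x; rewrite mulgA.
Qed.

Lemma weq_ev w w' : weq w w' -> ev w = ev w'.
Proof. by move=> h; have := h _ _ mult_action 1. Qed.

Lemma ev_rev w : ev (rev w) = (ev w)^-1.
Proof.
apply/esym/mulg1_eq; rewrite -ev_cat -[1]/(ev [::]).
by apply: weq_ev; rewrite -[rev w]cats0; exact: weq_revr.
Qed.

Lemma ev_weq w w' : ev w = ev w' -> weq w w'.
Proof.
move=> e; have h : weq (rev w' ++ w) [::].
  by apply: (gen_faithful sP); rewrite ev_cat ev_rev e mulVg.
apply: (@weq_trans (w' ++ rev w' ++ w)); first exact/weq_sym/weq_revr.
by rewrite -[X in weq _ X]cats0; apply: weq_cat.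
Qed.

Definition word_of (g : G) : word := sval (cid (gen_span sP g)).
Lemma word_ofP g : g = ev (word_of g).
Proof. exact: (svalP (cid (gen_span sP g))). Qed.

Section Action.
Variables (Y : Type) (a : 'I_3 -> Y -> Y) (aP : coxeter_action a).
(** An action of the generators extends to the group because [weq] is equality in
    it. *)
Definition gact (g : G) (y : Y) : Y := act a (word_of g) y.

Lemma gact_ev w y : gact (ev w) y = act a w y.
Proof. by rewrite /gact; apply: (ev_weq _ aP); rewrite -word_ofP. Qed.

Lemma gactM g h y : gact (g * h) y = gact g (gact h y).
Proof.
by rewrite (word_ofP g) (word_ofP h) -ev_cat !gact_ev act_cat.
Qed.

Lemma gact1 y : gact 1 y = y.
Proof. by rewrite -[1]/(ev [::]) gact_ev. Qed.

Lemma gacts i y : gact (s i) y = a i y.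
Proof. by rewrite -[s i]ev1 gact_ev. Qed.

Lemma gactK g y : gact g^-1 (gact g y) = y.
Proof. by rewrite -gactM mulVg gact1. Qed.

Lemma gactKV g y : gact g (gact g^-1 y) = y.
Proof. by rewrite -gactM mulgV gact1. Qed.
End Action.

Definition toggle (l i : 'I_3) (x : bool) : bool := x (+) (i == l).

Lemma toggle_action l : coxeter_action (toggle l).
Proof.
split=> [i x|i j x]; rewrite /toggle /=; first by rewrite addbK.
by case: (i == l); case: (j == l); case: x.
Qed.

(** The number of letters l modulo 2, a homomorphism since all relators are even
    in each letter. *)
Definition parity l (g : G) : bool := gact (toggle l) g false.

Lemma gact_toggle l g x : gact (toggle l) g x = x (+) parity l g.
Proof.
rewrite /parity /gact; elim: (word_of g) => [|i w IH] /=; first by rewrite addbF.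
by rewrite IH /toggle addbA.
Qed.

Lemma parityM l g h : parity l (g * h) = parity l g (+) parity l h.
Proof. by rewrite {1}/parity (gactM (toggle_action l)) gact_toggle addbC. Qed.

Lemma parity1 l : parity l 1 = false.
Proof. exact: (gact1 (toggle_action l)). Qed.

Lemma paritys l i : parity l (s i) = (i == l).
Proof. exact: (gacts (toggle_action l)). Qed.

Lemma parityV l g : parity l g^-1 = parity l g.
Proof. by have := parityM l g g^-1; rewrite mulgV parity1; case: (parity l g); case: parity. Qed.

Lemma parityJ l g h : parity l (g ^ h) = parity l g.
Proof. by rewrite !parityM parityV addbC addbK. Qed.

Lemma gen_invE i : (s i)^-1 = s i. Proof. by apply: mulg1_eq; exact: (gen_inv sP). Qed.

(** The product of two generators has order exactly 4, as the geometric
    representation shows. *)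
Lemma braid_neq1 i j : i != j -> s i * s j * s i * s j != 1.
Proof.
move=> ij; apply/eqP => h.
have /(gen_faithful sP) : ev [:: i; j; i; j] = 1 by rewrite /= mulg1 !mulgA.
move=> /(_ _ _ (rrefl_action r2) (root R i)) /=; rewrite rrefl_rot2 //.
rewrite !coroot_root coxii coxij 1?eq_sym // => /rowP/(_ i)/eqP.
rewrite !mxE !eqxx (negPf ij) /= !mulr1 mulr0 subr0 => /eqP.
have := r2; lra.
Qed.

Section Dihedral.
Variables (i j : 'I_3) (ij : i != j).
Notation S := (s i).
Notation T := (s j).

Lemma gen1K x : S * (S * x) = x. Proof. by rewrite mulgA (gen_inv sP) mul1g. Qed.
Lemma gen2K x : T * (T * x) = x. Proof. by rewrite mulgA (gen_inv sP) mul1g. Qed.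

Lemma braid : S * (T * (S * T)) = T * (S * (T * S)).
Proof.
have := weq_ev (weq_braid i j); by rewrite /= !mulg1.
Qed.

Lemma braidx x : S * (T * (S * (T * x))) = T * (S * (T * (S * x))).
Proof. by have := congr1 (fun z => z * x) braid; rewrite -!mulgA. Qed.

(** The involutions of the dihedral group of order 8: the central rotation and two
    classes of two reflections. *)
Lemma dihedral_involution w : all (mem [:: i; j]) w -> ev w * ev w = 1 ->
  [\/ ev w = 1 \/ ev w = S * (T * (S * T)), ev w = S \/ ev w = T * (S * T) |
      ev w = T \/ ev w = S * (T * S)].
Proof.
move=> /(dihedral_normal_form)[m [m4 H]].
have c1 := braid_neq1 ij.
have c1' : (T * S * T * S != 1) by rewrite braid_neq1 // eq_sym.
have m5 : (m < 5)%N by move: m4; lia.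
case: m H m4 m5 => [|[|[|[|[|//]]]]] /= H _ _; case: H => /weq_ev ->; rewrite /= ?mulg1 => e.
- by constructor 1; left.
- by constructor 1; left.
- by constructor 2; left.
- by constructor 3; left.
- by rewrite !mulgA in e; rewrite e eqxx in c1'.
- by rewrite !mulgA in e; rewrite e eqxx in c1.
- by constructor 3; right.
- by constructor 2; right.
- by constructor 1; right; rewrite braid.
- by constructor 1; right.
Qed.

Lemma same_type_square U V : U = S \/ U = T * (S * T) -> V = S \/ V = T * (S * T) ->
  U * V * (U * V) = 1.
Proof.
have o4 : S * (T * (S * (T * (S * (T * (S * T)))))) = 1.
  by rewrite -(gen_order sP i j) !expgS expg0 mulg1 -!mulgA.
have o4' : T * (S * (T * (S * (T * (S * (T * S)))))) = 1.
  by rewrite -(gen_order sP j i) !expgS expg0 mulg1 -!mulgA.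
case=> ->; case=> ->; rewrite -!mulgA //.
  by rewrite gen1K (gen_inv sP).
by rewrite !(gen2K, gen1K) (gen_inv sP).
Qed.

(** Reflections of different classes are a conjugate of the two generators, by the
    same element. *)
Lemma cross_pair U V : U = S \/ U = T * (S * T) -> V = T \/ V = S * (T * S) ->
  exists X, U = S ^ X /\ V = T ^ X.
Proof.
case=> ->; case=> ->.
- by exists 1; rewrite !conjg1.
- by exists S; rewrite /conjg gen_invE gen1K.
- by exists T; rewrite /conjg gen_invE gen2K.
- by exists (S * T); rewrite /conjg invgM !gen_invE -!mulgA !gen1K braid gen2K.
Qed.

Lemma cross_not_commute X : S ^ X * T ^ X != T ^ X * S ^ X.
Proof.
apply: contra_neq (braid_neq1 ij); rewrite -!conjMg => /conjg_inj e.
by rewrite e -!mulgA gen1K (gen_inv sP).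
Qed.
End Dihedral.

Lemma dihedral_in_parabolic (u v : G) :
  u * u = 1 -> v * v = 1 -> (u * v) ^+ 4 = 1 ->
  exists g i j, i != j /\ exists U V,
    [/\ u = U ^ g, v = V ^ g,
        (exists2 w, all (mem [:: i; j]) w & U = ev w) &
        (exists2 w, all (mem [:: i; j]) w & V = ev w)].
Proof.
move=> uu vv uv4; pose wu := word_of u; pose wv := word_of v.
have [|||g [k [u' [v' [au av eu evv]]]]] := @finite_dihedral _ _ r_gt0 r2 wu wv.
- by apply: ev_weq; rewrite ev_cat -word_ofP.
- by apply: ev_weq; rewrite ev_cat -word_ofP.
- apply: ev_weq; rewrite !ev_cat -!word_ofP [RHS]/= -uv4.
  by rewrite !expgS expg0 mulg1 -!mulgA.
have [i [j [ij hij]]] : exists i j : 'I_3, i != j /\ forall l, predC1 k l -> mem [:: i; j] l.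
  case: k {au av} => [[|[|[|//]]]] h.
  - exists (inord 1), (inord 2); rewrite -val_eqE /= !inordK //; split=> // -[[|[|[|//]]] l];
    by rewrite /= !inE -!val_eqE /= !inordK.
  - exists (inord 0), (inord 2); rewrite -val_eqE /= !inordK //; split=> // -[[|[|[|//]]] l];
    by rewrite /= !inE -!val_eqE /= !inordK.
  - exists (inord 0), (inord 1); rewrite -val_eqE /= !inordK //; split=> // -[[|[|[|//]]] l];
    by rewrite /= !inE -!val_eqE /= !inordK.
exists (ev g), i, j; split=> //; exists (ev u'), (ev v'); split.
- by rewrite -(weq_ev eu) !ev_cat -word_ofP ev_rev /conjg -!mulgA mulVg mulg1 mulKg.
- by rewrite -(weq_ev evv) !ev_cat -word_ofP ev_rev /conjg -!mulgA mulVg mulg1 mulKg.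
- by exists u' => //; apply: sub_all au.
- by exists v' => //; apply: sub_all av.
Qed.

Lemma conjg_square (U g : G) : U ^ g * U ^ g = 1 -> U * U = 1.
Proof. by rewrite -conjMg => /eqP; rewrite conjg_eq1 => /eqP. Qed.

(** The pair lies in a dihedral group by [dihedral_in_parabolic]. A central
    element or two reflections of the same class would give a product of order at
    most 2. *)
Lemma acute_pair (u v : G) :
  u * u = 1 -> v * v = 1 -> (u * v) ^+ 4 = 1 -> (u * v) ^+ 2 != 1 ->
  exists g i j, [/\ i != j, u = s i ^ g & v = s j ^ g].
Proof.
move=> uu vv uv4 uv2; have [g [i [j [ij [U [V [uE vE Uw Vw]]]]]]] := dihedral_in_parabolic uu vv uv4.
have UU : U * U = 1 by apply: (@conjg_square U g); rewrite -uE.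
have VV : V * V = 1 by apply: (@conjg_square V g); rewrite -vE.
have UV2 : U * V * (U * V) != 1.
  by apply: contraNneq uv2 => h; rewrite uE vE -conjMg -conjXg expg2 h conj1g.
have cen (C : G) : C = 1 \/ C = s i * (s j * (s i * s j)) ->
    forall w, all (mem [:: i; j]) w -> C * ev w = ev w * C.
  case=> -> ; first by move=> w _; rewrite mul1g mulg1.
  elim=> [|l w IH] /=; first by rewrite mul1g mulg1.
  case/andP; rewrite !inE => lij /IH {}IH; rewrite mulgA -[RHS]mulgA -IH !mulgA; congr (_ * _).
  case/orP: lij => /eqP->; rewrite -!mulgA.
    by rewrite gen1K braidx (gen_inv sP) mulg1.
  by rewrite (gen_inv sP) mulg1 braid gen2K.
case: Uw => wu au Ue; case: Vw => wv av Ve; subst U V.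
have Uc : ~ (ev wu = 1 \/ ev wu = s i * (s j * (s i * s j))).
  move=> /cen /(_ wv av) e; move: UV2; rewrite -mulgA [ev wv * _]mulgA -e.
  by rewrite !mulgA UU mul1g VV eqxx.
have Vc : ~ (ev wv = 1 \/ ev wv = s i * (s j * (s i * s j))).
  move=> /cen /(_ wu au) e; move: UV2; rewrite -mulgA [ev wv * _]mulgA e.
  by rewrite !mulgA UU mul1g VV eqxx.
case: (dihedral_involution ij au UU) => // HU; case: (dihedral_involution ij av VV) => // HV.
- by move: UV2; rewrite (same_type_square HU HV) eqxx.
- have [X [UX VX]] := cross_pair HU HV.
  by exists (X * g), i, j; split=> //; rewrite conjgM -?UX -?VX.
- have [X [UX VX]] := cross_pair HV HU.
  by exists (X * g), j, i; split=> //; rewrite 1?eq_sym // conjgM -?UX -?VX.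
- by move: UV2; rewrite (same_type_square HU HV) eqxx.
Qed.

(** Odd involutions exclude the central rotation, and commuting distinct
    reflections in the same dihedral group are in the same class: they are
    conjugate by a generator. *)
Lemma commuting_pair (u v : G) l l' :
  u * u = 1 -> v * v = 1 -> u * v = v * u -> u != v -> parity l u -> parity l' v ->
  exists g i j, [/\ i != j, u = s i ^ g & v = s i ^ (s j * g)].
Proof.
move=> uu vv uv neq pu pv.
have uv4 : (u * v) ^+ 4 = 1.
  have e4 (x : G) : x * x = 1 -> x ^+ 4 = 1 by move=> h; rewrite (expgnA x 2 2) !expg2 !h mulg1.
  by rewrite expgMn // !e4 // mulg1.
have [g [i [j [ij [U [V [uE vE Uw Vw]]]]]]] := dihedral_in_parabolic uu vv uv4.
have UU : U * U = 1 by apply: (@conjg_square U g); rewrite -uE.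
have VV : V * V = 1 by apply: (@conjg_square V g); rewrite -vE.
case: Uw => wu au Ue; case: Vw => wv av Ve; subst U V.
have even (k : 'I_3) (C : G) : C = 1 \/ C = s i * (s j * (s i * s j)) -> parity k C = false.
  case=> ->; rewrite ?parity1 // !parityM !paritys.
  by case: (i == k); case: (j == k).
have finish a b U V : u = U ^ g -> v = V ^ g ->
    U = s a \/ U = s b * (s a * s b) -> V = s a \/ V = s b * (s a * s b) -> a != b ->
    exists g i j, [/\ i != j, u = s i ^ g & v = s i ^ (s j * g)].
  have sJ : s a ^ s b = s b * (s a * s b) by rewrite /conjg gen_invE.
  move=> {}uE {}vE HU HV ab; case: HU HV uE vE => -> [] -> uE vE.
  - by rewrite uE vE eqxx in neq.
  - by exists g, a, b; split=> //; rewrite conjgM sJ.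
  - exists (s b * g), a, b; split=> //; first by rewrite conjgM sJ.
    by rewrite mulgA (gen_inv sP) mul1g.
  - by rewrite uE vE eqxx in neq.
case: (dihedral_involution ij au UU) => HU.
- by move: pu; rewrite uE parityJ even.
- case: (dihedral_involution ij av VV) => HV.
  + by move: pv; rewrite vE parityJ even.
  + exact: (finish i j _ _ uE vE).
  + have [X [UX VX]] := cross_pair HU HV.
    have := cross_not_commute ij X; rewrite -UX -VX; case/eqP.
    by apply: (@conjg_inj _ g); rewrite !conjMg -uE -vE.
- case: (dihedral_involution ij av VV) => HV.
  + by move: pv; rewrite vE parityJ even.
  + have [X [VX UX]] := cross_pair HV HU.
    have := cross_not_commute ij X; rewrite -UX -VX; case/eqP.
    by apply: (@conjg_inj _ g); rewrite !conjMg -uE -vE.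
  + apply: (finish j i _ _ uE vE) => //; by rewrite eq_sym.
Qed.

Section Stabilizer.
Variable omega : int -> bool.
Let mP := move_action omega.
Notation ga := (gact (move omega)).

Definition stab (x : place) : {pred G} := [pred g | ga g x == x].

Lemma stabE x g : (g \in stab x) = (ga g x == x). Proof. by []. Qed.

Lemma stab_closed x : group_closed (stab x).
Proof.
split=> [|g h]; rewrite !stabE; first by rewrite (gact1 mP).
move=> /eqP gx /eqP hx; apply/eqP.
by rewrite (gactM mP) -{1}hx (gactK mP) gx.
Qed.

(** Moving the base triangle conjugates the stabiliser. *)
Lemma stabJ x g h : (h ^ g \in stab x) = (h \in stab (ga g x)).
Proof.
rewrite !stabE !(gactM mP); apply/eqP/eqP => [|->]; last by rewrite (gactK mP).
by move=> /(congr1 (ga g)); rewrite (gactKV mP).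
Qed.

Lemma gact_lt g x : (x.2 < 20)%N -> ((ga g x).2 < 20)%N.
Proof. exact: act_lt. Qed.

(** The cocycle given by [crossing_move]: the parity of the number of reflections
    in side e along a path from x labelled by g. *)
Definition crossing_parity (e : int) (x : place) (g : G) : bool :=
  (gact (crossing_move omega e) g (x, false)).2.

Lemma gact_crossing e g x b :
  gact (crossing_move omega e) g (x, b) = (ga g x, b (+) crossing_parity e x g).
Proof.
rewrite /crossing_parity /gact; elim: (word_of g) => [|i w IH] /=; first by rewrite addbF.
rewrite IH /crossing_move /= act_crossing; congr (_, _).
by rewrite addbA.
Qed.

Lemma crossing_parityM e x g h :
  crossing_parity e x (g * h) = crossing_parity e (ga h x) g (+) crossing_parity e x h.
Proof.
rewrite {1}/crossing_parity (gactM (crossing_action omega e)) !gact_crossing /=.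
by rewrite addbC.
Qed.

Lemma crossing_parity_gen e x i : crossing_parity e x (s i) = crosses omega e i x.
Proof. by rewrite /crossing_parity (gacts (crossing_action omega e)). Qed.

Lemma crossing_parity1 e x : crossing_parity e x 1 = false.
Proof. by rewrite /crossing_parity (gact1 (crossing_action omega e)). Qed.

Lemma crossing_parityJ e x g h : ga h (ga g x) = ga g x ->
  crossing_parity e x (h ^ g) = crossing_parity e (ga g x) h.
Proof.
move=> hx; have : crossing_parity e (ga g x) g^-1 (+) crossing_parity e x g = false.
  by rewrite -crossing_parityM mulVg crossing_parity1.
rewrite /conjg !crossing_parityM (gactM mP) hx.
by case: (crossing_parity e x g); case: (crossing_parity e (ga g x) g^-1);
  case: (crossing_parity e (ga g x) h).
Qed.

(** The element follows a path g to a triangle with an edge on side e, reflects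
    in that edge, and goes back. *)
Definition on_side (x : place) (e : int) (u : G) : Prop :=
  exists g i, [/\ move omega i (ga g x) = ga g x, side omega i (ga g x) = Some e
                & u = s i ^ g].

Lemma on_side_stab x e u : on_side x e u -> u \in stab x.
Proof. by move=> [g [i [fx _ ->]]]; rewrite stabJ stabE (gacts mP) fx. Qed.

Lemma on_sideJ x e u h : h \in stab x -> on_side x e u -> on_side x e (u ^ h).
Proof.
rewrite stabE => /eqP hx [g [i [fx sx ->]]]; exists (g * h), i.
by rewrite (gactM mP) hx; split=> //; rewrite conjgM.
Qed.

Lemma on_side_inv x e u : on_side x e u -> u * u = 1.
Proof. by move=> [g [i [_ _ ->]]]; rewrite -conjMg (gen_inv sP) conj1g. Qed.

Lemma on_side_parity x e u : on_side x e u -> exists l, parity l u.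
Proof. by move=> [g [i [_ _ ->]]]; exists i; rewrite parityJ paritys eqxx. Qed.

Lemma crossing_parity_loop x g i e : move omega i (ga g x) = ga g x ->
  crossing_parity e x (s i ^ g) = (side omega i (ga g x) == Some e).
Proof.
move=> fx; rewrite crossing_parityJ ?(gacts mP) // crossing_parity_gen /crosses fx eqxx; exact: andTb.
Qed.

Lemma on_side_crossing_parity x e e' u : on_side x e u -> crossing_parity e' x u = (e == e').
Proof. by move=> [g [i [fx sx ->]]]; rewrite crossing_parity_loop // sx. Qed.

Lemma on_side_uniq x e e' u : on_side x e u -> on_side x e' u -> e = e'.
Proof.
move=> h h'; apply/eqP; rewrite -(on_side_crossing_parity e' h) (on_side_crossing_parity e' h').
exact: eqxx.
Qed.

Lemma bounce_commute i ls : s i * ev (bounce i ls) = ev (bounce i ls) * s i.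
Proof.
elim: ls => [|l ls IH] /=; first by rewrite mulg1 mul1g.
have := weq_ev (weq_braid i l); rewrite /= !mulg1 => b.
rewrite -!mulgA -IH; have := congr1 (fun z => z * ev (bounce i ls)) b.
by rewrite -!mulgA.
Qed.

(** Bounces commute with the reflection and lead from both edges to the base edge
    of the side, so they join into an element of the stabiliser that conjugates
    one reflection into the other. *)
Lemma on_side_conj x e u u' : on_side x e u -> on_side x e u' ->
  exists2 h, h \in stab x & u' = u ^ h.
Proof.
move=> [g [i [fx sx ->]]] [g' [i' [fx' sx' ->]]].
have [iE [ls [_ bl]]] := side_base fx sx.
have [iE' [ls' [_ bl']]] := side_base fx' sx'.
have ii : i' = i by apply: val_inj; rewrite iE iE'.
subst i'; pose b := ev (bounce i ls); pose b' := ev (bounce i ls').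
exists (g^-1 * b^-1 * (b' * g')).
  rewrite stabE; apply/eqP; rewrite !(gactM mP) {1}/b' (gact_ev mP) bl' -bl.
  by rewrite -(gact_ev mP) -/b !(gactK mP).
have comm c : s i * c = c * s i -> s i ^ c = s i by move=> h; rewrite /conjg h mulKg.
have gh : g * (g^-1 * b^-1 * (b' * g')) = b^-1 * b' * g' by rewrite !mulgA mulgV mul1g.
have cb : s i * b = b * s i by exact: bounce_commute.
have cb' : s i * b' = b' * s i by exact: bounce_commute.
by rewrite -conjgM gh !conjgM [s i ^ b^-1]comm ?[s i ^ b']comm //; apply/commuteV.
Qed.

(** The stabiliser contains the conjugates of two generators i and j by some g, so
    both sides i and j of the triangle g x are on the boundary. *)
Lemma acute_pair_sides x u v : (x.2 < 20)%N -> u \in stab x -> v \in stab x ->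
  u * u = 1 -> v * v = 1 -> (u * v) ^+ 4 = 1 -> (u * v) ^+ 2 != 1 ->
  exists e e', [/\ on_side x e u, on_side x e' v & adjacent omega false e e'].
Proof.
move=> x20 ux vx uu vv uv4 uv2.
have [g [i [j [ij uE vE]]]] := acute_pair uu vv uv4 uv2.
have fi : move omega i (ga g x) = ga g x.
  by apply/eqP; rewrite -(gacts mP) -stabE -stabJ -uE.
have fj : move omega j (ga g x) = ga g x.
  by apply/eqP; rewrite -(gacts mP) -stabE -stabJ -vE.
have [e [e' [se se' adj]]] := acute_corner (gact_lt g x20) ij fi fj.
by exists e, e'; split=> //; [exists g, i|exists g, j].
Qed.

(** By [commuting_pair] the two reflections come from adjacent triangles with the
    same boundary side i. *)
Lemma commuting_pair_sides x u v e e' : (x.2 < 20)%N ->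
  on_side x e u -> on_side x e' v -> u * v = v * u -> e != e' ->
  adjacent omega true e e'.
Proof.
move=> x20 su sv uv ee.
have neq : u != v by apply: contra_neq ee => uv'; rewrite -uv' in sv; exact: (on_side_uniq su sv).
have [[l pu] [l' pv]] := (on_side_parity su, on_side_parity sv).
have [g [i [j [ij uE vE]]]] :=
  commuting_pair (on_side_inv su) (on_side_inv sv) uv neq pu pv.
have fi : move omega i (ga g x) = ga g x.
  by apply/eqP; rewrite -(gacts mP) -stabE -stabJ -uE (on_side_stab su).
have E : ga (s j * g) x = move omega j (ga g x) by rewrite (gactM mP) (gacts mP).
have fj : move omega i (move omega j (ga g x)) = move omega j (ga g x).
  by apply/eqP; rewrite -E -(gacts mP) -stabE -stabJ -vE (on_side_stab sv).
have si : side omega i (ga g x) = Some e.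
  by apply/eqP; rewrite -(crossing_parity_loop e fi) -uE (on_side_crossing_parity e su).
have sj : side omega i (move omega j (ga g x)) = Some e'.
  by apply/eqP; rewrite -E -crossing_parity_loop ?E // -vE (on_side_crossing_parity e' sv).
apply: (right_corner (gact_lt g x20) fi _ fj si sj ee).
by apply: contraNneq ee => jj; move: sj; rewrite jj si => -[->].
Qed.

Lemma corner_elements x e : (x.2 < 20)%N -> exists u v,
  [/\ on_side x e u, on_side x (e + 1) v &
      if right_angled omega e then u * v = v * u
      else (u * v) ^+ 4 = 1 /\ (u * v) ^+ 2 != 1].
Proof.
move=> x20; have [t [i [l [t20 C]]]] := corner_exists omega e.
have [w wx] := path_between omega x20 t20.
have gx : ga (ev w) x = t by rewrite (gact_ev mP).
move: C; rewrite /corner; case: ifP => _.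
  case=> fi fl fil si sl; exists (s i ^ ev w), (s i ^ (s l * ev w)); split.
  - by exists (ev w), i; rewrite gx.
  - by exists (s l * ev w), i; rewrite (gactM mP) (gacts mP) gx.
  rewrite conjgM -!conjMg; congr (_ ^ _).
  have := weq_ev (weq_braid i l); rewrite /= !mulg1 /conjg gen_invE => ->.
  by rewrite -!mulgA.
case=> il fi fl si sl; exists (s i ^ ev w), (s l ^ ev w); split.
- by exists (ev w), i; rewrite gx.
- by exists (ev w), l; rewrite gx.
rewrite -!conjMg -!conjXg (gen_order sP) conj1g conjg_eq1; split=> //.
by rewrite expg2 mulgA braid_neq1.
Qed.
End Stabilizer.
End CoxeterGroup.

(** * Rigidity of the corner sequence *)

(** An injective walk on the integers with steps 1 and -1 cannot turn back. *)
Lemma int_line (sigma : int -> int) : injective sigma ->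
  (forall e, sigma (e + 1) = sigma e + 1 \/ sigma e = sigma (e + 1) + 1) ->
  (forall e, sigma e = sigma 0 + e) \/ (forall e, sigma e = sigma 0 - e).
Proof.
move=> inj step.
have const d : d = 1 \/ d = -1 -> sigma 1 = sigma 0 + d -> forall e, sigma e = sigma 0 + d * e.
  move=> d1 s1.
  have up e : sigma (e + 1) = sigma e + d -> sigma (e + 1 + 1) = sigma (e + 1) + d.
    move=> se; have ne : sigma (e + 1 + 1) <> sigma e by move=> /inj; lia.
    by have := step (e + 1); move: d1; lia.
  have down e : sigma (e + 1) = sigma e + d -> sigma e = sigma (e - 1) + d.
    move=> se; have ne : sigma (e + 1) <> sigma (e - 1) by move=> /inj; lia.
    by have := step (e - 1); rewrite subrK; move: d1; lia.
  have all_e e : sigma (e + 1) = sigma e + d.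
    case: e => n.
      elim: n => [|n IH]; first by rewrite add0r.
      have -> : n.+1%:Z = n%:Z + 1 by lia.
      exact: (up _ IH).
    rewrite NegzE; elim: n => [|n IH].
      have := @down 0; rewrite add0r sub0r => h; rewrite addNr; exact: h.
    have := @down (- n.+1%:Z); rewrite (_ : - n.+1%:Z - 1 = - n.+2%:Z); last by lia.
    by rewrite (_ : - n.+2%:Z + 1 = - n.+1%:Z); [exact|lia].
  case=> n.
    elim: n => [|n IH]; first by rewrite mulr0 addr0.
    have -> : n.+1%:Z = n%:Z + 1 by lia.
    by rewrite all_e IH mulrDr mulr1 addrA.
  rewrite NegzE; elim: n => [|n IH].
    by have := all_e (-1); rewrite addNr mulrN mulr1 => ->; rewrite addrK.
  have := all_e (- n.+2%:Z); rewrite (_ : - n.+2%:Z + 1 = - n.+1%:Z); last by lia.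
  rewrite IH => /esym/eqP; rewrite -subr_eq => /eqP <-.
  by rewrite (_ : n.+2%:Z = n.+1%:Z + 1); [ring|lia].
have [s1|s1] := step 0; rewrite add0r in s1.
  by left=> e; rewrite (const 1) ?mul1r //; left.
right=> e; rewrite (const (-1)) ?mulN1r //; first by right.
by rewrite s1 addrK.
Qed.

(** Each side is hence adjacent to a corner of angle pi/4, where its reflections
    are recognised by [acute_pair_sides]. *)
Lemma right_angled_isolated omega e : right_angled omega e ->
  ~~ right_angled omega (e + 1).
Proof.
rewrite /right_angled; have [q [j [-> [j0 j5]]]] : exists q j : int, e = q * 5 + j /\ 0 <= j /\ j < 5.
  exists (e %/ 5)%Z, (e %% 5)%Z; rewrite -divz_eq modz_ge0 // ltz_pmod //.
rewrite modzMDl divzMDl // (divz_small (m := j)) ?j0 //= (modz_small (m := j)) ?j0 //= addr0 => h.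
rewrite -addrA modzMDl divzMDl //.
have j2 : j + 1 < 5 by move: h; case: (omega q) => /eqP ->.
rewrite (divz_small (m := j + 1)) ?(modz_small (m := j + 1)) ?addr0 ?j2 /= ?andbT ?addr_ge0 //.
by move: h; case: (omega q) => /eqP ->.
Qed.

Section Rigidity.
Variables (R : realFieldType) (r : R) (r_gt0 : 0 < r) (r2 : r * r = 2).
Variables (G : groupType) (s : 'I_3 -> G) (sP : coxeter_generators s).
Variables (omega omega' : int -> bool) (x y : place).
Hypotheses (x20 : (x.2 < 20)%N) (y20 : (y.2 < 20)%N).
Notation H := (stab sP omega x).
Notation K := (stab sP omega' y).
Variable f : G -> G.
Hypotheses (fK : forall u, u \in H -> f u \in K)
  (f_onto : forall v, v \in K -> exists2 u, u \in H & f u = v)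
  (f_inj : {in H &, injective f})
  (fM : {in H &, {morph f : u v / (u * v)%g}}).
Local Open Scope group_scope.

Let H1 : 1 \in H. Proof. by have [] := stab_closed sP omega x. Qed.
Let HV u : u \in H -> u^-1 \in H.
Proof. by have [h1 hd] := stab_closed sP omega x => uH; rewrite -[u^-1]mul1g; apply: hd. Qed.
Let HM u v : u \in H -> v \in H -> u * v \in H.
Proof.
have [h1 hd] := stab_closed sP omega x => uH vH; rewrite -[v]invgK.
by apply: hd => //; exact: HV.
Qed.
Let HX u n : u \in H -> u ^+ n \in H.
Proof. by move=> uH; elim: n => [|n IH]; rewrite ?expg0 ?expgS //; exact: HM. Qed.
Let HJ u v : u \in H -> v \in H -> u ^ v \in H.
Proof. by move=> uH vH; rewrite /conjg !HM // HV. Qed.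

Let f1 : f 1 = 1.
Proof. by apply: (mulgI (f 1)); rewrite -fM // !mulg1. Qed.
Let fV u : u \in H -> f u^-1 = (f u)^-1.
Proof. by move=> uH; apply/esym/mulg1_eq; rewrite -fM ?HV // mulgV f1. Qed.
Let fX u n : u \in H -> f (u ^+ n) = f u ^+ n.
Proof. by move=> uH; elim: n => [|n IH]; rewrite ?expg0 ?f1 // !expgS fM ?IH ?HX. Qed.
Let fJ u v : u \in H -> v \in H -> f (u ^ v) = f u ^ f v.
Proof. by move=> uH vH; rewrite /conjg fM ?HV ?HM // fM // fV. Qed.

Notation side_H := (on_side sP omega x).
Notation side_K := (on_side sP omega' y).
Let side_in e u : side_H e u -> u \in H. Proof. exact: on_side_stab. Qed.

Lemma acute_image e e' u v : side_H e u -> side_H e' v ->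
  (u * v) ^+ 4 = 1 -> (u * v) ^+ 2 != 1 ->
  exists e1 e1', [/\ side_K e1 (f u), side_K e1' (f v) & adjacent omega' false e1 e1'].
Proof.
move=> su sv h4 h2; have [uH vH] := (side_in su, side_in sv).
have uv := HM uH vH.
apply: (acute_pair_sides r_gt0 r2) => //; try exact: fK.
- by rewrite -fM // (on_side_inv su) f1.
- by rewrite -fM // (on_side_inv sv) f1.
- by rewrite -fM // -fX // h4 f1.
- rewrite -fM // -fX //; apply: contraNneq h2 => h.
  by apply/eqP/f_inj; rewrite ?HX // h f1.
Qed.

(** An isomorphism preserves the algebraic description of the corners of angle
    pi/4, so it sends some reflection in side e to a reflection in a side; all
    reflections in side e follow because they are conjugate in the stabiliser. *)
Lemma side_image e : exists e1, forall u, side_H e u -> side_K e1 (f u).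
Proof.
have [u0 [e1 [su0 se1]]] : exists u0 e1, side_H e u0 /\ side_K e1 (f u0).
  case: (boolP (right_angled omega e)) => re.
    have re' : ~~ right_angled omega (e - 1).
      by apply: contraL re => /right_angled_isolated; rewrite GRing.subrK.
    have [u [v [su sv]]] := corner_elements r2 sP omega (e - 1) x20.
    rewrite (negPf re') => -[h4 h2]; have [e1 [e1' [h h' _]]] := acute_image su sv h4 h2.
    by exists v, e1'; rewrite GRing.subrK in sv.
  have [u [v [su sv]]] := corner_elements r2 sP omega e x20.
  rewrite (negPf re) => -[h4 h2]; have [e1 [e1' [h h' _]]] := acute_image su sv h4 h2.
  by exists u, e1.
exists e1 => u su; have [h hH ->] := on_side_conj su0 su.
by rewrite fJ // ?(side_in su0) //; apply: on_sideJ => //; exact: fK.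
Qed.

Definition sigma (e : int) : int := sval (cid (side_image e)).
Lemma sigmaP e u : side_H e u -> side_K (sigma e) (f u).
Proof. exact: (svalP (cid (side_image e))). Qed.

(** Conjugation in the target lifts to the source, where non-conjugacy of
    reflections in different sides is detected by [on_side_uniq]. *)
Lemma sigma_inj : injective sigma.
Proof.
move=> e e' se; have [u [_ [su _ _]]] := corner_elements r2 sP omega e x20.
have [u' [_ [su' _ _]]] := corner_elements r2 sP omega e' x20.
have := sigmaP su'; rewrite -se => /(on_side_conj (sigmaP su))[k /f_onto[h hH <-]].
rewrite -fJ //; last exact: side_in su.
move=> /f_inj e_uu; have uu' : u' = u ^ h.
  by apply: e_uu; rewrite ?HJ // ?(side_in su) // (side_in su').
apply: (on_side_uniq _ su'); rewrite uu'.
exact: on_sideJ.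
Qed.

Lemma sigma_adjacent e :
  adjacent omega' (right_angled omega e) (sigma e) (sigma (e + 1)).
Proof.
have [u [v [su sv]]] := corner_elements r2 sP omega e x20.
case: ifP => _ h.
  have [uH vH] := (side_in su, side_in sv).
  apply: (commuting_pair_sides r_gt0 r2 y20 (sigmaP su) (sigmaP sv)).
    by rewrite -!fM // h.
  by apply/eqP => /sigma_inj; lia.
case: h => h4 h2; have [e1 [e1' [h h' adj]]] := acute_image su sv h4 h2.
by rewrite (on_side_uniq (sigmaP su) h) (on_side_uniq (sigmaP sv) h').
Qed.

(** The bijection of sides induced by an isomorphism preserves adjacency and
    angles, so it is a translation or a flip of the line. *)
Theorem rigidity : exists c : int,
  (forall e, right_angled omega' (c + e)%R = right_angled omega e) \/
  (forall e, right_angled omega' (c - e)%R = right_angled omega e).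
Proof.
have [|inc|dec] := int_line sigma_inj.
- by move=> e; have [[]|[]] := sigma_adjacent e; [left|right].
- exists (sigma 0); left => e; rewrite -inc.
  have [[_ //]|[]] := sigma_adjacent e.
  by rewrite (inc (e + 1)%R) (inc e); lia.
- exists (sigma 0 - 1)%R; right => e; rewrite (_ : (_ - e)%R = sigma (e + 1)); last first.
    by rewrite (dec (e + 1)%R); lia.
  have [[]|[_ //]] := sigma_adjacent e.
  by rewrite (dec (e + 1)%R) (dec e); lia.
Qed.
End Rigidity.

(** Corner 0 of a block of type false is right-angled, that of a block of type true
    is not. *)
Lemma bit_of_corner omega n : omega n = ~~ right_angled omega (5 * n).
Proof.
rewrite /right_angled mulrC -[n * 5]addr0 divzMDl // modzMDl div0z mod0z addr0.
by case: (omega n).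
Qed.

(** * Lorentzian geometry of the hyperbolic plane *)

Section Lorentz.
Variable R : realType.
Implicit Types u v w n p : 'rV[R]_3.

Lemma lorentzC u v : lorentz u v = lorentz v u.
Proof. by rewrite !lorentzE; ring. Qed.

Lemma lorentzDl a u v w : lorentz (a *: u + v) w = a * lorentz u w + lorentz v w.
Proof. by rewrite !lorentzE !mxE; ring. Qed.

Lemma lorentzZl a u w : lorentz (a *: u) w = a * lorentz u w.
Proof. by rewrite !lorentzE !mxE; ring. Qed.

Lemma lorentz0l w : lorentz 0 w = 0.
Proof. by rewrite !lorentzE !mxE; ring. Qed.

Lemma row3_ext u v : u 0 0 = v 0 0 -> u 0 1 = v 0 1 -> u 0 2 = v 0 2 -> u = v.
Proof. by move=> h0 h1 h2; apply/rowP; exact: ord3. Qed.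

Lemma vec0 (x y z : R) : vec x y z 0 0 = x. Proof. by rewrite mxE. Qed.
Lemma vec1 (x y z : R) : vec x y z 0 1 = y. Proof. by rewrite mxE. Qed.
Lemma vec2 (x y z : R) : vec x y z 0 2 = z. Proof. by rewrite mxE. Qed.
Definition vecs := (vec0, vec1, vec2).

(** The Lorentzian vector product: orthogonal to both arguments. *)
Definition cross u v : 'rV[R]_3 :=
  vec (- (u 0 1 * v 0 2 - u 0 2 * v 0 1))
      (u 0 2 * v 0 0 - u 0 0 * v 0 2) (u 0 0 * v 0 1 - u 0 1 * v 0 0).

Lemma cross_cross u v w t : lorentz (cross u v) (cross w t) =
  lorentz u t * lorentz v w - lorentz u w * lorentz v t.
Proof. by rewrite !lorentzE !vecs; ring. Qed.

Lemma crossl u v : lorentz (cross u v) u = 0.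
Proof. by rewrite !lorentzE !vecs; ring. Qed.

Lemma crossr u v : lorentz (cross u v) v = 0.
Proof. by rewrite !lorentzE !vecs; ring. Qed.

Definition triple u v w := lorentz (cross u v) w.

Lemma tripleC u v w : triple v w u = triple u v w.
Proof. by rewrite /triple !lorentzE !vecs; ring. Qed.

(** The determinant is, up to sign, that of the Gram matrix; its sign gives the
    Cauchy-Schwarz inequality used in [angle_pi4]. *)
Lemma triple_sq u v w : triple u v w ^+ 2 =
  - (lorentz u u * (lorentz v v * lorentz w w - lorentz v w ^+ 2)
     - lorentz u v * (lorentz u v * lorentz w w - lorentz u w * lorentz v w)
     + lorentz u w * (lorentz u v * lorentz v w - lorentz u w * lorentz v v)).
Proof. by rewrite /triple !lorentzE !vecs; ring. Qed.

Lemma dual_frame u v w x : triple u v w *: x =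
  lorentz (cross v w) x *: u + lorentz (cross w u) x *: v + lorentz (cross u v) x *: w.
Proof.
by apply: row3_ext; rewrite !mxE /triple !lorentzE !vecs; ring.
Qed.

Lemma cross_frame u v w x : triple u v w *: x =
  lorentz u x *: cross v w + lorentz v x *: cross w u + lorentz w x *: cross u v.
Proof.
have Z a y i : (a *: y : 'rV[R]_3) 0 i = a * y 0 i by rewrite mxE.
have D (y z : 'rV[R]_3) i : (y + z) 0 i = y 0 i + z 0 i by rewrite mxE.
by apply: row3_ext; rewrite !D !Z /triple !lorentzE !vecs; ring.
Qed.

Definition reflect_in n p := p - (2 * lorentz n p) *: n.

Lemma lorentz_reflect n u v : lorentz n n = 1 ->
  lorentz (reflect_in n u) (reflect_in n v) = lorentz u v.
Proof.
move=> nn; transitivity (lorentz u v + 4 * (lorentz n n - 1) * lorentz n u * lorentz n v).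
  rewrite /reflect_in !lorentzE !mxE; ring.
by rewrite nn; ring.
Qed.

Lemma reflectK n : lorentz n n = 1 -> involutive (reflect_in n).
Proof.
move=> nn p; transitivity (p + (4 * (lorentz n n - 1) * lorentz n p) *: n).
  by apply: row3_ext; rewrite /reflect_in !lorentzE !mxE; ring.
by rewrite nn subrr mulr0 mul0r scale0r addr0.
Qed.

Lemma reflect_lin n a u v : reflect_in n (a *: u + v) = a *: reflect_in n u + reflect_in n v.
Proof. by apply: row3_ext; rewrite /reflect_in !lorentzE !mxE; ring. Qed.

(** Two unit timelike vectors with a negative product are on the same sheet of the
    hyperboloid, by the Cauchy-Schwarz inequality for the spatial parts. *)
Lemma same_sheet (x y : 'rV[R]_3) : lorentz x x = -1 -> lorentz y y = -1 ->
  0 < y 0 0 -> lorentz x y < 0 -> 0 < x 0 0.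
Proof.
rewrite !lorentzE; set a := x 0 0; set b := x 0 1; set c := x 0 2.
set d := y 0 0; set e := y 0 1; set f := y 0 2 => xx yy d0 xy.
rewrite ltNge; apply/negP => a0.
have h1 : b * e + c * f < a * d by lra.
have h2 : a * d <= 0 by nra.
have h3 : (a * d) ^+ 2 < (b * e + c * f) ^+ 2.
  by rewrite -[X in X < _]sqrrN -[X in _ < X]sqrrN ltr_pXn2r // ?nnegrE; lra.
have h4 : (b * e + c * f) ^+ 2 <= (b ^+ 2 + c ^+ 2) * (e ^+ 2 + f ^+ 2).
  by have := sqr_ge0 (b * f - c * e); lra.
have h5 : (a * d) ^+ 2 = (1 + b ^+ 2 + c ^+ 2) * (1 + e ^+ 2 + f ^+ 2).
  by rewrite exprMn; congr (_ * _); lra.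
have := sqr_ge0 b; have := sqr_ge0 c; have := sqr_ge0 e; have := sqr_ge0 f.
lra.
Qed.

Lemma reflect_hyperboloid n p : lorentz n n = 1 -> hyperboloid p ->
  hyperboloid (reflect_in n p).
Proof.
move=> nn [pp p0]; split; first by rewrite lorentz_reflect.
apply: (same_sheet _ pp p0); first by rewrite lorentz_reflect.
rewrite (_ : lorentz _ p = lorentz p p - 2 * lorentz n p ^+ 2); last first.
  by rewrite /reflect_in !lorentzE !mxE; ring.
by rewrite pp; have := sqr_ge0 (lorentz n p); lra.
Qed.

Lemma H2P (p : H2 R) : hyperboloid (set_val p). Proof. exact: set_valP. Qed.
Lemma H2norm (p : H2 R) : lorentz (set_val p) (set_val p) = -1. Proof. by have [] := H2P p. Qed.

Definition reflect_H2 n (nn : lorentz n n = 1) (p : H2 R) : H2 R :=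
  mk_point (reflect_hyperboloid nn (H2P p)).

Lemma reflect_H2E n (nn : lorentz n n = 1) (p : H2 R) :
  set_val (reflect_H2 nn p) = reflect_in n (set_val p).
Proof. by []. Qed.

Lemma H2_ext (p q : H2 R) : set_val p = set_val q -> p = q.
Proof. exact: val_inj. Qed.

Lemma reflect_isometry n (nn : lorentz n n = 1) : isometries (reflect_H2 nn).
Proof.
split; last by move=> p q; rewrite /hdist !reflect_H2E lorentz_reflect.
have K : involutive (reflect_H2 nn) by move=> p; apply: H2_ext; rewrite !reflect_H2E reflectK.
by exists (reflect_H2 nn).
Qed.

Lemma cos_pi4 : cos (pi / 4 : R) = Num.sqrt 2 / 2.
Proof.
have cp : 0 < cos (pi / 4 : R) by apply: cos_gt0_pihalf; have := @pi_gt0 R; lra.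
have c4 : cos (pi / 4 : R) ^+ 2 = 1 / 2.
  have := cos_mulr2n (pi / 4 : R).
  rewrite (_ : pi / 4 *+ 2 = pi / 2) ?cos_pihalf; last by field.
  by lra.
apply/eqP; rewrite -(@eqrXn2 _ 2) ?(ltW cp) ?divr_ge0 ?sqrtr_ge0 //.
by rewrite c4 expr_div_n sqr_sqrtr; [apply/eqP; field|lra].
Qed.

(** The hyperbolic law of cosines. The denominator of the quotient in [angle]
    cannot vanish: the quotient would be 0, and the angle pi/2. Its absolute value
    is at most 1, so the arc cosine can be inverted. *)
Lemma angle_pi4 (p q r : H2 R) : angle p q r = pi / 4 ->
  let x := lorentz (set_val p) (set_val q) in
  let y := lorentz (set_val p) (set_val r) in
  let z := lorentz (set_val q) (set_val r) in
  [/\ 0 < x ^+ 2 - 1, 0 < y ^+ 2 - 1 &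
      z + x * y = Num.sqrt 2 / 2 * (Num.sqrt (x ^+ 2 - 1) * Num.sqrt (y ^+ 2 - 1))].
Proof.
move=> A x y z.
have dir (u v : H2 R) : lorentz (direction p u) (direction p v) =
    lorentz (set_val u) (set_val v) + lorentz (set_val p) (set_val u) * lorentz (set_val p) (set_val v).
  rewrite /direction; transitivity (lorentz (set_val u) (set_val v) +
    lorentz (set_val p) (set_val u) * lorentz (set_val p) (set_val v) *
    (2 + lorentz (set_val p) (set_val p))).
    by rewrite !lorentzE !mxE; ring.
  by rewrite H2norm; ring.
move: A; rewrite /angle /= !dir !H2norm -/x -/y -/z -!expr2.
rewrite [-1 + _]addrC [-1 + y ^+ 2]addrC.
set a := Num.sqrt (x ^+ 2 - 1); set b := Num.sqrt (y ^+ 2 - 1) => A.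
have ab : a * b != 0.
  apply/eqP => ab0; move: A; rewrite ab0 invr0 mulr0 acos0.
  by have := @pi_gt0 R; lra.
move: ab; rewrite mulf_eq0 negb_or => /andP[]; rewrite !sqrtr_eq0 -!ltNge => x0 y0.
split=> //.
have a0 : 0 < a by rewrite sqrtr_gt0.
have b0 : 0 < b by rewrite sqrtr_gt0.
have a2 : a ^+ 2 = x ^+ 2 - 1 by rewrite sqr_sqrtr // ltW.
have b2 : b ^+ 2 = y ^+ 2 - 1 by rewrite sqr_sqrtr // ltW.
have bound : (z + x * y) ^+ 2 <= (a * b) ^+ 2.
  rewrite exprMn a2 b2.
  have := triple_sq (set_val p) (set_val q) (set_val r); rewrite !H2norm -/x -/y -/z.
  by have := sqr_ge0 (triple (set_val p) (set_val q) (set_val r)) => h e; move: h; rewrite e; lra.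
have abs : `|z + x * y| <= a * b.
  by rewrite -(@ler_pXn2r _ 2) ?nnegrE ?normr_ge0 ?(mulr_ge0 (ltW a0) (ltW b0)) // real_normK ?num_real.
have ab0 : 0 < a * b by rewrite mulr_gt0.
have := congr1 cos A; rewrite acosK ?cos_pi4; last first.
  rewrite in_itv /= -ler_norml normrM normfV (gtr0_norm ab0) ler_pdivrMr // mul1r.
  exact: abs.
by move=> <-; rewrite divfK // gt_eqF.
Qed.
End Lorentz.

Local Open Scope classical_set_scope.
Local Open Scope ring_scope.
(** * The reflection group of the triangle *)

Lemma ord3_cycle (i : 'I_3) : [/\ i + 1 + 1 = i + 2, i + 1 + 2 = i, i + 2 + 1 = i & i + 2 + 2 = i + 1].
Proof. by move: i; apply: ord3; split; exact: val_inj. Qed.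

Lemma ord3_neq (i j : 'I_3) : i != j -> j = i + 1 \/ i = j + 1.
Proof.
move: i; apply: ord3; move: j; apply: ord3 => // _;
  by [left; exact: val_inj | right; exact: val_inj].
Qed.

Section Triangle.
Variable R : realType.
Variables (T : 'I_3 -> H2 R) (hT : is_T4 T).
Let V i := set_val (T i).
Let sqrt2 : R := Num.sqrt 2.

Lemma sqrt2_gt0 : 0 < sqrt2. Proof. by rewrite sqrtr_gt0; lra. Qed.
Lemma sqrt2_sq : sqrt2 * sqrt2 = 2. Proof. by rewrite -expr2 sqr_sqrtr; lra. Qed.

(** The cyclic order makes the three normals point all inwards or all outwards,
    whence the sign in [normal_next]. *)
Definition side_vec i := cross (V (i + 1)) (V (i + 2)).
Definition side_len i := Num.sqrt (lorentz (side_vec i) (side_vec i)).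
Definition normal i := (side_len i)^-1 *: side_vec i.

Lemma side_vec_sq i : lorentz (side_vec i) (side_vec i) = lorentz (V (i + 1)) (V (i + 2)) ^+ 2 - 1.
Proof. by rewrite cross_cross [lorentz (V (i + 2)) _]lorentzC /V !H2norm; ring. Qed.

Lemma angleP i : [/\ 0 < lorentz (V i) (V (i + 1)) ^+ 2 - 1, 0 < lorentz (V i) (V (i + 2)) ^+ 2 - 1 &
   lorentz (V (i + 1)) (V (i + 2)) + lorentz (V i) (V (i + 1)) * lorentz (V i) (V (i + 2)) =
   sqrt2 / 2 * (Num.sqrt (lorentz (V i) (V (i + 1)) ^+ 2 - 1) *
      Num.sqrt (lorentz (V i) (V (i + 2)) ^+ 2 - 1))].
Proof. by have [_ ang] := hT; exact: angle_pi4 (ang i). Qed.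

Lemma side_vec_gt0 i : 0 < lorentz (side_vec i) (side_vec i).
Proof.
rewrite side_vec_sq; have [_ + _] := angleP (i + 1 + 1); have [e1 e2 e3 e4] := ord3_cycle i.
by rewrite e1 e4 lorentzC.
Qed.

Lemma side_len_gt0 i : 0 < side_len i.
Proof. by rewrite sqrtr_gt0 side_vec_gt0. Qed.

Lemma normal_unit i : lorentz (normal i) (normal i) = 1.
Proof.
rewrite /normal lorentzZl lorentzC lorentzZl mulrA -expr2 exprVn sqr_sqrtr ?ltW ?side_vec_gt0 //.
by rewrite mulVf // gt_eqF // side_vec_gt0.
Qed.

(** The product of the normals of two sides is minus the cosine of the angle
    between them. *)
Lemma normal_next i : lorentz (normal (i + 1)) (normal (i + 2)) = - (sqrt2 / 2).
Proof.
have [e1 e2 e3 e4] := ord3_cycle i.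
have [_ _ A] := angleP i.
have L1 : side_len (i + 1) = Num.sqrt (lorentz (V i) (V (i + 2)) ^+ 2 - 1).
  by rewrite /side_len side_vec_sq e1 e2 lorentzC.
have L2 : side_len (i + 2) = Num.sqrt (lorentz (V i) (V (i + 1)) ^+ 2 - 1).
  by rewrite /side_len side_vec_sq e3 e4.
rewrite /normal lorentzZl lorentzC lorentzZl /side_vec e1 e2 e3 e4 cross_cross.
rewrite [lorentz (V i) (V i)](_ : _ = -1); last by rewrite /V H2norm.
rewrite [lorentz (V (i + 1)) (V i)]lorentzC.
have l1 := side_len_gt0 (i + 1); have l2 := side_len_gt0 (i + 2).
rewrite -L1 -L2 in A.
transitivity (- ((lorentz (V (i + 1)) (V (i + 2)) + lorentz (V i) (V (i + 1)) * lorentz (V i) (V (i + 2)))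
   / (side_len (i + 1) * side_len (i + 2)))).
  by field; rewrite !gt_eqF.
by rewrite A; field; rewrite !gt_eqF.
Qed.

Lemma normal_neq i j : i != j -> lorentz (normal i) (normal j) = - (sqrt2 / 2).
Proof.
have [e1 e2 e3 e4] := ord3_cycle i; have [e1' e2' e3' e4'] := ord3_cycle j.
case/ord3_neq => ->.
  by have := normal_next (i + 2); rewrite e3 e4.
by rewrite lorentzC; have := normal_next (j + 2); rewrite e3' e4'.
Qed.

Lemma normal_cox i j : 2 * lorentz (normal i) (normal j) = cox sqrt2 i j.
Proof.
rewrite /cox; case: eqVneq => [<-|ij]; first by rewrite normal_unit mulr1.
by rewrite normal_neq //; field.
Qed.

(** It is non-zero because the vertices are not on a line, so a vector is determined
    by its products with them. *)
Let D := triple (V 0) (V 1) (V 2).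

Lemma triple_rot i : triple (V (i + 1)) (V (i + 2)) (V i) = D.
Proof.
move: i; apply: ord3.
- by rewrite !add0r tripleC.
- rewrite (_ : 1 + 1 = 2); last exact: val_inj.
  rewrite (_ : 1 + 2 = 0); last exact: val_inj.
  by rewrite /D tripleC -tripleC -[RHS]tripleC -[RHS]tripleC.
- rewrite (_ : 2 + 1 = 0); last exact: val_inj.
  by rewrite (_ : 2 + 2 = 1); last exact: val_inj.
Qed.

Lemma normal_vertex i j : j != i -> lorentz (normal i) (V j) = 0.
Proof.
move=> ji; rewrite lorentzZl; have [e1 e2 e3 e4] := ord3_cycle i.
have [->|ie] := ord3_neq ji.
  have [e1' e2' e3' e4'] := ord3_cycle j.
  by rewrite /side_vec e1' e2' crossr mulr0.
by rewrite /side_vec ie crossl mulr0.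
Qed.

Lemma normal_vertex_self i : lorentz (normal i) (V i) = D / side_len i.
Proof. by rewrite lorentzZl -[lorentz _ _]/(triple _ _ _) triple_rot mulrC. Qed.

Lemma D_neq0 : D != 0.
Proof.
have [nd _] := hT; apply/eqP => D0; apply: nd; exists (normal 0) => i.
split; first exact: normal_unit.
have [->|i0] := eqVneq i 0; last exact: normal_vertex.
by have := normal_vertex_self 0; rewrite D0 mul0r.
Qed.

Lemma vertex_ext (u v : 'rV[R]_3) : (forall i, lorentz (V i) u = lorentz (V i) v) -> u = v.
Proof.
move=> h; have := cross_frame (V 0) (V 1) (V 2) u; have := cross_frame (V 0) (V 1) (V 2) v.
by rewrite !h => <- /(scalerI D_neq0).
Qed.

(** Sending the simple roots to the unit normals intertwines the geometric
    representation and the reflections in the sides. *)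
Definition from_roots (a : 'rV[R]_3) : 'rV[R]_3 := \sum_j a 0 j *: normal j.

Lemma from_roots_lin c a b : from_roots (c *: a + b) = c *: from_roots a + from_roots b.
Proof.
rewrite /from_roots scaler_sumr -big_split; apply: eq_bigr => j _.
rewrite /= mxE [(c *: a) 0 j]mxE scalerDl. by rewrite -scalerA.
Qed.

Lemma from_roots_root i : from_roots (root R i) = normal i.
Proof.
rewrite /from_roots (bigD1 i) //= big1 => [|j ji]; rewrite mxE eqxx ?eqxx ?scale1r ?addr0 //=.
by rewrite (negPf ji) scale0r.
Qed.

Lemma lorentz_from_roots a v : lorentz v (from_roots a) = \sum_j a 0 j * lorentz v (normal j).
Proof.
rewrite /from_roots; elim/big_rec2: _ => [|j x y _ <-]; first by rewrite lorentzC lorentz0l.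
by rewrite lorentzC lorentzDl !(lorentzC v).
Qed.

Lemma from_roots_rrefl i a :
  from_roots (rrefl sqrt2 i a) = reflect_in (normal i) (from_roots a).
Proof.
rewrite /rrefl addrC -scaleNr from_roots_lin from_roots_root scaleNr addrC; congr (_ - _ *: _).
rewrite lorentz_from_roots mulr_sumr /coroot; apply: eq_bigr => j _.
by rewrite -normal_cox; ring.
Qed.

Lemma from_roots_act w a :
  from_roots (act (rrefl sqrt2) w a) = act (fun i => reflect_in (normal i)) w (from_roots a).
Proof. by elim: w => //= i w <-; rewrite from_roots_rrefl. Qed.

Lemma lorentz_vertex_from_roots i a : lorentz (V i) (from_roots a) = a 0 i * (D / side_len i).
Proof.
rewrite lorentz_from_roots (bigD1 i) //= big1 ?addr0 => [|j ji].
  by rewrite lorentzC normal_vertex_self.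
by rewrite lorentzC normal_vertex ?mulr0 // eq_sym.
Qed.

Lemma from_roots_inj : injective from_roots.
Proof.
move=> a b ab; apply/rowP => i; have := lorentz_vertex_from_roots i a.
rewrite ab lorentz_vertex_from_roots => /mulIf ->//.
by rewrite mulf_neq0 ?D_neq0 // invr_eq0 gt_eqF // side_len_gt0.
Qed.

Lemma from_roots_onto v : exists a, from_roots a = v.
Proof.
exists (\row_i (lorentz (V i) v / (D / side_len i))); apply: vertex_ext => i.
rewrite lorentz_vertex_from_roots mxE divfK //.
by rewrite mulf_neq0 ?D_neq0 // invr_eq0 gt_eqF // side_len_gt0.
Qed.

Lemma reflect_action : coxeter_action (fun i => reflect_in (normal i)).
Proof.
have [rK r4] := rrefl_action sqrt2_sq.
split=> [i v|i j v]; have [a <-] := from_roots_onto v.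
  by rewrite -!from_roots_rrefl rK.
by rewrite -[in RHS](r4 i j a) /= !from_roots_rrefl.
Qed.

Definition mirror i : Defs.isometry R := mk_isom (reflect_isometry (normal_unit i)).

Lemma mirror_side i : side_reflections T (mirror i).
Proof.
exists i, (normal i); split=> // j ji; split; first exact: normal_unit.
exact: normal_vertex.
Qed.

(** A unit vector orthogonal to two vertices is, up to sign, the normal of the
    side, and a vector and its opposite define the same reflection. *)
Lemma side_mirror (g : Defs.isometry R) : side_reflections T g -> exists i, g = mirror i.
Proof.
move=> [i [n [on_n refl]]]; exists i; apply: isom_ext => p; apply: H2_ext.
rewrite refl /= reflect_H2E /reflect_in.
have i1 : i + 1 != i by move: i {on_n refl}; apply: ord3.
have [n1 _] := on_n _ i1.
have e : n = (lorentz n (V i) / (D / side_len i)) *: normal i.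
  apply: vertex_ext => j; rewrite [RHS]lorentzC lorentzZl [LHS]lorentzC.
  have [->|ji] := eqVneq j i.
    rewrite normal_vertex_self divfK //.
    by rewrite mulf_neq0 ?D_neq0 // invr_eq0 gt_eqF // side_len_gt0.
  by rewrite normal_vertex // mulr0; have [] := on_n _ ji.
move: n1; rewrite e; set t := _ / _; rewrite lorentzZl lorentzC lorentzZl normal_unit mulr1 => t2.
rewrite lorentzZl scalerA; congr (_ - _ *: _).
by rewrite -[RHS]mulr1 -t2; ring.
Qed.

Lemma mirror_generated i : generated (side_reflections T) (mirror i).
Proof. by move=> H [_ sub]; apply: sub; exact: mirror_side. Qed.

Definition gen i : reflection_group T := exist _ (mirror i) (mem_set (mirror_generated i)).

Definition on_H2 (g : reflection_group T) : H2 R -> H2 R := isom_fun (val g).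

Lemma on_H2M g h p : on_H2 (g * h)%g p = on_H2 g (on_H2 h p).
Proof. by []. Qed.

Lemma on_H2_ext g h : (forall p, set_val (on_H2 g p) = set_val (on_H2 h p)) -> g = h.
Proof. by move=> e; apply: val_inj; apply: isom_ext => p; apply: H2_ext; exact: e. Qed.

Lemma on_H2_gen i p : set_val (on_H2 (gen i) p) = reflect_in (normal i) (set_val p).
Proof. by []. Qed.

Lemma on_H2_ev w p : set_val (on_H2 (evalw gen w) p) =
  act (fun i => reflect_in (normal i)) w (set_val p).
Proof. by elim: w => //= i w IH; rewrite on_H2M on_H2_gen IH. Qed.

Lemma act_reflect_lin w c u v : act (fun i => reflect_in (normal i)) w (c *: u + v) =
  c *: act (fun i => reflect_in (normal i)) w u + act (fun i => reflect_in (normal i)) w v.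
Proof. by elim: w => //= i w ->; rewrite reflect_lin. Qed.

(** A product of reflections that is trivial on the hyperbolic plane fixes the
    vertices, which span the Lorentzian space; so it fixes the normals, and
    [geometric_faithful] applies to their preimages. *)
Lemma gen_generators : coxeter_generators gen.
Proof.
have [mK m4] := reflect_action.
split.
- move=> i; apply: on_H2_ext => p; rewrite on_H2M !on_H2_gen mK; by [].
- move=> i j; apply: on_H2_ext => p.
  by rewrite !expgS expg0 mulg1 !on_H2M !on_H2_gen; exact: m4.
- move=> g.
  pose H : set (Defs.isometry R) := [set x | exists w, x = val (evalw gen w)].
  have gp : generated (side_reflections T) (val g) by apply: set_mem; exact: (valP g).
  have evM w w' : evalw gen (w ++ w') = (evalw gen w * evalw gen w')%g.
    by elim: w => [|i w IH] /=; rewrite ?mul1g // IH mulgA.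
  have [w gw] : H (val g); last by exists w; exact: val_inj.
  apply: gp; split; last first.
    by move=> x /side_mirror[i ->]; exists [:: i]; rewrite /= mulg1.
  split; first by apply/mem_set; exists [::].
  move=> x y /set_mem[w ->] /set_mem[w' ->]; apply/mem_set; exists (w ++ rev w').
  rewrite evM; congr (_ * _)%g.
  have -> : evalw gen (rev w') = (evalw gen w')^-1%g; last by [].
  apply/esym/mulg1_eq; rewrite -evM; apply: on_H2_ext => p; rewrite on_H2_ev.
  by rewrite -[rev w']cats0 (@weq_revr w' [::] _ _ reflect_action).
- move=> w w1; apply: (geometric_faithful sqrt2_gt0 sqrt2_sq) => i; apply: from_roots_inj.
  rewrite from_roots_act from_roots_root.
  have fixV j : act (fun i => reflect_in (normal i)) w (V j) = V j.
    by rewrite -on_H2_ev w1.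
  have fix0 : act (fun i => reflect_in (normal i)) w 0 = 0.
    by have := act_reflect_lin w (-1) 0 0; rewrite scaler0 addr0 scaleN1r addNr.
  apply: (scalerI D_neq0); rewrite -[LHS]addr0 -fix0 -act_reflect_lin addr0.
  rewrite (dual_frame (V 0) (V 1) (V 2) (normal i)).
  by rewrite -[_ *: V 2]addr0 -addrA !act_reflect_lin fix0 !fixV.
Qed.
End Triangle.

(** * Binary digits of a uniform variable *)

Section Digits.
Variable R : realType.

Definition unif : probability (measurableTypeR R) R :=
  uniform_prob (@ltr01 R).

Lemma unif_lebesgue (A : set (measurableTypeR R)) : measurable A ->
  (forall x, A x -> 0 <= x <= 1) -> unif A = lebesgue_measure A.
Proof.
move=> mA A01; rewrite /unif /= /uniform_prob (eq_integral (fun=> 1%E)).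
  by rewrite integral_cst // mul1e.
move=> x; rewrite inE => /A01; rewrite /uniform_pdf => ->.
by rewrite subr0 invr1.
Qed.

(** The index of the dyadic interval of length 2^-n that contains x, when x is not
    negative. *)
Definition level (n : nat) (x : R) : nat := Num.truncn (2 ^+ n * x).
Definition dyadic (n k : nat) : set R := `[k%:R / 2 ^+ n, k.+1%:R / 2 ^+ n[.

Lemma pow2_gt0 n : 0 < 2 ^+ n :> R. Proof. by rewrite exprn_gt0. Qed.

Lemma dyadicP n k x : dyadic n k x <-> 0 <= x /\ level n x = k.
Proof.
rewrite /dyadic /= in_itv /= ler_pdivrMr ?pow2_gt0 // ltr_pdivlMr ?pow2_gt0 //.
rewrite mulrC; split=> [h|[x0 <-]].
  have h0 : 0 <= 2 ^+ n * x by case/andP: h => h _; apply: le_trans h.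
  split; first by move: h0; rewrite pmulr_rge0 ?pow2_gt0.
  exact: truncn_def.
by apply: truncn_itv; rewrite mulr_ge0 // ltW ?pow2_gt0.
Qed.

Lemma unif_dyadic n k : (k < 2 ^ n)%N -> unif (dyadic n k) = (2 ^- n)%:E.
Proof.
move=> kn; have p0 := pow2_gt0 n.
rewrite unif_lebesgue; [|exact: measurable_itv|].
  rewrite lebesgue_measure_itv /= lte_fin ltr_pM2r ?invr_gt0 // ltr_nat ltnSn.
  by rewrite -EFinD -mulrBl -natrB // subSnn mul1r.
move=> x; rewrite /dyadic /= in_itv /= => /andP[h1 h2]; apply/andP; split.
  by apply: le_trans h1; rewrite divr_ge0 // ltW.
apply: ltW; apply: (lt_le_trans h2); rewrite ler_pdivrMr // mul1r.
by rewrite -natrX ler_nat.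
Qed.

Lemma trivIset_dyadic n : trivIset setT (fun k : 'I_(2 ^ n) => dyadic n k).
Proof.
move=> i j _ _ [x [/dyadicP[_ xi] /dyadicP[_ xj]]].
by apply: val_inj; rewrite /= -xi xj.
Qed.

Lemma measurable_dyadic n k : measurable (dyadic n k : set (measurableTypeR R)).
Proof. exact: measurable_itv. Qed.

(** An event that depends on the first n binary digits has the probability given
    by counting dyadic intervals. *)
Lemma unif_level n (Q : pred nat) (A : set (measurableTypeR R)) :
  measurable A -> (forall x, 0 <= x -> A x <-> Q (level n x)) ->
  unif A = ((\sum_(k < 2 ^ n) Q k)%:R / 2 ^+ n)%:E.
Proof.
move=> mA AQ; pose F (k : 'I_(2 ^ n)) := dyadic n k : set (measurableTypeR R).
pose U := \big[setU/set0]_(k < 2 ^ n) F k.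
have mF k : measurable (F k) by exact: measurable_dyadic.
have mU : measurable U by apply: bigsetU_measurable => k _; exact: mF.
have sumF (P : pred 'I_(2 ^ n)) : unif (\big[setU/set0]_(k < 2 ^ n | P k) F k) =
    ((\sum_(k < 2 ^ n) P k)%:R / 2 ^+ n)%:E.
  rewrite (@measure_bigsetU_ord _ _ _ unif _ P F mF); last exact: trivIset_dyadic.
  rewrite (eq_bigr (fun=> (2 ^- n)%:E)); last first.
    by move=> k _; exact: unif_dyadic (ltn_ord k).
  rewrite sumEFin; congr EFin; rewrite big_mkcond natr_sum mulr_suml.
  by apply: eq_bigr => k _; case: (P k); rewrite ?mul1r ?mul0r.
have U1 : unif U = 1%E.
  by rewrite /U (sumF predT) sum1_card card_ord natrX divff // expf_neq0.
have UC0 : unif (~` U) = 0%E by rewrite probability_setC // U1 subee.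
rewrite -(sumF Q) -[A in LHS](setUIDK A U).
have mAU : measurable (A `\` U) by exact: measurableD.
have AU0 : unif (A `\` U) = 0%E.
  by apply: (subset_measure0 mAU (measurableC mU)) UC0 => x [].
have -> : unif (A `&` U `|` A `\` U) = unif (A `&` U).
  by apply: measureU0 => //; exact: measurableI.
congr (unif _); rewrite /U setIC.
rewrite [RHS]big_mkcond; rewrite big_distrl /=; apply: eq_bigr => k _.
apply/seteqP; split=> x.
  by move=> [/dyadicP[x0 xk] Ax]; rewrite -xk (AQ x x0).1 //; apply/dyadicP.
case: ifP => // Qk /dyadicP[x0 xk]; split; first by apply/dyadicP.
by apply/(AQ x x0); rewrite xk.
Qed.

Lemma level_half n x : 0 <= x -> level n x = (level n.+1 x)./2.
Proof.
move=> x0; apply: truncn_def; set y := 2 ^+ n * x.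
have y0 : 0 <= y by rewrite mulr_ge0 // ltW ?pow2_gt0.
have e : 2 ^+ n.+1 * x = 2 * y by rewrite exprS /y; ring.
have := @truncn_itv _ (2 ^+ n.+1 * x); rewrite -/(level n.+1 x) e.
set m := level n.+1 x => /(_ _)/andP[]; first by rewrite mulr_ge0.
have := odd_double_half m; set b : bool := odd m; move=> mE.
have [h1 h2] : (m = b + 2 * m./2)%N /\ True by rewrite mul2n mE.
rewrite {1 2}h1 -!natr1 natrD natrM => hA hB.
by apply/andP; split; case: (b) hA hB => /= hA hB; lra.
Qed.

Definition digit (n : nat) (x : R) : bool := odd (level n.+1 x).

Definition fits (o : option bool) (b : bool) := if o is Some c then b == c else true.

(** The number k, read in binary with n digits, has the digits prescribed by f:
    [Some] is a prescription, and the digit of index m is the one of weight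
    2^-(m+1). *)
Fixpoint pattern (f : nat -> option bool) (n k : nat) : bool :=
  if n is m.+1 then pattern f m k./2 && fits (f m) (odd k) else true.

Lemma patternP f n x : 0 <= x ->
  pattern f n (level n x) <-> forall m, (m < n)%N -> fits (f m) (digit m x).
Proof.
move=> x0; elim: n => [|n IH] /=; first by [].
rewrite -level_half //; split.
  move=> /andP[/IH h fn] m; rewrite ltnS leq_eqVlt => /orP[/eqP->//|]; exact: h.
move=> h; apply/andP; split; last exact: h.
by apply/IH => m mn; apply: h; rewrite ltnS ltnW.
Qed.

Lemma sum_pairs (F : nat -> nat) n :
  (\sum_(k < n.*2) F k = \sum_(k < n) (F k.*2 + F k.*2.+1))%N.
Proof.
elim: n => [|n IH]; first by rewrite !big_ord0.
by rewrite doubleS !big_ord_recr /= IH addnA.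
Qed.

Lemma pattern_count f n : (\sum_(k < 2 ^ n) pattern f n k)%:R / 2 ^+ n =
  \prod_(m < n) (if f m is Some _ then 2^-1 else 1) :> R.
Proof.
elim: n => [|n IH]; first by rewrite big_ord0 /= sum1_card card_ord expr0 divr1.
rewrite big_ord_recr -IH.
have -> : (\sum_(k < 2 ^ n.+1) pattern f n.+1 k = \sum_(k < (2 ^ n).*2) pattern f n.+1 k)%N.
  by rewrite -mul2n -expnS.
rewrite (sum_pairs (fun k => nat_of_bool (pattern f n.+1 k))) exprS.
have -> : (\sum_(k < 2 ^ n) (pattern f n.+1 k.*2 + pattern f n.+1 k.*2.+1) =
  (\sum_(k < 2 ^ n) pattern f n k) * (if f n is Some _ then 1 else 2))%N.
  rewrite big_distrl /=; apply: eq_bigr => k _.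
  rewrite /= doubleK uphalf_double odd_double /=.
  by case: (pattern f n k); case: (f n) => [[]|].
have p0 : (2 ^+ n : R) != 0 by rewrite gt_eqF // pow2_gt0.
by rewrite natrM; case: (f n) => [_|] /=; field.
Qed.

Lemma measurable_level n k : measurable [set x : measurableTypeR R | level n x = k].
Proof.
have -> : [set x | level n x = k] =
    (if k == 0%N then `]-oo, 0[%classic else set0) `|` dyadic n k.
  apply/seteqP; split=> x /=.
    case: (leP 0 x) => x0 xk; first by right; apply/dyadicP.
    left; rewrite -xk /level (_ : Num.truncn _ = 0%N) /=; first by rewrite in_itv.
    by apply/truncn0Pn; rewrite -ltNge (lt_trans _ ltr01) // pmulr_rlt0 // pow2_gt0.
  case; last by case/dyadicP.
  case: eqP => // -> /=; rewrite in_itv /= => x0.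
  by apply/truncn0Pn; rewrite -ltNge (lt_trans _ ltr01) // pmulr_rlt0 // pow2_gt0.
apply: measurableU; last exact: measurable_dyadic.
by case: ifP => _; [exact: measurable_itv|exact: measurable0].
Qed.

Lemma measurable_digit n b : measurable [set x : measurableTypeR R | digit n x = b].
Proof.
have -> : [set x | digit n x = b] = \bigcup_(k in [set k | odd k = b]) [set x | level n.+1 x = k].
  by apply/seteqP; split=> x /=; [move=> h; exists (level n.+1 x)|move=> [k /= <- <-]].
by apply: bigcup_measurable => k _; exact: measurable_level.
Qed.

(** Binary digits of a uniform variable are independent fair coins. *)
Lemma unif_pattern f n (A : set (measurableTypeR R)) : measurable A ->
  (forall x, 0 <= x -> A x <-> forall m, (m < n)%N -> fits (f m) (digit m x)) ->
  unif A = (\prod_(m < n) (if f m is Some _ then 2^-1 else 1))%:E.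
Proof.
move=> mA AP; rewrite (@unif_level n (pattern f n)) ?pattern_count // => x x0.
by rewrite AP // -patternP.
Qed.
End Digits.

(** * Fair coins on the integers and their ergodicity *)

Definition cyl (s : seq int) (w : int -> bool) : set (int -> bool) :=
  [set o | forall i, i \in s -> o i = w i].

Definition cyls : set (set (int -> bool)) :=
  [set A | A = set0 \/ exists s w, A = cyl s w].

(** Cylinders generate the product sigma-algebra on sequences of coins. *)
Notation Omega := (g_sigma_algebraType cyls).

Lemma cyls_setI : setI_closed cyls.
Proof.
move=> A B [->|[s [w ->]]]; first by left; rewrite set0I.
case=> [->|[s' [w' ->]]]; first by left; rewrite setI0.
have [e|/set0P[w0 [oS oS2]]] := eqVneq (cyl s w `&` cyl s' w') set0; first by left.
right; exists (s ++ s'), w0; apply/seteqP; split=> o'.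
  move=> [h1 h2] i; rewrite mem_cat => /orP[hi|hi].
    by rewrite h1 // oS.
  by rewrite h2 // oS2.
move=> h; split=> i hi.
  by rewrite h ?mem_cat ?hi // oS.
by rewrite h ?mem_cat ?hi ?orbT // oS2.
Qed.

Lemma measurable_cyl s w : measurable (cyl s w : set Omega).
Proof. by apply: sub_sigma_algebra; right; exists s, w. Qed.

Lemma cyl_nil w : cyl [::] w = setT.
Proof. by apply/seteqP; split. Qed.

Lemma cyl_unique (R : realType) (m1 m2 : {measure set Omega -> \bar R}) :
  (m1 setT < +oo)%E -> (forall s w, m1 (cyl s w) = m2 (cyl s w)) ->
  forall A, measurable A -> m1 A = m2 A.
Proof.
move=> fin e A mA.
apply: (@g_sigma_algebra_measure_unique _ _ Omega cyls _ (fun=> setT)) => //.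
- by move=> B cB; apply: sub_sigma_algebra.
- by move=> _; right; exists [::], (fun=> false); rewrite cyl_nil.
- by rewrite bigcup_const.
- exact: cyls_setI.
- by move=> B [->|[s [w ->]]]; rewrite ?measure0.
Qed.

Lemma measurable_to_Omega d (T : measurableType d) (f : T -> Omega) :
  (forall i b, measurable [set x | f x i = b]) -> measurable_fun setT f.
Proof.
move=> mf; apply: (@measurability _ _ T Omega setT f cyls) => //.
move=> _ [A [->|[s [w ->]]] <-]; rewrite setTI; first by rewrite preimage_set0.
rewrite [X in measurable X](_ : _ = \bigcap_(i in [set` s]) [set x | f x i = w i]).
  by apply: fin_bigcap_measurable => // i _; exact: mf.
by apply/seteqP; split=> x /= h i; exact: h.
Qed.

Definition shift (n : int) (o : Omega) : Omega := fun i => o (i + n).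

Lemma shift_cyl n s w : shift n @^-1` cyl s w =
  cyl [seq i + n | i <- s] (fun i => w (i - n)).
Proof.
apply/seteqP; split=> o /= h.
  by move=> _ /mapP[i si ->]; rewrite addrK -h.
by move=> i si; rewrite /shift (h (i + n)) ?addrK //; apply: (map_f (fun i => i + n)).
Qed.

Lemma measurable_coord i b : measurable [set o : Omega | o i = b].
Proof.
rewrite (_ : [set o | o i = b] = cyl [:: i] (fun=> b)); first exact: measurable_cyl.
apply/seteqP; split=> o /= h; last by apply: h; rewrite inE.
by move=> j; rewrite inE => /eqP ->.
Qed.

Lemma measurable_shift n : measurable_fun setT (shift n).
Proof. by apply: measurable_to_Omega => i b; exact: measurable_coord. Qed.

HB.instance Definition _ n := isMeasurableFun.Build _ _ _ _ (shift n) (measurable_shift n).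

Lemma measurable_point_Omega (o : Omega) : measurable [set o].
Proof.
rewrite (_ : [set o] = \bigcap_n cyl [seq k%:Z | k <- iota 0 n] o `&` \bigcap_n cyl [seq - k%:Z | k <- iota 0 n] o).
  by apply: measurableI; apply: bigcapT_measurable => n; exact: measurable_cyl.
apply/seteqP; split=> [_ ->|o' [h h']]; first by split=> n _ i.
apply/funext => -[k|k].
  by apply: (h k.+1) => //; apply: map_f; rewrite mem_iota /= ltnSn.
apply: (h' k.+2) => //; rewrite NegzE; apply: (map_f (fun k => - k%:Z)).
by rewrite mem_iota /= ltnSn.
Qed.

Section Coin.
Variable R : realType.

(** The integers being countable, the binary digits of one uniform variable
    provide a coin for each of them. *)
Definition coins (x : measurableTypeR R) : Omega := fun i => digit (pickle i) x.

Lemma measurable_coins : measurable_fun setT coins.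
Proof. by apply: measurable_to_Omega => i b; exact: measurable_digit. Qed.

HB.instance Definition _ := isMeasurableFun.Build _ _ _ _ coins measurable_coins.

Definition bern : probability Omega R := distribution (unif R) coins.

Lemma prod_half (M : seq nat) N : uniq M -> all (fun m => m < N)%N M ->
  \prod_(m < N) (if val m \in M then 2^-1 else 1) = 2^-1 ^+ size M :> R.
Proof.
move=> uM /allP ltM; rewrite -(big_mkord xpredT (fun m => if m \in M then 2^-1 else 1 : R)).
rewrite -big_mkcond -big_filter (perm_big M) /=.
  by elim: M {uM ltM} => [|m M IH]; rewrite ?big_nil ?expr0 // big_cons IH exprS.
apply: uniq_perm => //; first by rewrite filter_uniq // iota_uniq.
move=> m; rewrite mem_filter mem_index_iota; apply: andb_idr => mM.
exact: ltM.
Qed.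

Lemma bern_cyl s w : bern (cyl s w) = (2^-1 ^+ size (undup s))%:E.
Proof.
pose f m := if @pickle_inv int m is Some i then if i \in s then Some (w i) else None else None.
pose N := (\max_(m <- map pickle s) m).+1.
have ltN i : i \in s -> (pickle i < N)%N.
  by move=> si; rewrite ltnS; apply: (leq_bigmax_seq (F := id)) => //; exact: map_f.
have mA : measurable (coins @^-1` cyl s w).
  by rewrite -[X in measurable X]setTI; apply: measurable_coins => //; exact: measurable_cyl.
rewrite /bern /= /distribution /= /pushforward (@unif_pattern R f N _ mA); last first.
  move=> x x0; split=> [h m mN|h i si].
    rewrite /f; have := @pickle_invK int m; case: (@pickle_inv int m) => //= i im.
    by case: ifP => // si /=; rewrite -im -(h i si).
  have := h _ (ltN i si); rewrite /f pickleK_inv si /=; exact/eqP.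
congr EFin; rewrite -(size_map pickle) -(@prod_half (map pickle (undup s)) N).
- apply: eq_bigr => m _; rewrite /f.
  have := @pickle_invK int m; case E: (@pickle_inv int m) => [i|] /=.
    move=> <-; rewrite mem_map; last exact: pcan_inj pickleK_inv.
    by rewrite mem_undup; case: ifP.
  move=> _; case: ifP => // /mapP[i _ mi].
  by move: E; rewrite mi pickleK_inv.
- by rewrite map_inj_uniq ?undup_uniq //; exact: pcan_inj pickleK_inv.
- by apply/allP => _ /mapP[i si ->]; apply: ltN; rewrite -mem_undup.
Qed.

Lemma bern_shift n A : measurable A -> bern (shift n @^-1` A) = bern A.
Proof.
move=> mA; rewrite -[LHS]/(distribution bern (shift n) A).
apply: cyl_unique mA => [|s w].
  exact: le_lt_trans (probability_le1 _ measurableT) (ltry 1).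
rewrite -[LHS]/(bern (shift n @^-1` cyl s w)) -[RHS]/(bern (cyl s w)).
rewrite shift_cyl !bern_cyl undup_map_inj ?size_map //.
exact: addIr.
Qed.

Lemma bern_point (o : Omega) : bern [set o] = 0%E.
Proof.
apply/eqP; rewrite eq_le measure_ge0 andbT.
apply/lee_addgt0Pr => e e0; rewrite add0e.
have [n ne] : exists n, 2^-1 ^+ n <= e :> R.
  exists (Num.truncn e^-1).+1; rewrite exprVn invf_ple ?posrE ?exprn_gt0 //.
  apply: ltW; apply: (lt_le_trans (truncnS_gt _)).
  by rewrite -natrX ler_nat; exact: (ltnW (ltn_expl (Num.truncn e^-1).+1 (isT : (1 < 2)%N))).
pose s := [seq k%:Z | k <- iota 0 n].
have szs : size (undup s) = n.
  by rewrite undup_id ?size_map ?size_iota // map_inj_uniq ?iota_uniq // => i j [].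
apply: (@le_trans _ _ (bern (cyl s o))); last by rewrite bern_cyl szs lee_fin.
by apply: le_measure; rewrite ?inE //; [exact: measurable_point_Omega|exact: measurable_cyl|move=> _ -> i].
Qed.

Definition pr (A : set Omega) : R := fine (bern A).

Lemma prE A : measurable A -> bern A = (pr A)%:E.
Proof. by move=> mA; rewrite /pr fineK // fin_num_measure. Qed.

Lemma pr_ge0 A : 0 <= pr A.
Proof. by rewrite fine_ge0 // measure_ge0. Qed.

Lemma pr_le A B : measurable A -> measurable B -> A `<=` B -> pr A <= pr B.
Proof. by move=> mA mB AB; rewrite -lee_fin -!prE // le_measure ?inE. Qed.

Lemma prT : pr setT = 1. Proof. by rewrite /pr probability_setT. Qed.
Lemma pr0 : pr set0 = 0. Proof. by rewrite /pr measure0. Qed.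

Lemma pr_le1 A : measurable A -> pr A <= 1.
Proof. by move=> mA; rewrite -prT; apply: pr_le. Qed.

Lemma prU A B : measurable A -> measurable B -> A `&` B = set0 -> pr (A `|` B) = pr A + pr B.
Proof.
move=> mA mB AB; apply: EFin_inj; rewrite EFinD -!prE //; last exact: measurableU.
exact: measureU.
Qed.

Lemma prID A B : measurable A -> measurable B -> pr A = pr (A `&` B) + pr (A `\` B).
Proof.
move=> mA mB; rewrite -prU ?setUIDK //; first exact: measurableI.
  exact: measurableD.
by rewrite setDE setIACA setICr setI0.
Qed.

Lemma pr_shift n A : measurable A -> pr (shift n @^-1` A) = pr A.
Proof. by move=> mA; rewrite /pr bern_shift. Qed.

Lemma measurable_shift_pre n (A : set Omega) : measurable A -> measurable (shift n @^-1` A).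
Proof. by move=> mA; rewrite -[X in measurable X]setTI; exact: measurable_shift. Qed.

(** Cylinders with disjoint supports are independent, and a large translation
    separates the supports. *)
Lemma bern_mixing_cyl s w s' w' : exists N : nat, forall n : nat, (N <= n)%N ->
  pr (cyl s w `&` shift n%:Z @^-1` cyl s' w') = pr (cyl s w) * pr (cyl s' w').
Proof.
pose N := (\max_(i <- s) `|i| + \max_(i <- s') `|i|).+1%N.
exists N => n Nn; rewrite shift_cyl; set s2 := map _ s'; set w2 := fun i => _.
have dis i : i \in s -> i \in s2 -> False.
  move=> si /mapP[j sj ij].
  have h1 : (`|i| <= \max_(i <- s) `|i|)%N by apply: (leq_bigmax_seq (F := absz)).
  have h2 : (`|j| <= \max_(i <- s') `|i|)%N by apply: (leq_bigmax_seq (F := absz)).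
  by move: Nn; rewrite /N; lia.
pose w3 i := if i \in s then w i else w2 i.
have -> : cyl s w `&` cyl s2 w2 = cyl (s ++ s2) w3.
  apply/seteqP; split=> o.
    move=> [h1 h2] i; rewrite mem_cat /w3; case: ifP => [si _|_ /= si]; first exact: h1.
    exact: h2.
  move=> h; split=> i si; rewrite h ?mem_cat ?si ?orbT // /w3.
    by rewrite si.
  by case: ifP => // si'; case: (dis i).
rewrite /pr !bern_cyl /= -exprD; congr (_ ^+ _).
rewrite undup_cat size_cat [X in (size X + _)%N](_ : _ = undup s); last first.
  by apply/all_filterP/allP => i si; apply/negP; apply: dis; rewrite -mem_undup.
by rewrite undup_map_inj ?size_map //; exact: addIr.
Qed.

Definition mixes (B : set Omega) (A : set Omega) : Prop :=
  forall e : R, 0 < e -> exists N : nat, forall n : nat, (N <= n)%N ->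
    `|pr (A `&` shift n%:Z @^-1` B) - pr A * pr B| <= e.

(** Mixing against a cylinder passes to complements, disjoint unions and limits,
    so the pi-lambda theorem extends it from cylinders to all events. *)
Lemma mixes_cyl s w A : measurable A -> mixes (cyl s w) A.
Proof.
set B := cyl s w; have mB : measurable (B : set Omega) by exact: measurable_cyl.
pose S (n : nat) := shift n%:Z @^-1` B.
have mS n : measurable (S n) by exact: measurable_shift_pre.
have pS n : pr (S n) = pr B by exact: pr_shift.
have disjU A1 A2 : measurable A1 -> measurable A2 -> A1 `&` A2 = set0 ->
    mixes B A1 -> mixes B A2 -> mixes B (A1 `|` A2).
  move=> m1 m2 d12 h1 h2 e e0.
  have e20 : 0 < e / 2 by rewrite divr_gt0.
  have [N1 H1] := h1 _ e20; have [N2 H2] := h2 _ e20.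
  exists (maxn N1 N2) => n; rewrite geq_max => /andP[n1 n2].
  rewrite setIUl (prU m1 m2 d12) prU;
    [|exact: (measurableI _ _ m1 (mS n))|exact: (measurableI _ _ m2 (mS n))|].
    rewrite (_ : _ - _ = (pr (A1 `&` S n) - pr A1 * pr B) +
      (pr (A2 `&` S n) - pr A2 * pr B)); last by rewrite /S; ring.
    apply: (le_trans (ler_normD _ _)); have := H1 n n1; have := H2 n n2; rewrite -/(S n).
    by lra.
  by rewrite setIACA d12 set0I.
apply: (@dynkin_induction _ Omega cyls) => //.
- exact: cyls_setI.
- by move=> e e0; exists 0%N => n _; rewrite setTI prT mul1r pS subrr normr0 ltW.
- move=> _ [->|[s' [w' ->]]] e e0.
    by exists 0%N => n _; rewrite set0I pr0 mul0r subrr normr0 ltW.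
  have [N HN] := bern_mixing_cyl s' w' s w.
  by exists N => n Nn; rewrite HN // subrr normr0 ltW.
- move=> {}A mA hA e e0; have [N HN] := hA e e0; exists N => n Nn.
  have h1 : pr (~` A) = 1 - pr A.
    by have := @prID setT A measurableT mA; rewrite setTI setTD prT; lra.
  have h2 : pr (~` A `&` S n) = pr B - pr (A `&` S n).
    by rewrite [~` A `&` _]setIC -setDE -(pS n) (prID (mS n) mA) [S n `&` A]setIC; ring.
  rewrite -/(S n) h1 h2 (_ : pr B - _ - _ = - (pr (A `&` S n) - pr A * pr B)); last by ring.
  by rewrite normrN; exact: HN.
- move=> F mF tF hF e e0.
  have e30 : 0 < e / 3 by rewrite divr_gt0.
  pose U k := \big[setU/set0]_(i < k) F i.
  have mU k : measurable (U k) by apply: bigsetU_measurable.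
  have mUU : measurable (\bigcup_k F k) by exact: bigcupT_measurable.
  have hU k : mixes B (U k).
    elim: k => [|k IH]; rewrite /U ?big_ord0 ?big_ord_recr /=.
      by move=> d d0; exists 0%N => n _; rewrite set0I pr0 mul0r subrr normr0 ltW.
    apply: disjU => //; first exact: mU.
    rewrite -bigcup_mkord; apply/seteqP; split=> // x [[i /= ik Fi] Fk].
    by have ij := tF i k I I (ex_intro _ x (conj Fi Fk)); rewrite ij ltnn in ik.
  have UF : \bigcup_k U k = \bigcup_k F k.
    apply/seteqP; split=> x [k _].
      by rewrite /U -bigcup_mkord => -[i _ Fi]; exists i.
    by move=> Fk; exists k.+1 => //; rewrite /U -bigcup_mkord; exists k => /=.
  (* A disjoint union is approximated by a finite one up to e / 3. *)
  have [k Hk] : exists k, pr (\bigcup_k F k) - pr (U k) <= e / 3.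
    have c : bern \o U @ \oo --> (pr (\bigcup_k F k))%:E.
      rewrite -prE // -UF; apply: nondecreasing_cvg_mu => //; first by rewrite UF.
      move=> i j ij; apply/subsetPset; rewrite /U -!bigcup_mkord => x [l /= li Fl].
      by exists l => //=; exact: leq_trans ij.
    have /cvgrPdist_le/(_ _ e30)[k _ hk] := fine_cvg (FF := eventually_filter) c.
    by exists k; have := hk k (leqnn k); apply: le_trans; rewrite ler_norm.
  have Usub : U k `<=` \bigcup_k F k by rewrite -UF => x Ux; exists k.
  have [N HN] := hU k _ e30; exists N => n Nn; have := HN n Nn; rewrite -/(S n).
  set A' := \bigcup_k F k in Hk Usub *.
  have a1 := @prID (A' `&` S n) (U k) (measurableI _ _ mUU (mS n)) (mU k).
  have a2 : (A' `&` S n) `&` U k = U k `&` S n.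
    by rewrite setIAC (setIidr Usub).
  have a3 : pr ((A' `&` S n) `\` U k) <= e / 3.
    apply: le_trans Hk; have := @prID A' (U k) mUU (mU k); rewrite (setIidr Usub) => ->.
    rewrite [pr (U k) + _]addrC addrK; apply: pr_le; [|exact: measurableD|].
      by apply: measurableD => //; exact: measurableI.
    by move=> x [[]].
  have a4 := pr_ge0 ((A' `&` S n) `\` U k).
  have a5 : pr (U k) <= pr A' by exact: pr_le.
  have b0 := pr_ge0 B; have b1 := pr_le1 mB.
  rewrite a1 a2 !ler_norml => /andP[c1 c2].
  have a6 : 0 <= (pr A' - pr (U k)) * pr B by rewrite mulr_ge0 // subr_ge0.
  have a7 : (pr A' - pr (U k)) * pr B <= e / 3.
    by apply: le_trans Hk; rewrite ler_piMr // subr_ge0.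
  by apply/andP; split; lra.
Qed.

(** Mixing makes a translation-invariant event independent of all cylinders, hence
    of itself. *)
Theorem bern_ergodic A : measurable A -> shift 1 @^-1` A = A -> pr A = 0 \/ pr A = 1.
Proof.
move=> mA inv.
have invn (n : nat) : shift n%:Z @^-1` A = A.
  elim: n => [|n IH].
    suff -> : shift 0 = id by [].
    by apply/funext => o; apply/funext => i; rewrite /shift addr0.
  suff -> : shift n.+1%:Z = shift n%:Z \o shift 1.
    by rewrite comp_preimage IH inv.
  by apply/funext => o; apply/funext => i; rewrite /shift /= intS [1 + _]addrC addrA.
have ind s w : pr (A `&` cyl s w) = pr A * pr (cyl s w).
  have mC : measurable (cyl s w : set Omega) by exact: measurable_cyl.
  apply/eqP; rewrite -subr_eq0 -normr_le0; apply/ler_addgt0Pr => e e0.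
  rewrite add0r; have [N HN] := mixes_cyl s w mA e0.
  have := HN N (leqnn N); rewrite -{1}(invn N) -preimage_setI pr_shift //.
  exact: measurableI.
have prod B : measurable B -> bern (B `&` A) = ((pr A)%:E * bern B)%E.
  move=> mB.
  apply: (@cyl_unique R (mrestr bern mA) (mscale (NngNum (pr_ge0 A)) bern) _ _ B mB).
    exact: le_lt_trans (probability_le1 bern (measurableI _ _ measurableT mA)) (ltry 1).
  move=> s w; have mC : measurable (cyl s w : set Omega) by exact: measurable_cyl.
  have e : bern (A `&` cyl s w) = ((pr A)%:E * bern (cyl s w))%E.
    by rewrite prE ?ind ?EFinM -?prE //; exact: measurableI.
  by rewrite setIC in e.
have : pr A = pr A * pr A.
  have e := prod A mA; rewrite setIid prE // -EFinM in e.
  exact: EFin_inj e.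
move/eqP; rewrite -subr_eq0 -{1}[pr A]mulr1 -mulrBr mulf_eq0 => /orP[/eqP|]; first by left.
by rewrite subr_eq0 => /eqP <-; right.
Qed.
End Coin.

(** * The Chabauty space *)

Section BooleanProduct.
Variable I : eqType.
Implicit Type f : {ptws I -> bool}.

Lemma nbhs_coordinate f i : nbhs f [set g : {ptws I -> bool} | g i = f i].
Proof.
have := @proj_continuous I (fun=> bool) i f.
by move=> /(_ [set f i]); apply; rewrite nbhs_principalE; apply/principal_filterP.
Qed.

Lemma nbhs_agree f (s : seq I) :
  nbhs f [set g : {ptws I -> bool} | forall i, i \in s -> g i = f i].
Proof.
elim: s => [|i s IH]; first by apply: filterS filterT => g.
apply: filterS (filterI (nbhs_coordinate f i) IH) => g [gi gs] j.
by rewrite inE => /orP[/eqP->|]; [exact: gi|exact: gs].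
Qed.

Lemma cvg_coordinatewise (F : set_system {ptws I -> bool}) f : Filter F ->
  (forall i, F [set g | g i = f i]) -> F --> f.
Proof.
move=> FF h; apply/cvg_sup => i U [V [[W oW <-]] /= Wf VU].
by apply: filterS (h i) => g gi; apply: VU; rewrite /= /proj gi.
Qed.

(** The sets of sequences agreeing with f at finitely many places form a filter
    that converges to f, coordinate by coordinate. *)
Lemma nbhs_contains_agree f U : nbhs f U ->
  exists s : seq I, [set g : {ptws I -> bool} | forall i, i \in s -> g i = f i] `<=` U.
Proof.
pose F : set_system {ptws I -> bool} := filter_from setT
  (fun s : seq I => [set g : {ptws I -> bool} | forall i, i \in s -> g i = f i]).
have FF : Filter F.
  apply: filter_from_filter; first by exists [::].
  move=> s t _ _; exists (s ++ t) => // g h.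
  by split=> i hi; apply: h; rewrite mem_cat hi ?orbT.
have Ff : F --> f.
  by apply: cvg_coordinatewise => i; exists [:: i] => // g; apply; rewrite inE.
by move=> /Ff[s _ sU]; exists s.
Qed.
End BooleanProduct.

(** An open set is a union of cylinders, of which there are countably many. *)
Lemma open_measurable_Omega (U : set {ptws int -> bool}) : open U ->
  measurable (U : set Omega).
Proof.
move=> oU.
pose C (l : seq (int * bool)) : set Omega := [set o | forall p, p \in l -> o p.1 = p.2].
have mC l : measurable (C l).
  rewrite (_ : C l = \bigcap_(p in [set` l]) [set o : Omega | o p.1 = p.2]).
    by apply: fin_bigcap_measurable => // p _; exact: measurable_coord.
  by apply/seteqP; split=> o h p; exact: h.
rewrite (_ : (U : set Omega) = \bigcup_(l in [set l | C l `<=` U]) C l).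
  rewrite bigcup_mkcond; apply: countable_bigcupT_measurable => [|l]; first exact: countableP.
  by case: ifP.
apply/seteqP; split=> [|o []]; last by move=> l lU; exact: lU.
move=> o Uo.
have := open_nbhs_nbhs (conj oU Uo) => /nbhs_contains_agree[s sU].
exists [seq (i, o i) | i <- s]; last by move=> _ /mapP[i _ ->].
by move=> o' h; apply: sU => i si; apply: (h (i, o i)); exact: map_f.
Qed.

Section Chabauty.
Variable G : groupType.
Implicit Type H : Defs.Sub G.

Lemma sub_ext H K : (forall g, (g \in sub_pred H) = (g \in sub_pred K)) -> H = K.
Proof. by move=> e; apply: val_inj; apply/funext => g; exact: e. Qed.

Lemma Sub_hausdorff : hausdorff_space (Defs.Sub G).
Proof.
have hB : hausdorff_space {ptws G -> bool}.
  by apply: hausdorff_product => _; exact: discrete_hausdorff.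
move=> H K HK; apply: val_inj; apply: hB => A B nA nB.
have ci := @initial_continuous (Defs.Sub G) {ptws G -> bool}
  (fun H : Defs.Sub G => val H : {ptws G -> bool}).
have := HK _ _ (ci H A nA) (ci K B nB) => -[L [LA LB]].
by exists (val L).
Qed.

(** The Chabauty topology is that of the product: it is enough that membership of
    every element is locally constant. *)
Lemma continuous_to_Sub (X : topologicalType) (F : X -> Defs.Sub G) :
  (forall x g, nbhs x [set y | (g \in sub_pred (F y)) = (g \in sub_pred (F x))]) ->
  continuous F.
Proof.
move=> h; apply: (@continuous_comp_initial (Defs.Sub G) X {ptws G -> bool}
  (fun H : Defs.Sub G => val H : {ptws G -> bool})).
by move=> x; apply: cvg_coordinatewise => g; exact: h.
Qed.

Lemma nbhs_mem H g : nbhs H [set K | (g \in sub_pred K) = (g \in sub_pred H)].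
Proof.
have ci := @initial_continuous (Defs.Sub G) {ptws G -> bool}
  (fun H : Defs.Sub G => val H : {ptws G -> bool}).
exact: ci H _ (nbhs_coordinate (val H) g).
Qed.

Lemma conj_sub_continuous g : continuous (@conj_sub G g).
Proof. by apply: continuous_to_Sub => H x; exact: nbhs_mem. Qed.

Lemma measurable_conj_sub g : measurable_fun setT (@conj_sub G g : BorelSub G -> BorelSub G).
Proof.
apply: (@measurability _ _ (BorelSub G) (BorelSub G) setT _ (@open (Defs.Sub G))) => //.
move=> _ [U oU <-]; rewrite setTI; apply: sub_sigma_algebra.
by move: U oU; apply/continuousP; exact: conj_sub_continuous.
Qed.

Lemma closed_measurable_Sub (C : set (Defs.Sub G)) : closed C -> measurable (C : set (BorelSub G)).
Proof.
by move=> cC; rewrite -[C]setCK; apply: measurableC; apply: sub_sigma_algebra; exact: closed_openC.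
Qed.

Lemma measurable_point (H : BorelSub G) : measurable [set H].
Proof.
apply: closed_measurable_Sub; apply: accessible_closed_set1.
exact: hausdorff_accessible Sub_hausdorff.
Qed.

Lemma measurable_from_Omega (F : {ptws int -> bool} -> Defs.Sub G) : continuous F ->
  measurable_fun setT (F : Omega -> BorelSub G).
Proof.
move=> /continuousP cF.
apply: (@measurability _ _ Omega (BorelSub G) setT _ (@open (Defs.Sub G))) => //.
by move=> _ [U oU <-]; rewrite setTI; apply: open_measurable_Omega; exact: cF.
Qed.

(** The image of a compact space in a Hausdorff one is closed. *)
Lemma measurable_range (F : {ptws int -> bool} -> Defs.Sub G) : continuous F ->
  measurable (range F : set (BorelSub G)).
Proof.
move=> cF; apply: closed_measurable_Sub; apply: compact_closed; first exact: Sub_hausdorff.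
apply: continuous_compact; first exact: continuous_subspaceT.
have := @tychonoff int (fun=> bool) (fun=> setT) (fun=> bool_compact).
by congr (compact _); apply/seteqP; split.
Qed.
End Chabauty.

(** * The random stabiliser *)

(** A word visits finitely many blocks and depends only on their coins. *)
Lemma act_local omega w x : exists l : seq int, forall omega' : int -> bool,
  (forall i, i \in l -> omega' i = omega i) ->
  act (move omega') w x = act (move omega) w x.
Proof.
elim: w => [|i w [l hl]]; first by exists [::].
exists ((act (move omega) w x).1 :: l) => omega' h /=.
rewrite hl => [|j jl]; last by apply: h; rewrite inE jl orbT.
by rewrite /move h // mem_head.
Qed.

Lemma act_shift n omega w m k :
  act (move (shift n omega)) w (m, k) =
  ((act (move omega) w (m + n, k)).1 - n, (act (move omega) w (m + n, k)).2).
Proof.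
elim: w => [|i w IH]; first by rewrite /= addrK.
by rewrite /= IH /move /shift /= subrK addrAC.
Qed.

Lemma tile_perm b (i : 'I_3) : perm_eq [seq tile b i k | k <- tiles] tiles.
Proof. by case: i => [[|[|[|i]]]] // ?; case: b; vm_compute. Qed.

Section RandomSubgroup.
Variables (G : groupType) (s : 'I_3 -> G) (sP : coxeter_generators s).

Definition stab_sub (x : place) (omega : {ptws int -> bool}) : Defs.Sub G :=
  mk_sub (stab_closed sP omega x).

Lemma mem_stab_sub x omega g : (g \in sub_pred (stab_sub x omega)) = (gact sP (move omega) g x == x).
Proof. by []. Qed.

Lemma conj_stab_sub g x omega :
  conj_sub g (stab_sub x omega) = stab_sub (gact sP (move omega) g x) omega.
Proof. by apply: sub_ext => h; exact: stabJ. Qed.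

Lemma stab_sub_shift n k omega : stab_sub (0, k) (shift n omega) = stab_sub (n, k) omega.
Proof.
apply: sub_ext => g; rewrite !mem_stab_sub /gact act_shift add0r.
set y := act _ _ _; rewrite /eq_op /= subr_eq0; by [].
Qed.

Lemma stab_sub_continuous x : continuous (stab_sub x).
Proof.
apply: continuous_to_Sub => omega g.
have [l hl] := act_local omega (word_of sP g) x.
by apply: filterS (nbhs_agree omega l) => omega' /hl h; rewrite /= !mem_stab_sub /gact h.
Qed.

(** The same function as [stab_sub], between measurable spaces instead of
    topological ones. *)
Definition rand_sub (x : place) : Omega -> BorelSub G := stab_sub x.

Lemma measurable_rand_sub x : measurable_fun setT (rand_sub x).
Proof. exact: measurable_from_Omega (@stab_sub_continuous x). Qed.

HB.instance Definition _ x :=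
  isMeasurableFun.Build _ _ _ _ (rand_sub x) (measurable_rand_sub x).

Variable R : realType.

Definition irs : set (BorelSub G) -> \bar R :=
  mscale (20^-1)%:nng (msum (fun k => distribution (bern R) (rand_sub (0, k))) 20).

HB.instance Definition _ := Measure.on irs.

Lemma irsE (A : set (BorelSub G)) : measurable A ->
  irs A = (20^-1 * \sum_(k <- tiles) pr R (rand_sub (0, k) @^-1` A))%:E.
Proof.
move=> mA; rewrite /irs /= /mscale /= /msum EFinM; congr (_ * _)%E.
rewrite -sumEFin -[tiles]/(index_iota 0 20) big_mkord; apply: eq_bigr => k _.
by rewrite -prE // -[X in measurable X]setTI; exact: measurable_rand_sub.
Qed.

Lemma irs_setT : irs setT = 1%E.
Proof.
rewrite irsE // (eq_bigr (fun=> 1)) => [|k _]; last by rewrite preimage_setT prT.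
by rewrite -[tiles]/(index_iota 0 20) sumr_const_nat subn0 mulVf ?pnatr_eq0.
Qed.

HB.instance Definition _ := Measure_isProbability.Build _ _ _ irs irs_setT.

Definition irs_prob : probability (BorelSub G) R := irs.

Lemma measurable_event x (A : set (BorelSub G)) : measurable A ->
  measurable (rand_sub x @^-1` A).
Proof. by move=> mA; rewrite -[X in measurable X]setTI; exact: measurable_rand_sub. Qed.

Lemma event_shift n k (A : set (BorelSub G)) :
  rand_sub (n, k) @^-1` A = shift n @^-1` (rand_sub (0, k) @^-1` A).
Proof. by apply/seteqP; split=> omega; rewrite /= /rand_sub stab_sub_shift. Qed.

(** For the generator 0 the moved triangle does not depend on the coins, except
    that it may be in a neighbouring block, which a translation corrects. For the
    other generators the triangle stays in block 0, and given the coin of that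
    block the twenty triangles are permuted. *)
Lemma irs_invariant_gen i (A : set (BorelSub G)) : measurable A ->
  irs (conj_sub (s i) @^-1` A) = irs A.
Proof.
move=> mA; pose E x := rand_sub x @^-1` A.
have mE x : measurable (E x) by exact: measurable_event.
have mconj : measurable (conj_sub (s i) @^-1` A : set (BorelSub G)).
  by rewrite -[X in measurable X]setTI; exact: measurable_conj_sub.
rewrite !irsE //; congr EFin; congr (_ * _).
pose moved k : set Omega := [set omega | E (move omega i (0, k)) omega].
have -> : \sum_(k <- tiles) pr R (rand_sub (0, k) @^-1` (conj_sub (s i) @^-1` A)) =
    \sum_(k <- tiles) pr R (moved k).
  apply: eq_bigr => k _; congr (pr R _); apply/seteqP; split=> omega;
    by rewrite /moved /E /= /rand_sub conj_stab_sub (gacts sP (move_action omega)).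
have [i0|i0] := eqVneq i 0.
  have tile0 b k : tile b i k = tile true i k by rewrite i0; case: b.
  rewrite -[RHS](perm_big _ (tile_perm true i)) big_map; apply: eq_bigr => k _.
  rewrite -(pr_shift R (jump i k) (mE (0, tile true i k))) -event_shift.
  congr (pr R _); apply/seteqP; split=> omega; by rewrite /moved /move /= tile0 add0r.
pose C b : set Omega := [set omega | omega 0 = b].
have mC b : measurable (C b) by exact: measurable_coord.
have CC : ~` C true = C false.
  by apply/seteqP; split=> omega; rewrite /C /=; case: (omega 0).
have movedE b k : moved k `&` C b = E (0, tile b i k) `&` C b.
  have j0 : jump i k = 0 by rewrite /jump -[(_ == 0)%N]/(i == 0) (negPf i0).
  by apply/seteqP; split=> omega [h o0]; split=> //; move: h; rewrite /moved /move /= o0 j0 addr0.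
have mM k : measurable (moved k).
  rewrite -[moved k](setUIDK _ (C true)) setDE CC !movedE.
  by apply: measurableU; apply: measurableI.
have split_bit (B : set Omega) : measurable B ->
    pr R B = pr R (B `&` C true) + pr R (B `&` C false).
  by move=> mB; rewrite (prID R mB (mC true)) setDE CC.
rewrite (eq_bigr (fun k => pr R (E (0, tile true i k) `&` C true)
    + pr R (E (0, tile false i k) `&` C false))); last first.
  by move=> k _; rewrite split_bit // !movedE.
rewrite [RHS](eq_bigr (fun k => pr R (E (0, k) `&` C true) + pr R (E (0, k) `&` C false))); last first.
  by move=> k _; exact: split_bit (mE (0, k)).
rewrite !big_split /=; congr (_ + _).
  rewrite -[RHS](perm_big _ (tile_perm true i)) big_map; exact: eq_bigr.
rewrite -[RHS](perm_big _ (tile_perm false i)) big_map; exact: eq_bigr.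
Qed.

Lemma conj_subM (g h : G) : conj_sub (g * h)%g = @conj_sub G g \o conj_sub h.
Proof. by apply/funext => H; apply: sub_ext => x; rewrite -[LHS]/((x ^ (g * h))%g \in sub_pred H) conjgM. Qed.

Lemma conj_sub1 (H : Defs.Sub G) : conj_sub 1%g H = H.
Proof. by apply: sub_ext => x; rewrite -[LHS]/((x ^ 1)%g \in sub_pred H) conjg1. Qed.

Lemma irs_invariant : is_irs irs_prob.
Proof.
move=> g A mA; have [w ->] := gen_span sP g; elim: w A mA => [|i w IH] A mA /=.
  suff -> : conj_sub 1%g @^-1` A = A by [].
  by apply/seteqP; split=> H; rewrite /= conj_sub1.
rewrite conj_subM comp_preimage IH; first exact: irs_invariant_gen.
by rewrite -[X in measurable X]setTI; exact: measurable_conj_sub.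
Qed.

(** The pattern of the argument: an invariant event does not depend on the triangle
    by [block_path], and [next_block] makes it invariant under translation. *)
Lemma irs_ergodic : ergodic irs_prob.
Proof.
move=> A mA inv; pose E x := rand_sub x @^-1` A.
have mE x : measurable (E x) by exact: measurable_event.
have inA (g : G) H : A (conj_sub g H) = A H by rewrite -[in RHS](inv g).
have moveE omega w x : E (act (move omega) w x) omega = E x omega.
  rewrite /E /= -(inA (evalw s w) (rand_sub x omega)) /rand_sub conj_stab_sub.
  by rewrite (gact_ev sP (move_action omega)).
have E0 k : (k < 20)%N -> E (0, k) = E (0, 0%N).
  move=> k20; apply/seteqP; split=> omega; have [w hw] := block_path (omega 0) k20;
    by have := moveE omega w (0, 0%N); rewrite hw // => ->.
have inv1 : shift 1 @^-1` E (0, 0%N) = E (0, 0%N).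
  rewrite -event_shift -/(E _) -[in RHS](E0 19%N) //; apply/seteqP; split=> omega;
    by have := moveE omega [:: 0] (0, 19%N); rewrite /= next_block add0r => ->.
rewrite /irs_prob /= irsE //.
have -> : \sum_(k <- tiles) pr R (rand_sub (0, k) @^-1` A) = 20 * pr R (E (0, 0%N)).
  rewrite (eq_big_seq (fun=> pr R (E (0, 0%N)))) => [|k].
    by rewrite -[tiles]/(index_iota 0 20) sumr_const_nat subn0 mulr_natl.
  by rewrite mem_iota => k20; rewrite -/(E _) E0.
rewrite mulrA mulVf ?pnatr_eq0 // mul1r.
by have [->|->] := bern_ergodic R (mE (0, 0%N)) inv1; [left|right].
Qed.
End RandomSubgroup.

(** * Diffuseness *)

Lemma isomorphic_refl (G : groupType) (H : Defs.Sub G) : isomorphic H H.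
Proof. by exists id; do !split=> //; move=> x Hx; exists x. Qed.

Lemma isomorphic_cancel (G : groupType) (H K L : Defs.Sub G) :
  isomorphic H K -> isomorphic H L -> isomorphic K L.
Proof.
move=> [f [[fK f_inj f_onto] fM]] [g [[gL g_inj g_onto] gM]].
have /choice[f' f'P] v : exists u, v \in sub_pred K -> u \in sub_pred H /\ f u = v.
  have [vK|] := boolP (v \in sub_pred K); last by exists 1%g.
  by have [u uH fu] := f_onto v vK; exists u.
have f'M : {in sub_pred K &, {morph f' : x y / (x * y)%g}}.
  move=> x y xK yK.
  have mul (P : Defs.Sub G) a b : a \in sub_pred P -> b \in sub_pred P -> (a * b)%g \in sub_pred P.
    have [P1 PD] : group_closed (sub_pred P) by exact: set_valP.
    by move=> aP bP; rewrite -[b]invgK; apply: (PD) => //; rewrite -[b^-1%g]mul1g; exact: PD.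
  have [hx fx] := f'P x xK; have [hy fy] := f'P y yK.
  have [hxy fxy] := f'P _ (mul K x y xK yK).
  apply: f_inj; rewrite ?inE //=; first exact: mul.
  by rewrite fxy fM // fx fy.
exists (g \o f'); split; last first.
  move=> x y xK yK /=; rewrite f'M //.
  by rewrite gM //; [have [] := f'P x xK|have [] := f'P y yK].
split.
- by move=> v vK /=; apply: gL; have [] := f'P v vK.
- move=> x y; rewrite !inE /= => xK yK e.
  have [hx fx] := f'P x xK; have [hy fy] := f'P y yK.
  by rewrite -fx -fy; congr f; apply: g_inj e; rewrite inE.
- move=> w wL; have [u uH gu] := g_onto w wL.
  have fuK : f u \in sub_pred K by exact: fK.
  have [h1 h2] := f'P _ fuK.
  exists (f u) => //=; rewrite -gu; congr g.
  by apply: f_inj h2; rewrite inE.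
Qed.

(** The coins recovered from the corners of omega after a translation or a flip of
    the chain. *)
Definition decode (omega : int -> bool) (cb : int * bool) : int -> bool :=
  fun n => ~~ right_angled omega (if cb.2 then 5 * n - cb.1 else cb.1 - 5 * n).

Section Diffuse.
Variables (R : realType) (G : groupType) (s : 'I_3 -> G) (sP : coxeter_generators s).

Lemma isomorphic_decode x y omega omega' : (x.2 < 20)%N -> (y.2 < 20)%N ->
  isomorphic (stab_sub sP x omega) (stab_sub sP y omega') -> exists cb, omega' = decode omega cb.
Proof.
move=> x20 y20 [f [[fK f_inj f_onto] fM]].
have [||||c hc] := @rigidity R _ (sqrt2_gt0 R) (sqrt2_sq R) _ _ sP omega omega' x y x20 y20 f.
- exact: fK.
- by move=> v vK; have [u uH fu] := f_onto v vK; exists u.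
- by move=> u v uH vH; apply: f_inj; rewrite inE.
- exact: fM.
case: hc => hc.
  exists (c, true); apply/funext => n.
  by rewrite bit_of_corner /decode /= -hc addrC subrK.
exists (c, false); apply/funext => n.
by rewrite bit_of_corner /decode /= -hc; congr (~~ right_angled _ _); ring.
Qed.

Lemma bern_countable (I : countType) (f : I -> Omega) (A : set Omega) :
  measurable A -> A `<=` range f -> bern R A = 0%E.
Proof.
move=> mA Af; apply/negligibleP => //.
pose F n : set Omega := [set o | exists2 i : I, pickle_inv n = Some i & o = f i].
apply: (@negligibleS _ _ _ _ (\bigcup_n F n)).
  by move=> o /Af[i _ <-]; exists (pickle i) => //; exists i; rewrite ?pickleK_inv.
apply: negligible_bigcup => n.
rewrite /F; case: (@pickle_inv I n) => [i|]; last by apply: negligibleS (negligible_set0 _) => o [].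
exists [set f i]; split; [exact: measurable_point_Omega|exact: bern_point|].
by move=> o [j [->] ->].
Qed.

(** Inside the Borel set [I] of all stabilisers, an isomorphism class is contained
    in the countable set [D] of the stabilisers whose coins are decoded from those
    of one of its members. The set [D] is null because a sequence of coins whose stabiliser
    is in [D] is itself decoded from a decoded sequence. *)
Lemma irs_diffuse : diffuse (irs_prob sP R).
Proof.
move=> H _.
pose I : set (BorelSub G) := \bigcup_(k < 20) range (stab_sub sP (0, k)).
have mI : measurable (I : set (BorelSub G)).
  apply: bigcup_measurable => k _; apply: measurable_range; exact: stab_sub_continuous.
have muI : irs_prob sP R (~` I) = 0%E.
  rewrite /irs_prob /= irsE; last exact: measurableC.
  rewrite big_seq big1 ?mulr0 // => k; rewrite mem_iota => k20.
  suff -> : rand_sub sP (0, k) @^-1` (~` I) = set0 by rewrite pr0.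
  by apply/seteqP; split=> // omega; apply; exists k.
have nI : (irs_prob sP R).-negligible (~` I) by exists (~` I); split=> //; exact: measurableC.
have [[[k0 omega0] /= [k020 iso0]]|none] :=
    pselect (exists p : nat * Omega, (p.1 < 20)%N /\ isomorphic H (stab_sub sP (0, p.1) p.2)); last first.
  apply: negligibleS nI => K HK [k k20 [omega _ e]].
  by apply: none; exists (k, omega); rewrite /= e.
pose D : set (BorelSub G) := \bigcup_(p : 'I_20 * (int * bool)) [set stab_sub sP (0, val p.1) (decode omega0 p.2)].
have mD : measurable (D : set (BorelSub G)).
  by apply: countable_bigcupT_measurable => [|p]; [exact: countableP|exact: measurable_point].
have muD : irs_prob sP R D = 0%E.
  rewrite /irs_prob /= irsE // big_seq big1 ?mulr0 // => k; rewrite mem_iota => k20.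
  apply: EFin_inj; rewrite -prE; last exact: measurable_event.
  apply: (@bern_countable _ (fun p => decode (decode omega0 p.1) p.2)); first exact: measurable_event.
  move=> omega [[l p] _ e].
  (* Equal subgroups are isomorphic, so rigidity applies once more. *)
  have [|||q ->] := @isomorphic_decode (0, val l) (0, k) (decode omega0 p) omega => //.
    - exact: ltn_ord.
    - by rewrite -[stab_sub sP (0, k) omega]/(rand_sub sP (0, k) omega) e; exact: isomorphic_refl.
  by exists (p, q).
apply: (@negligibleS _ _ _ _ (~` I `|` D)); last first.
  by apply: negligibleU nI _; exists D; split.
move=> K HK; have [IK|] := pselect (I K); last by left.
right; have [k k20 [omega _ e]] := IK; rewrite -e in HK *.
have [|||cb ->] := @isomorphic_decode (0, k0) (0, k) omega0 omega => //.
  exact: isomorphic_cancel iso0 HK.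
by exists (Ordinal (k20 : (k < 20)%N), cb).
Qed.
End Diffuse.

Theorem theorem1 (R : realType) (T : 'I_3 -> H2 R) (hT : is_T4 T) :
  exists mu : probability (BorelSub (reflection_group T)) R,
    [/\ is_irs mu, ergodic mu & diffuse mu].
Proof.
exists (irs_prob (gen_generators hT) R).
split; [exact: irs_invariant|exact: irs_ergodic|exact: irs_diffuse].
Qed.
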